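(* Let $\mu$ be a probability measure on $[c]=\{1,\ldots,c\}$ with $\mu_r:=\mu(\{r\})>0$ for all $r\in[c]$, and $X_1,\ldots,X_n\stackrel{i.i.d.}{\sim}\mu$. Suppose that $\delta_\square(W_{Q_n},W)\to0$ for some $W\in\mathcal{W}$ and $\limsup_{n\to\infty}\|W_{Q_n}\|_{q\Delta}<\infty$ for some $q>1$. Then $N_2(H,Q_n,\mathbf{X})$ satisfies a large deviation principle with speed $n$ and good rate function $$I_2(t)=\inf_{\mathbf{f}\in\mathcal{F}_c:\ G_{2,W}(\mathbf{f})=t}\Big\{\int_{[0,1]}\sum_{r=1}^cf_r(u)\log\frac{f_r(u)}{\mu_r}\,du\Big\}.$$
   Context: Setting: $\mu$ is non-degenerate. $H=(V(H),E(H))$ is a fixed finite graph with vertex set $[v]=\{1,\dots,v\}$, $v\ge2$, and maximum degree $\Delta$. For each $n$, $Q_n$ is a real symmetric $n\times n$ matrix with zero diagonal. With $\mathcal{S}(n,v)$ the set of tuples in $[n]^v$ with pairwise distinct entries, $$N_2(H,Q_n,\mathbf{X})=n^{-v}\sum_{(i_1,\ldots,i_v)\in\mathcal{S}(n,v)}1\{X_{i_1}=X_{i_2}=\cdots=X_{i_v}\}\prod_{(a,b)\in E(H)}Q_n(i_a,i_b).$$ Cut distance: $\mathcal{W}$ is the space of symmetric real-valued functions in $L^1([0,1]^2)$. For $W_1,W_2\in\mathcal{W}$, $d_\square(W_1,W_2)=\sup_{S,T}\big|\int_{S\times T}[W_1(x,y)-W_2(x,y)]\,dx\,dy\big|$ over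 measurable $S,T\subseteq[0,1]$, and $\delta_\square(W_1,W_2)=\inf_\sigma d_\square(W_1^\sigma,W_2)$ over measure preserving bijections $\sigma$ of $[0,1]$, where $W^\sigma(x,y)=W(\sigma(x),\sigma(y))$. For a symmetric $n\times n$ matrix $Q_n$, $W_{Q_n}(x,y)=Q_n(i,j)$ if $\lceil nx\rceil=i,\lceil ny\rceil=j$. $\|\cdot\|_r$ is the $L^r$ norm on $[0,1]^2$. $\mathcal{F}_c$ is the set of measurable $\mathbf{f}=(f_1,\ldots,f_c):[0,1]\to[0,1]^c$ with $\sum_{r=1}^cf_r(x)=1$ for all $x\in[0,1]$, and $$G_{2,W}(\mathbf{f})=\sum_{r\in[c]}\int_{[0,1]^v}\prod_{(a,b)\in E(H)}W(x_a,x_b)\prod_{a=1}^vf_r(x_a)\,dx_a.$$ Convention $0\log0=0$; the infimum over the empty set is $+\infty$. LDP: random variables $T_n$ satisfy an LDP with speed $n$ and good rate function $I$ (values in $[0,\infty]$) if the level sets of $I$ are compact and for every Borel $F$: $-\inf_{F^\circ}I\le\liminf_n\frac1n\log\mathbb{P}(T_n\in F)\le\limsup_n\frac1n\log\mathbb{P}(T_n\in F)\le-\inf_{\bar F}I$. *)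

(* Defs.v *)
From HB Require Import structures.
From mathcomp Require Import all_boot all_order all_algebra.
From mathcomp Require Import all_classical all_reals all_analysis.

Set Implicit Arguments.
Unset Strict Implicit.
Unset Printing Implicit Defensive.

Import Order.TTheory GRing.Theory Num.Theory.
Import numFieldNormedType.Exports.

Local Open Scope classical_set_scope.
Local Open Scope ring_scope.

(* The colour set [c] carries the discrete sigma-algebra. Measurable types of
   the library are pointed, whence the successor. *)
HB.instance Definition _ (c : nat) := isPointed.Build 'I_c.+1 ord0.
HB.instance Definition _ (c : nat) := @isMeasurable.Build
  default_measure_display 'I_c.+1 (@discrete_measurable 'I_c.+1)
  (@discrete_measurable0 _) (@discrete_measurableC _) (@discrete_measurableU _).

Section tuple_cons.
Context d (T : measurableType d) (n : nat).

Definition tuple_cons (z : T * n.-tuple T) : n.+1.-tuple T :=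
  [tuple of z.1 :: z.2].

Let measurable_tuple_cons : measurable_fun setT tuple_cons.
Proof. exact: (measurable_cons measurable_fst measurable_snd). Qed.

HB.instance Definition _ := isMeasurableFun.Build _ _ _ _ tuple_cons
  measurable_tuple_cons.

End tuple_cons.

(* The n-fold product of P, on n-tuples. *)
Fixpoint power_prob d (T : measurableType d) (R : realType)
    (P : probability T R) (n : nat) : probability (n.-tuple T) R :=
  if n is k.+1 then distribution (P \x power_prob P k)%E (@tuple_cons _ T k)
  else dirac [tuple].

Lemma power_probE d (T : measurableType d) (R : realType)
    (P : probability T R) (n : nat) (A : 'I_n -> set T) :
  (forall i, measurable (A i)) ->
  (power_prob P n [set t | forall i, A i (tnth t i)]
   = \prod_(i < n) P (A i))%E.
Proof.
elim: n => [|n IH] in A *.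
  by move=> _; rewrite big_ord0 /= diracE mem_set// => -[].
move=> mA; rewrite big_ord_recl /= /distribution /pushforward.
set B := [set t : n.-tuple T | forall i, A (lift ord0 i) (tnth t i)].
rewrite (_ : _ @^-1` _ = A ord0 `*` B); last first.
  apply/seteqP; split => [[x t] /= h|[x t] /= [h1 h2] i].
    split; first by have := h ord0; rewrite /tuple_cons tnth0.
    by move=> i; have := h (lift ord0 i); rewrite /tuple_cons tnthS.
  by case: (unliftP ord0 i) => [j ->|->]; rewrite /tuple_cons ?tnthS ?tnth0.
rewrite product_measure1E //; first by congr (_ * _)%E; exact: IH.
rewrite (_ : B = \bigcap_(i in [set: 'I_n])
    ((@tnth _ T ^~ i) @^-1` A (lift ord0 i))).
  apply: fin_bigcap_measurable => [|i _]; first exact: finite_finset.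
  rewrite -[X in measurable X]setTI.
  exact: measurable_tnth.
by apply/seteqP; split => t /= h i; [move=> _; exact: h|exact: h].
Qed.

Section unit_interval.
Context (R : realType).

Definition unit_itv : set (measurableTypeR R) := `[0, 1].

Lemma measurable_unit_itv : measurable unit_itv.
Proof. exact: measurable_itv. Qed.

Definition unit_leb : set (measurableTypeR R) -> \bar R :=
  mrestr (@lebesgue_measure R) measurable_unit_itv.

HB.instance Definition _ := Measure.on unit_leb.

Let unit_leb_setT : unit_leb setT = 1%E.
Proof.
by rewrite /unit_leb /mrestr setTI lebesgue_measure_itv /= lte_fin ltr01
  oppr0 adde0.
Qed.

HB.instance Definition _ := Measure_isProbability.Build _ _ _ unit_leb
  unit_leb_setT.

End unit_interval.

Arguments unit_itv R : clear implicits.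
Arguments unit_leb R : clear implicits.

Section graphons.
Context (R : realType).
Implicit Types W : R * R -> R.

Definition unit_leb2 := (unit_leb R \x unit_leb R)%E.

(* Symmetric kernels in L^1([0,1]^2), as functions on R^2 of which only the
   restriction to the unit square matters. *)
Definition kernel_L1 W :=
  unit_leb2.-integrable setT (EFin \o W) /\
  (forall x y, unit_itv R x -> unit_itv R y -> W (x, y) = W (y, x)).

Definition cut_dist W1 W2 : \bar R :=
  ereal_sup [set a | exists S T : set (measurableTypeR R),
    [/\ measurable S /\ S `<=` unit_itv R, measurable T /\ T `<=` unit_itv R &
        a = `| \int[unit_leb2]_(z in S `*` T) (W1 z - W2 z)%:E |%E]].

(* Measure preserving bijections of [0,1]; s is extended to the real line in
   an arbitrary measurable way. *)
Definition mp_bijection (s : measurableTypeR R -> measurableTypeR R) :=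
  [/\ measurable_fun setT s, set_bij (unit_itv R) (unit_itv R) s &
      forall A, measurable A -> unit_leb R (s @^-1` A) = unit_leb R A].

Definition relabel (s : R -> R) W : R * R -> R := fun z => W (s z.1, s z.2).

Definition delta_cut W1 W2 : \bar R :=
  ereal_inf [set cut_dist (relabel s W1) W2 | s in mp_bijection].

(* The matrix index i : 'I_n stands for i.+1 in {1, ..., n}. *)
Definition step_kernel n (Q : 'M[R]_n) : R * R -> R := fun z =>
  \sum_(i < n) \sum_(j < n) Q i j *
    ((Num.ceil (n%:R * z.1) == i.+1%:Z) &&
     (Num.ceil (n%:R * z.2) == j.+1%:Z))%:R.

Definition Lr_norm (r : R) W : \bar R := Lnorm unit_leb2 r%:E (EFin \o W).

End graphons.

Section subgraph_counts.
Context (R : realType) (v c : nat) (H : rel 'I_v).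

Definition max_degree : nat := \max_(a < v) #|[pred b | H a b]|.

(* Each undirected edge {a, b} is counted once, as the pair with a < b. *)
Definition edge (e : 'I_v * 'I_v) : bool := (e.1 < e.2)%N && H e.1 e.2.

Definition N2 n (Q : 'M[R]_n) (x : 'I_n -> 'I_c) : R :=
  n%:R ^- v * \sum_(i : {ffun 'I_v -> 'I_n} | injectiveb i)
    [forall a, forall b, x (i a) == x (i b)]%:R *
    \prod_(e | edge e) Q (i e.1) (i e.2).

Definition colour_profile (f : 'I_c -> R -> R) :=
  (forall r, measurable_fun [set: measurableTypeR R] (f r)) /\
  (forall x, unit_itv R x ->
    (forall r, 0 <= f r x <= 1) /\ \sum_(r < c) f r x = 1).

Definition G2 (W : R * R -> R) (f : 'I_c -> R -> R) : \bar R :=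
  (\sum_(r < c) \int[power_prob (unit_leb R) v]_x
    ((\prod_(e | edge e) W (tnth x e.1, tnth x e.2)) *
     \prod_(a < v) f r (tnth x a))%:E)%E.

(* ln 0 = 0 in the library, so 0 * ln (0 / p r) = 0. *)
Definition relative_entropy (p : 'I_c -> R) (f : 'I_c -> R -> R) : \bar R :=
  (\int[unit_leb R]_u (\sum_(r < c) f r u * ln (f r u / p r))%:E)%E.

Definition I2 (p : 'I_c -> R) (W : R * R -> R) (t : R) : \bar R :=
  ereal_inf [set relative_entropy p f |
    f in [set f | colour_profile f /\ G2 W f = t%:E]].

End subgraph_counts.

Section probability_notions.
Context (R : realType).

(* The product rule over all indices gives the one over each subfamily, by
   taking A i = setT for the other indices. *)
Definition iid d (Omega : measurableType d) (P : probability Omega R)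
    d' (E : measurableType d') (mu : probability E R)
    n (X : 'I_n -> {mfun Omega >-> E}) :=
  (forall i A, measurable A -> distribution P (X i) A = mu A) /\
  (forall A : 'I_n -> set E, (forall i, measurable (A i)) ->
    P (\bigcap_(i in [set: 'I_n]) (X i @^-1` A i))
    = (\prod_(i < n) P (X i @^-1` A i))%E).

Definition nondegenerate_prob d (E : measurableType d) (mu : probability E R) :=
  forall x : E, mu [set x] != 1%E.

(* Large deviation principle with speed n and good rate function I, for
   real-valued T n on possibly different probability spaces. *)
Definition LDP (d : nat -> measure_display)
    (Omega : forall n, measurableType (d n))
    (P : forall n, probability (Omega n) R)
    (T : forall n, Omega n -> R) (I : R -> \bar R) :=
  let rate F n := (n%:R^-1%:E * lne (P n (T n @^-1` F)))%E in
  [/\ forall t, (0 <= I t)%E,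
      forall a : R, compact [set t | (I t <= a%:E)%E] &
      forall F : set R, measurable (F : set (measurableTypeR R)) ->
        [/\ (- ereal_inf (I @` interior F) <= limn_einf (rate F))%E,
            (limn_einf (rate F) <= limn_esup (rate F))%E &
            (limn_esup (rate F) <= - ereal_inf (I @` closure F))%E]].

End probability_notions.

(* Main.v *)
(** Up to o(1), uniformly in the colouring x, N_2 is the density G_{U_n}(g^x) of
    the 0/1 profile g^x of x, where U_n is the step kernel of Q_n, relabelled so
    that it is close to W in the cut norm.  The L^{q Delta} bound makes |U_n|^Delta
    uniformly integrable; together with Finner's generalization of Hoelder's
    inequality this gives G_{U_n} -> G_W uniformly over all profiles.  Hence W may
    be replaced by one fixed U_m, whose density is a Lipschitz function of the
    finitely many colour masses of the profile on the m blocks.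

    Upper bound: the vectors of block masses of the colourings are covered by a
    number of cells which does not depend on n, and each cell is estimated by the
    exponential Chebyshev inequality for the log-likelihood ratio of its block
    average.  Lower bound: under the product law whose i-th marginal is the average
    of f over the i-th block, the block masses concentrate around those of f, and
    the change of measure costs n times the entropy of f.  Goodness of the rate
    function: an ultralimit of profiles is again a profile, by the Radon-Nikodym
    theorem, and the entropy is lower semicontinuous. *)

Require Import Defs.
From HB Require Import structures.
From mathcomp Require Import all_boot all_order all_algebra.
From mathcomp Require Import all_classical all_reals all_analysis.
From mathcomp Require Import measurable_realfun.
From mathcomp Require Import ring lra zify.

Set Implicit Arguments.
Unset Strict Implicit.
Unset Printing Implicit Defensive.

Import Order.TTheory GRing.Theory Num.Theory.
Import numFieldNormedType.Exports.

Local Open Scope classical_set_scope.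
Local Open Scope ring_scope.

(** * Integrals and image measures *)

(** Three obstacles shape the argument. [W] is only integrable, whereas Finner's inequality asks for
    an L^Delta bound at every edge. That bound is inherited from the kernels U_n: the cut norm gives
    convergence against rectangles, uniform integrability extends it to all measurable sets, and the
    integral of the convex excess (|u| - K)^+ to the power Delta is lower semicontinuous under such
    convergence. Next, the cut norm controls a difference of kernels only against bounded factors.
    Hence edges are exchanged one at a time, the kernels of the other edges being first clipped at
    K; the exponent q > 1 makes the price of clipping small uniformly in n. Finally, the entropy
    involves unbounded logarithms. Mixing a profile with a fraction theta of mu turns its
    log-likelihood ratio into a bounded test function and costs only -ln (1 - theta), so the entropy
    is a supremum of pairings with bounded functions; monotonicity under averaging and lower
    semicontinuity both come from this. Ultrafilters make the masses of all measurable sets converge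
    at once. *)

Notation intg P f := (P.-integrable setT (EFin \o f)).

Section laws.
Context d1 d2 (X : measurableType d1) (Y : measurableType d2) (R : realType).
Variables (mu : {measure set X -> \bar R}) (nu : {measure set Y -> \bar R}).

Definition is_law (phi : X -> Y) :=
  measurable_fun setT phi /\
  forall A, measurable A -> mu (phi @^-1` A) = nu A.

Variable phi : X -> Y.
Hypothesis hphi : is_law phi.

Lemma ge0_integral_law (f : Y -> \bar R) :
  measurable_fun setT f -> (forall y, 0 <= f y)%E ->
  (\int[nu]_y f y = \int[mu]_x f (phi x))%E.
Proof.
move=> mf f0; have [mphi E] := hphi.
rewrite (eq_measure_integral (pushforward mu phi)); last first.
  by move=> A mA _; rewrite /= /pushforward E.
by rewrite ge0_integral_pushforward.
Qed.

Lemma integrable_law (f : Y -> \bar R) : measurable_fun setT f ->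
  nu.-integrable setT f <-> mu.-integrable setT (f \o phi).
Proof.
move=> mf; have [mphi _] := hphi.
have mfa : measurable_fun setT (abse \o f) by exact: measurableT_comp.
have mfp : measurable_fun setT (f \o phi) by exact: measurableT_comp.
have E := ge0_integral_law mfa (fun y => abse_ge0 (f y)).
by split=> /integrableP[_ h]; apply/integrableP; split => //; rewrite -?E// E.
Qed.

Lemma integral_law (f : Y -> \bar R) : measurable_fun setT f ->
  (\int[nu]_y f y = \int[mu]_x f (phi x))%E.
Proof.
move=> mf; rewrite integralE [RHS]integralE.
have -> : (fun x => f (phi x))^\+%E = f^\+%E \o phi := funepos_comp f phi.
have -> : (fun x => f (phi x))^\-%E = f^\-%E \o phi := funeneg_comp f phi.
rewrite (ge0_integral_law (measurable_funepos mf)); last first.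
  by move=> y; exact: funepos_ge0.
rewrite (ge0_integral_law (measurable_funeneg mf)); last first.
  by move=> y; exact: funeneg_ge0.
by [].
Qed.

Lemma Rintegral_law (f : Y -> R) : measurable_fun setT f ->
  \int[nu]_y f y = \int[mu]_x f (phi x).
Proof. by move=> mf; rewrite /Rintegral integral_law//; exact/measurable_EFinP. Qed.

End laws.

Section probability_integrals.
Context d (T : measurableType d) (R : realType) (P : probability T R).
Implicit Types f g : T -> R.

Lemma prob_cst (k : R) : \int[P]_x k = k.
Proof.
transitivity (k * fine (P setT)); first exact: Rintegral_cst.
by rewrite probability_setT mulr1.
Qed.

Lemma intg_cst (k : R) : intg P (cst k).
Proof. exact: finite_measure_integrable_cst. Qed.

Lemma intg_measurable f : intg P f -> measurable_fun setT f.
Proof. by move=> /integrableP[/measurable_EFinP]. Qed.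

Lemma le_intg f g : measurable_fun setT f -> intg P g ->
  (forall x, `|f x| <= `|g x|) -> intg P f.
Proof.
move=> mf ig fg; apply: (le_integrable _ _ _ ig) => //.
  exact/measurable_EFinP.
by move=> x _ /=; rewrite lee_fin.
Qed.

Lemma bounded_intg f M : measurable_fun setT f -> (forall x, `|f x| <= M) ->
  intg P f.
Proof.
move=> mf fM; apply: (le_intg mf (intg_cst M)) => x /=.
by rewrite (le_trans (fM x))// ler_norm.
Qed.

Lemma intgM f g M : intg P f -> measurable_fun setT g ->
  (forall x, `|g x| <= M) -> intg P (fun x => f x * g x).
Proof.
move=> fi mg gM; apply: (@le_intg _ (fun x => M * f x)).
- by apply: measurable_funM => //; exact: intg_measurable.
- have -> : EFin \o (fun x => M * f x) = (fun x => M%:E * (EFin \o f) x)%E.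
    by apply/funext => x /=; rewrite EFinM.
  exact: integrableZl.
move=> x; rewrite !normrM mulrC ler_wpM2r//.
by rewrite (le_trans (gM x))// ler_norm.
Qed.

Lemma intgD f g : intg P f -> intg P g -> intg P (fun x => f x + g x).
Proof. by move=> fi gi; have := integrableD measurableT fi gi. Qed.

Lemma intgB f g : intg P f -> intg P g -> intg P (fun x => f x - g x).
Proof. by move=> fi gi; have := integrableB measurableT fi gi. Qed.

Lemma intgZl k f : intg P f -> intg P (fun x => k * f x).
Proof. by move=> fi; have := integrableZl measurableT k fi. Qed.

Lemma intg_sum I (s : seq I) (Q : pred I) (f : I -> T -> R) :
  (forall i, Q i -> intg P (f i)) -> intg P (fun x => \sum_(i <- s | Q i) f i x).
Proof.
move=> fi; elim: s => [|i s IH].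
  rewrite (_ : (fun _ => _) = cst 0); first exact: intg_cst.
  by apply/funext => x; rewrite big_nil.
case: (boolP (Q i)) => Qi; last first.
  by under eq_fun do rewrite big_cons (negbTE Qi).
by under eq_fun do rewrite big_cons Qi; apply: intgD => //; exact: fi.
Qed.

Lemma Rintegral_sum I (s : seq I) (Q : pred I) (f : I -> T -> R) :
  (forall i, Q i -> intg P (f i)) ->
  \int[P]_x (\sum_(i <- s | Q i) f i x) = \sum_(i <- s | Q i) \int[P]_x f i x.
Proof.
move=> fi; elim: s => [|i s IH].
  under eq_Rintegral do rewrite big_nil.
  by rewrite big_nil prob_cst.
rewrite big_cons; under eq_Rintegral do rewrite big_cons.
case: ifPn => // Qi; rewrite RintegralD//; first by rewrite IH.
  exact: fi.
exact: intg_sum.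
Qed.

Lemma Rintegral_fin f : intg P f ->
  (\int[P]_x (f x)%:E)%E = (\int[P]_x f x)%:E.
Proof. by move=> fi; rewrite fineK//; exact: integrable_fin_num. Qed.

Lemma le_Rintegral_norm f g : intg P f -> intg P g ->
  (forall x, `|f x| <= g x) -> `|\int[P]_x f x| <= \int[P]_x g x.
Proof.
move=> fi gi fg; apply: (le_trans (le_normr_Rintegral _ _)) => //.
by apply: le_Rintegral => //; exact: integrable_norm.
Qed.

Lemma Rintegral_bound f M : measurable_fun setT f -> (forall x, `|f x| <= M) ->
  `|\int[P]_x f x| <= M.
Proof.
move=> mf fM; rewrite -[leRHS](prob_cst M).
by apply: le_Rintegral_norm => //; [exact: bounded_intg mf fM|exact: intg_cst].
Qed.

Lemma Rintegral_indic (A : set T) : measurable A ->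
  \int[P]_x \1_A x = fine (P A).
Proof. by move=> mA; rewrite /Rintegral integral_indic// setIT. Qed.

Lemma Rintegral_setE (A : set T) f : \int[P]_(x in A) f x = \int[P]_x (f x * \1_A x).
Proof.
rewrite Rintegral_mkcond; apply: eq_Rintegral => x _.
by rewrite patchE indicE; case: ifPn => _; rewrite ?mulr1 ?mulr0.
Qed.

End probability_integrals.

Section fubini_real.
Context d1 d2 (X : measurableType d1) (Y : measurableType d2) (R : realType).
Variables (P : probability X R) (Q : probability Y R) (f : X * Y -> R).
Hypothesis fi : intg (P \x Q)%E f.

Lemma intg_section : {ae P, forall x, intg Q (fun y => f (x, y))}.
Proof. exact: (ae_integrable1 fi). Qed.

Lemma Rintegral_fubini : \int[(P \x Q)%E]_z f z = \int[P]_x \int[Q]_y f (x, y).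
Proof.
rewrite /Rintegral; congr fine.
rewrite -(integral12_prod_meas1 fi).
(* Both inner integrals agree wherever the section is integrable; elsewhere, on a null set, [fine]
   may have replaced an infinite value by 0. *)
apply: ae_eq_integral => //.
- exact: (measurable_fubini_F fi).
- apply/measurable_EFinP; apply: measurableT_comp => //.
  exact: (measurable_fubini_F fi).
apply: filterS intg_section => x ix _.
by rewrite /fubini_F /= fineK//; exact: (integrable_fin_num measurableT ix).
Qed.

Lemma intg_fubini : intg P (fun x => \int[Q]_y f (x, y)).
Proof.
have := integrable_fubini_F fi => /integrableP[mF Foo].
apply/integrableP; split.
  by apply/measurable_EFinP; exact: measurableT_comp mF.
apply: le_lt_trans Foo; apply: ge0_le_integral => //.
- apply: measurableT_comp => //; apply/measurable_EFinP.
  exact: measurableT_comp mF.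
- exact: measurableT_comp.
move=> x _ /=; rewrite /fubini_F/= /Rintegral.
by case: (integral _ _ _) => [r| |]//=; rewrite ?leey// normr0 lee_fin.
Qed.

End fubini_real.

(** * Product measures on tuples *)

(** The product measure, repackaged as a [probability] because the lemmas of [probability_integrals]
    are stated for that structure. *)
Definition prod_prob d1 d2 (X : measurableType d1) (Y : measurableType d2)
    (R : realType) (P : probability X R) (Q : probability Y R) :
  probability (X * Y)%type R := (P \x Q)%E.

Section power_measure.
Context d (T : measurableType d) (R : realType) (P : probability T R).

Definition box n (A : 'I_n -> set T) : set (n.-tuple T) :=
  [set t | forall i, A i (tnth t i)].

Lemma measurable_box n (A : 'I_n -> set T) :
  (forall i, measurable (A i)) -> measurable (box A).
Proof.
move=> mA; rewrite (_ : box A = \bigcap_(i in [set: 'I_n])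
    ((@tnth _ T ^~ i) @^-1` A i)).
  apply: fin_bigcap_measurable => [|i _]; first exact: finite_finset.
  by rewrite -[X in measurable X]setTI; exact: measurable_tnth.
by apply/seteqP; split => t /= h i; [move=> _; exact: h|exact: h].
Qed.

Lemma measurable_tupleE n : @measurable _ (n.-tuple T) =
  <<s [set box A | A in [set A : 'I_n -> set T | forall i, measurable (A i)]] >>.
Proof.
apply/seteqP; split; last first.
  apply: smallest_sub; first exact: sigma_algebra_measurable.
  by move=> _ [A mA <-]; exact: measurable_box.
apply: smallest_sub; first exact: smallest_sigma_algebra.
rewrite -bigcup_seq => X [i _ [B mB <-]]; apply: sub_sigma_algebra.
exists (fun j => if j == i then B else setT).
  by move=> j /=; case: ifP.
apply/seteqP; split => t /=.
  by move=> /(_ i); rewrite eqxx.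
by move=> [_ Bt] j; case: eqP => // ->.
Qed.

Lemma power_box n (A : 'I_n -> set T) : (forall i, measurable (A i)) ->
  (power_prob P n (box A) = \prod_(i < n) P (A i))%E.
Proof. exact: power_probE. Qed.

(** Boxes are stable under intersection and generate the sigma-algebra of tuples, so a finite
    measure on tuples is determined by its values on boxes. *)
Lemma power_law d' (X : measurableType d') (mu : {measure set X -> \bar R})
    n (phi : X -> n.-tuple T) : measurable_fun setT phi ->
  (forall A : 'I_n -> set T, (forall i, measurable (A i)) ->
    (mu (phi @^-1` box A) = \prod_(i < n) P (A i))%E) ->
  is_law mu (power_prob P n) phi.
Proof.
move=> mphi E; split => // A mA.
pose mfphi : {mfun X >-> n.-tuple T} :=
  MeasurableFun.Pack (MeasurableFun.Class (isMeasurableFun.Build _ _ _ _ _ mphi)).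
apply: esym; apply: (measure_unique
  [set box A | A in [set A : 'I_n -> set T | forall i, measurable (A i)]]
  (fun=> setT) _ _ _ _ (power_prob P n) (pushforward mu mfphi)) => //.
- exact: measurable_tupleE.
- move=> _ _ [B mB <-] [C mC <-]; exists (fun i => B i `&` C i).
    by move=> i; exact: measurableI.
  apply/seteqP; split => t /=; first by move=> h; split => i; have [] := h i.
  by move=> [h1 h2] i; split; [exact: h1|exact: h2].
- by move=> _; exists (fun=> setT) => //; apply/seteqP; split.
- by rewrite bigcup_const.
- move=> _ [B mB <-]; transitivity (\prod_(i < n) P (B i))%E.
    exact: power_probE.
  by apply: esym; exact: E.
- by move=> _; apply: (@le_lt_trans _ _ 1%E); [exact: probability_le1|exact: ltry].
Qed.

Lemma power_cons_law n :
  is_law (P \x power_prob P n)%E (power_prob P n.+1) (@tuple_cons _ T n).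
Proof. by split => //; exact: measurable_funP. Qed.

Lemma measurable_tnth_fun n (a : 'I_n) (g : T -> R) : measurable_fun setT g ->
  measurable_fun setT (fun x : n.-tuple T => g (tnth x a)).
Proof. by move=> mg; apply: measurableT_comp => //; exact: measurable_tnth. Qed.

Lemma measurable_bprod d' (X : measurableType d') I (s : seq I) (Q : pred I)
    (g : I -> X -> R) : (forall i, Q i -> measurable_fun setT (g i)) ->
  measurable_fun setT (fun x => \prod_(i <- s | Q i) g i x).
Proof.
move=> mg; elim: s => [|i s IH].
  by under eq_fun do rewrite big_nil; exact: measurable_cst.
case: (boolP (Q i)) => Qi; last first.
  by under eq_fun do rewrite big_cons (negbTE Qi).
under eq_fun do rewrite big_cons Qi.
by apply: measurable_funM => //; exact: mg.
Qed.

Lemma norm_prod_le I (s : seq I) (Q : pred I) (g : I -> R) (M : R) :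
  (forall i, Q i -> `|g i| <= M) -> 1 <= M ->
  `|\prod_(i <- s | Q i) g i| <= M ^+ (size s).
Proof.
move=> gM M1; elim: s => [|i s IH]; first by rewrite big_nil normr1 expr0.
rewrite big_cons /= exprS; case: ifPn => Qi.
  by rewrite normrM ler_pM// gM.
by rewrite (le_trans IH)// ler_peMl// exprn_ge0// (le_trans _ M1).
Qed.

Lemma norm_prod_card (I : finType) (Q : pred I) (g : I -> R) (M : R) :
  (forall i, Q i -> `|g i| <= M) -> 1 <= M ->
  `|\prod_(i | Q i) g i| <= M ^+ #|I|.
Proof.
move=> gM M1; rewrite cardT enumT -[Finite.enum I](_ : index_enum I = _).
  exact: norm_prod_le.
by rewrite [index_enum I]unlock.
Qed.

Lemma Rintegral_power_prod n (g : 'I_n -> T -> R) (M : R) :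
  (forall a, measurable_fun setT (g a)) -> (forall a x, `|g a x| <= M) ->
  \int[power_prob P n]_x (\prod_(a < n) g a (tnth x a)) =
  \prod_(a < n) \int[P]_x g a x.
Proof.
(* With M at least 1, a power of M also bounds the partial products that appear in the induction. *)
move=> mg gM; wlog M1 : M gM / 1 <= M.
  move=> /(_ (Num.max 1 M)); apply; last by rewrite le_max lexx.
  by move=> a x; rewrite le_max gM orbT.
elim: n g mg gM => [|n IH] g mg gM.
  under eq_Rintegral do rewrite big_ord0.
  by rewrite big_ord0 prob_cst.
rewrite (Rintegral_law (power_cons_law n)); last first.
  by apply: measurable_bprod => a _; exact: measurable_tnth_fun.
have mh : measurable_fun setT (fun t : n.-tuple T =>
    \prod_(a < n) g (lift ord0 a) (tnth t a)).
  by apply: measurable_bprod => a _; exact: measurable_tnth_fun.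
have hM (t : n.-tuple T) : `|\prod_(a < n) g (lift ord0 a) (tnth t a)| <= M ^+ n.
  by rewrite -[X in M ^+ X]card_ord norm_prod_card.
pose F (z : T * n.-tuple T) := g ord0 z.1 * \prod_(a < n) g (lift ord0 a) (tnth z.2 a).
have -> : \int[(P \x power_prob P n)%E]_z
    (\prod_(a < n.+1) g a (tnth (tuple_cons z) a)) = \int[(P \x power_prob P n)%E]_z F z.
  apply: eq_Rintegral => z _; rewrite big_ord_recl /tuple_cons tnth0; congr (_ * _).
  by apply: eq_bigr => a _; rewrite tnthS.
rewrite (@Rintegral_fubini _ _ _ _ _ _ _ F); last first.
  apply: (@bounded_intg _ _ _ _ _ (M * M ^+ n)).
    by apply: measurable_funM; [exact: measurableT_comp|
      exact: (measurableT_comp mh)].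
  by move=> z; rewrite normrM ler_pM.
rewrite big_ord_recl -IH//.
set J := \int[power_prob P n]_x _.
have -> : \int[P]_x \int[power_prob P n]_y F (x, y) = \int[P]_x (g ord0 x * J).
  by apply: eq_Rintegral => x _; rewrite /F/= RintegralZl//; exact: bounded_intg hM.
by rewrite RintegralZr//; exact: bounded_intg (gM ord0).
Qed.

Lemma prod_eq2 n (a b : 'I_n) (F : 'I_n -> \bar R) : a != b ->
  (\prod_(i < n) (if i == a then F i else if i == b then F i else 1) = F a * F b)%E.
Proof.
move=> ab; rewrite (bigD1 a)//= eqxx (bigD1 b)/=; last by rewrite eq_sym.
rewrite eqxx eq_sym (negbTE ab) big1 ?mule1// => i /andP[/negbTE-> /negbTE->].
by [].
Qed.

Lemma pair_law n (a b : 'I_n) : a != b ->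
  is_law (power_prob P n) (P \x P)%E (fun x => (tnth x a, tnth x b)).
Proof.
move=> ab.
have mphi : measurable_fun setT (fun x : n.-tuple T => (tnth x a, tnth x b)).
  by apply: measurable_fun_pair; exact: measurable_tnth.
split => // A mA.
pose mfphi : {mfun n.-tuple T >-> (T * T)%type} :=
  MeasurableFun.Pack (MeasurableFun.Class (isMeasurableFun.Build _ _ _ _ _ mphi)).
apply: esym; apply: (product_measure_unique (m' := pushforward (power_prob P n) mfphi)) => //.
move=> B C mB mC; rewrite /= /pushforward.
rewrite (_ : _ @^-1` _ = box (fun i => if i == a then B else if i == b then C else setT)).
  rewrite power_box; last by move=> i; case: ifP => // _; case: ifP.
  rewrite (eq_bigr (fun i => if i == a then (if i == a then P B else P C) else
     if i == b then (if i == a then P B else P C) else 1%E)).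
    by rewrite prod_eq2// eqxx eq_sym (negbTE ab).
  move=> i _; case: eqP => // _; case: eqP => // _.
  exact: probability_setT.
apply/seteqP; split => t /=.
  by move=> [Ba Cb] i; case: eqP => [->//|_]; case: eqP => // ->.
move=> h; have := h a; have := h b; rewrite !eqxx eq_sym (negbTE ab).
by [].
Qed.

Definition replace2 n (a b : 'I_n) (z : n.-tuple T * (T * T)) : n.-tuple T :=
  [tuple if i == a then z.2.1 else if i == b then z.2.2 else tnth z.1 i | i < n].

(* Resampling the two endpoints of an edge allows to integrate its kernel first,
   against a product of bounded functions of one endpoint each. *)
Lemma replace2_law n (a b : 'I_n) : a != b ->
  is_law (power_prob P n \x prod_prob P P)%E (power_prob P n) (replace2 a b).
Proof.
move=> ab; apply: power_law.
  apply/measurable_fun_tnthP => i.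
  rewrite (_ : _ \o _ = fun z => if i == a then z.2.1 else
    if i == b then z.2.2 else tnth z.1 i); last first.
    by apply/funext => z; rewrite /= tnth_mktuple.
  case: (i == a); first exact: (measurableT_comp measurable_fst measurable_snd).
  case: (i == b); first exact: (measurableT_comp measurable_snd measurable_snd).
  by apply: (measurableT_comp (measurable_tnth i)).
move=> A mA.
rewrite (_ : _ @^-1` _ = box (fun i => if i == a then setT else
  if i == b then setT else A i) `*` (A a `*` A b)); last first.
  apply/seteqP; split => -[t [y z]] /=.
    move=> h; split.
      by move=> i; have := h i; rewrite tnth_mktuple; case: eqP => // _; case: eqP.
    split; first by have := h a; rewrite tnth_mktuple eqxx.
    by have := h b; rewrite tnth_mktuple eq_sym (negbTE ab) eqxx.
  move=> [h [ya zb]] i; rewrite tnth_mktuple /=; have := h i.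
  by case: eqP => [->//|_]; case: eqP => [->|].
set B := box _; have mB : measurable B.
  by apply: measurable_box => i; case: ifP => // _; case: ifP.
transitivity (power_prob P n B * prod_prob P P (A a `*` A b))%E.
  by apply: product_measure1E => //; exact: measurableX.
rewrite [X in (_ * X)%E](_ : _ = P (A a) * P (A b))%E; last first.
  exact: product_measure1E.
rewrite power_box; last first.
  by move=> i; case: ifP => // _; case: ifP.
rewrite [RHS](bigD1 a)//= [X in (_ = _ * X)%E](bigD1 b)/=; last by rewrite eq_sym.
rewrite (bigD1 a)//= eqxx probability_setT mul1e.
rewrite (bigD1 b)/=; last by rewrite eq_sym.
rewrite eqxx eq_sym (negbTE ab) probability_setT mul1e muleC -muleA.
congr (_ * (_ * _))%E; apply: eq_bigr => i /andP[/negbTE -> /negbTE ->].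
by [].
Qed.

End power_measure.

(** * Finner's inequality *)

Section finner_inequality.
Context d (T : measurableType d) (R : realType) (P : probability T R).

(** The inequality of arithmetic and geometric means for the D-th powers of the [y i], padded with
    ones up to exactly D numbers. The padding lets a vertex with fewer than D edges be treated with
    the exponent D all the same. *)
Lemma prod_le_mean (I : finType) (S : {pred I}) (D : nat) (y : I -> R) :
  (0 < D)%N -> (#|S| <= D)%N -> (forall i, 0 <= y i) ->
  \prod_(i in S) y i <= (\sum_(i in S) y i ^+ D + (D - #|S|)%:R) / D%:R.
Proof.
move=> D0 SD y0.
have : (#|S| + (D - #|S|) = D)%N by exact: subnKC.
move: (D - #|S|)%N => m hm.
pose A := [pred u : I + 'I_m | if u is inl i then i \in S else true].
pose E (u : I + 'I_m) : R := if u is inl i then y i ^+ D else 1.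
have cA : #|A| = D.
  rewrite -sum1_card big_sumType /= sum1_card sum_nat_const card_ord muln1.
  exact: hm.
have := @leif_AGM R _ A E; rewrite cA => /(_ _) h.
have E0 : {in A, forall u, 0 <= E u}.
  by case=> [i|j] _ //=; rewrite exprn_ge0.
move: {h}((h E0).1); rewrite !big_sumType /= [X in _ * X]big1 // mulr1.
rewrite [X in _ + X](_ : _ = m%:R); last first.
  by rewrite sumr_const card_ord.
rewrite prodrXl ler_pXn2r//.
- by rewrite nnegrE prodr_ge0.
- by rewrite nnegrE divr_ge0// addr_ge0// sumr_ge0// => i _; exact: exprn_ge0.
Qed.

(** Hoelder's inequality for at most D factors with common exponent D. After dividing [F i] by
    [N i], each D-th power has integral at most 1, and integrating [prod_le_mean] bounds the
    normalized product by 1. *)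
Lemma Rintegral_prod_le (I : finType) (S : {pred I}) (D : nat)
    (F : I -> T -> R) (M N : I -> R) :
  (0 < D)%N -> (#|S| <= D)%N ->
  (forall i, measurable_fun setT (F i)) -> (forall i x, 0 <= F i x <= M i) ->
  (forall i, 0 < N i) -> (forall i, \int[P]_x (F i x ^+ D) <= N i ^+ D) ->
  \int[P]_x \prod_(i in S) F i x <= \prod_(i in S) N i.
Proof.
move=> D0 SD mF FM N0 FN.
have mFN i : measurable_fun setT (fun x => (F i x / N i) ^+ D).
  by apply: measurable_funX; exact: measurable_funM.
have bFN i x : `|(F i x / N i) ^+ D| <= (M i / N i) ^+ D.
  have /andP[F0 FM'] := FM i x.
  rewrite ger0_norm ?exprn_ge0 ?divr_ge0 ?(ltW (N0 _))//.
  by rewrite lerXn2r ?nnegrE ?divr_ge0 ?(ltW (N0 _)) ?(le_trans F0)//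
    ler_pM2r ?invr_gt0.
have iFN i : intg P (fun x => (F i x / N i) ^+ D) by exact: bounded_intg (bFN i).
pose G x := (\prod_(i in S) N i) *
  ((\sum_(i in S) (F i x / N i) ^+ D + (D - #|S|)%:R) / D%:R).
have iS : intg P (fun x => \sum_(i in S) (F i x / N i) ^+ D).
  by apply: intg_sum => i _; exact: iFN.
have iS1 : intg P (fun x => \sum_(i in S) (F i x / N i) ^+ D + (D - #|S|)%:R).
  by apply: intgD => //; exact: intg_cst.
have iS2 : intg P (fun x => (\sum_(i in S) (F i x / N i) ^+ D + (D - #|S|)%:R) / D%:R).
  by under eq_fun do rewrite mulrC; exact: intgZl.
have PN0 : 0 <= \prod_(i in S) N i by rewrite prodr_ge0// => i _; exact: ltW.
have FG x : \prod_(i in S) F i x <= G x.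
  rewrite /G (eq_bigr (fun i => N i * (F i x / N i))); last first.
    by move=> i _; rewrite mulrCA divff ?mulr1// gt_eqF.
  rewrite big_split /= ler_wpM2l// prod_le_mean// => i.
  by have /andP[F0 _] := FM i x; rewrite divr_ge0// ltW.
have iG : intg P G by exact: intgZl.
have iF : intg P (fun x => \prod_(i in S) F i x).
  apply: (le_intg _ iG); first by apply: measurable_bprod => i _.
  move=> x; have F0 : 0 <= \prod_(i in S) F i x.
    by apply: prodr_ge0 => i _; have /andP[] := FM i x.
  by rewrite ger0_norm// (le_trans (FG x))// ler_norm.
apply: (le_trans (le_Rintegral _ iF iG (fun x _ => FG x))) => //.
rewrite /G RintegralZl// ler_piMr// RintegralZr// ler_pdivrMr ?ltr0n// mul1r.
rewrite RintegralD//; last exact: intg_cst.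
rewrite prob_cst Rintegral_sum//.
rewrite -lerBrDr -natrB ?leq_subr// subKn// -sum1_card natr_sum.
apply: ler_sum => i _.
under eq_Rintegral do rewrite expr_div_n.
rewrite RintegralZr//; last first.
  apply: (@bounded_intg _ _ _ _ _ (M i ^+ D)); first exact: measurable_funX.
  move=> x; have /andP[F0 FM'] := FM i x.
  by rewrite ger0_norm ?exprn_ge0// lerXn2r ?nnegrE ?(le_trans F0).
by rewrite ler_pdivrMr ?exprn_gt0// mul1r.
Qed.

Definition root (D : nat) (x : R) : R := x `^ (D%:R^-1).

Lemma rootK D x : (0 < D)%N -> 0 <= x -> root D x ^+ D = x.
Proof.
move=> D0 x0; rewrite /root -powR_mulrn ?powR_ge0// -powRrM mulVf ?powRr1//.
by rewrite pnatr_eq0 -lt0n.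
Qed.

Lemma root_ge0 D x : 0 <= root D x.
Proof. exact: powR_ge0. Qed.

Lemma root_gt0 D x : 0 < x -> 0 < root D x.
Proof. exact: powR_gt0. Qed.

Lemma le_root D x y : 0 <= x -> x <= y -> root D x <= root D y.
Proof.
by move=> x0 xy; apply: ge0_ler_powR; rewrite ?invr_ge0 ?nnegrE// (le_trans x0).
Qed.

Lemma measurable_root D : measurable_fun setT (root D).
Proof. exact: measurable_powR. Qed.

(* Induction on n: Hoelder's inequality in the first coordinate, on which at most
   D of the factors depend. *)
Lemma finner_bounded n (I : finType) (Q : pred I) (D : nat)
    (F : I -> n.-tuple T -> R) (dep : I -> pred 'I_n) (M N : I -> R) :
  (0 < D)%N ->
  (forall a, #|[pred i | Q i && dep i a]| <= D)%N ->
  (forall i, measurable_fun setT (F i)) ->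
  (forall i x, 0 <= F i x <= M i) ->
  (forall i x y, (forall a, dep i a -> tnth x a = tnth y a) -> F i x = F i y) ->
  (forall i, 0 < N i) ->
  (forall i, \int[power_prob P n]_x (F i x ^+ D) < N i ^+ D) ->
  \int[power_prob P n]_x \prod_(i | Q i) F i x <= \prod_(i | Q i) N i.
Proof.
move=> D0.
elim: n F dep M N => [|n IH] F dep M N degD mF FM Fdep N0 FN.
  rewrite (@eq_Rintegral _ _ _ _ _ (fun=> \prod_(i | Q i) F i [tuple])); last first.
    by move=> x _; rewrite tuple0.
  rewrite prob_cst; apply: ler_prod => i _.
  have /andP[-> _] := FM i [tuple]; move: (FN i).
  rewrite (@eq_Rintegral _ _ _ _ _ (fun=> F i [tuple] ^+ D)); last first.
    by move=> x _; rewrite tuple0.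
  rewrite prob_cst => /ltW; rewrite ler_pXn2r// ?nnegrE ?(ltW (N0 _))//.
  by have /andP[-> _] := FM i [tuple].
have FMD i x : `|F i x ^+ D| <= M i ^+ D.
  have /andP[F0 FM'] := FM i x.
  by rewrite ger0_norm ?exprn_ge0// lerXn2r ?nnegrE ?(le_trans F0).
pose fc i (z : T * n.-tuple T) := F i (tuple_cons z).
have mfc i : measurable_fun setT (fc i).
  by apply: measurableT_comp => //; exact: measurable_funP.
have mfc1 i t : measurable_fun setT (fun x => fc i (x, t)).
  by apply: measurableT_comp => //; exact: pair2_measurable.
(* The head coordinate is put second, so that Fubini's theorem makes it the inner variable. *)
pose fs i (z : n.-tuple T * T) := fc i (z.2, z.1) ^+ D.
have mfs i : measurable_fun setT (fs i).
  apply: measurable_funX; apply: (measurableT_comp (mfc i)).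
  by apply: measurable_fun_pair.
have bfs i z : `|fs i z| <= M i ^+ D by exact: FMD.
pose J i t := \int[P]_x fs i (t, x).
have intfs i : intg (power_prob P n \x P)%E (fs i).
  exact: (@bounded_intg _ _ _ (prod_prob (power_prob P n) P) _ _ (mfs i) (bfs i)).
have iJ i : intg (power_prob P n) (J i) by exact: intg_fubini (intfs i).
have swap_law : is_law (power_prob P n \x P)%E (power_prob P n.+1)
    (fun z => tuple_cons (z.2, z.1)).
  apply: power_law.
    apply: measurableT_comp; first exact: measurable_funP.
    exact: measurable_fun_pair.
  move=> A mA; rewrite big_ord_recl muleC.
  rewrite (_ : _ @^-1` _ = box (fun i => A (lift ord0 i)) `*` A ord0); last first.
    apply/seteqP; split => -[t x] /=.
      move=> h; split; last by have := h ord0; rewrite /tuple_cons tnth0.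
      by move=> i; have := h (lift ord0 i); rewrite /tuple_cons tnthS.
    move=> [h1 h2] i; case: (unliftP ord0 i) => [j ->|->].
      by rewrite /tuple_cons tnthS; exact: h1.
    by rewrite /tuple_cons tnth0.
  rewrite -(@power_box _ _ _ P n (fun i => A (lift ord0 i)))//.
  by apply: product_measure1E => //; exact: measurable_box.
have EJ i : \int[power_prob P n]_t J i t = \int[power_prob P n.+1]_x (F i x ^+ D).
  rewrite (Rintegral_law swap_law); last exact: measurable_funX.
  by rewrite [RHS](Rintegral_fubini (intfs i)).
(* Half of the slack in the strict hypothesis. Adding it to [J] makes the new norms positive, as
   Hoelder's inequality requires, and keeps the hypothesis of the induction strict. *)
pose eta i := (N i ^+ D - \int[power_prob P n.+1]_x (F i x ^+ D)) / 2.
have eta0 i : 0 < eta i by rewrite divr_gt0// subr_gt0.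
have J0 i t : 0 <= J i t.
  apply: Rintegral_ge0 => x _; apply: exprn_ge0.
  by have /andP[] := FM i (tuple_cons (x, t)).
have JM i t : J i t <= M i ^+ D.
  rewrite (le_trans (ler_norm _))//; apply: Rintegral_bound => //.
  by apply: measurableT_comp => //; exact: pair1_measurable.
pose F' i t := root D (J i t + eta i).
have F'D i t : F' i t ^+ D = J i t + eta i.
  by rewrite rootK// addr_ge0// ltW.
have mF' i : measurable_fun setT (F' i).
  apply: (measurableT_comp (measurable_root D)).
  by apply: measurable_funD => //; exact: intg_measurable (iJ i).
(* A factor which ignores the head coordinate coincides with its own partial D-norm, so it can leave
   the inner integral. *)
have fc_le i t x : ~~ dep i ord0 -> fc i (x, t) <= F' i t.
  move=> ndep; rewrite -(@ler_pXn2r _ D)// ?nnegrE ?root_ge0//; last first.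
    by have /andP[] := FM i (tuple_cons (x, t)).
  rewrite F'D /J (@eq_Rintegral _ _ _ _ _ (fun=> fc i (x, t) ^+ D)).
    by rewrite prob_cst lerDl ltW.
  move=> y _; congr (_ ^+ D); apply: Fdep => a.
  case: (unliftP ord0 a) => [j ->|->] depa; last by rewrite depa in ndep.
  by rewrite /tuple_cons !tnthS.
pose dep' i : pred 'I_n := fun a => dep i (lift ord0 a).
apply: (@le_trans _ _ (\int[power_prob P n]_t \prod_(i | Q i) F' i t)); last first.
  apply: (IH _ dep' (fun i => root D (M i ^+ D + eta i))) => //.
  - by move=> a; exact: degD.
  - move=> i t; rewrite root_ge0/= le_root ?lerD2r//.
    by rewrite addr_ge0// ltW.
  - move=> i s t st; congr (root D (_ + _)); apply: eq_Rintegral => x _.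
    congr (_ ^+ D); apply: Fdep => a.
    case: (unliftP ord0 a) => [j ->|->] depa; rewrite /tuple_cons ?tnth0//.
    by rewrite !tnthS; exact: st.
  - move=> i; under eq_Rintegral do rewrite F'D.
    rewrite RintegralD//; last exact: intg_cst.
    rewrite EJ prob_cst /eta.
    by have := FN i; lra.
have mprod : measurable_fun setT (fun z : n.-tuple T * T => \prod_(i | Q i) fc i (z.2, z.1)).
  apply: measurable_bprod => i _; apply: (measurableT_comp (mfc i)).
  exact: measurable_fun_pair.
have bprod (z : n.-tuple T * T) : `|\prod_(i | Q i) fc i (z.2, z.1)| <= \prod_(i | Q i) M i.
  rewrite normr_prod; apply: ler_prod => i _; rewrite normr_ge0/=.
  by have /andP[F0 FM'] := FM i (tuple_cons (z.2, z.1)); rewrite ger0_norm.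
have iprod : intg (power_prob P n \x P)%E
    (fun z => \prod_(i | Q i) fc i (z.2, z.1)).
  exact: (@bounded_intg _ _ _ (prod_prob (power_prob P n) P) _ _ mprod bprod).
rewrite (Rintegral_law swap_law); last by apply: measurable_bprod => i _.
rewrite [leLHS](Rintegral_fubini iprod) /=.
apply: le_Rintegral => //; first exact: intg_fubini iprod.
  apply: (@bounded_intg _ _ _ _ _ (\prod_(i | Q i) root D (M i ^+ D + eta i))).
    by apply: measurable_bprod => i _.
  move=> t; rewrite normr_prod; apply: ler_prod => i _; rewrite normr_ge0/=.
  rewrite ger0_norm ?root_ge0// le_root ?lerD2r//.
  by rewrite addr_ge0// ltW.
(* With the tail [t] fixed, only the at most D factors that depend on the head stay under the
   integral; the others are bounded by their [F']. *)
move=> t _; rewrite (bigID (fun i => dep i ord0))/=.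
set S := [pred i | Q i && dep i ord0].
apply: (@le_trans _ _ (\int[P]_x (\prod_(i in S) fc i (x, t) *
    \prod_(i | Q i && ~~ dep i ord0) F' i t))).
  apply: le_Rintegral => //.
  - apply: (@bounded_intg _ _ _ _ _ (\prod_(i | Q i) M i)).
      by apply: measurable_bprod => i _.
    by move=> x; exact: (bprod (t, x)).
  - under eq_fun do rewrite mulrC.
    apply: intgZl; apply: (@bounded_intg _ _ _ _ _ (\prod_(i in S) M i)).
      by apply: measurable_bprod => i _.
    move=> x; rewrite normr_prod; apply: ler_prod => i _; rewrite normr_ge0/=.
    by have /andP[F0 FM'] := FM i (tuple_cons (x, t)); rewrite ger0_norm.
  move=> x _; rewrite [leLHS](bigID (fun i => dep i ord0))/=.
  apply: ler_wpM2l.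
    by apply: prodr_ge0 => i _; have /andP[] := FM i (tuple_cons (x, t)).
  apply: ler_prod => i /andP[_ ndep]; rewrite fc_le// andbT.
  by have /andP[] := FM i (tuple_cons (x, t)).
rewrite RintegralZr//; last first.
  apply: (@bounded_intg _ _ _ _ _ (\prod_(i in S) M i)).
    by apply: measurable_bprod => i _.
  move=> x; rewrite normr_prod; apply: ler_prod => i _; rewrite normr_ge0/=.
  by have /andP[F0 FM'] := FM i (tuple_cons (x, t)); rewrite ger0_norm.
apply: ler_wpM2r; first by apply: prodr_ge0 => i _; exact: root_ge0.
apply: (@Rintegral_prod_le _ S D (fun i x => fc i (x, t)) M (F' ^~ t)) => //.
- exact: degD.
- by move=> i x; exact: FM.
- by move=> i; rewrite root_gt0// ltr_wpDl.
- by move=> i; rewrite F'D lerDl ltW.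
Qed.

End finner_inequality.

(** * Cut norm *)

Section sign_lemma.
Context d1 d2 (X : measurableType d1) (Y : measurableType d2) (R : realType).
Variables (P : probability X R) (Q : probability Y R).

Lemma Rintegral_ae_eq (f g : X -> R) :
  measurable_fun setT f -> measurable_fun setT g ->
  {ae P, forall x, f x = g x} -> \int[P]_x f x = \int[P]_x g x.
Proof.
move=> mf mg fg; congr fine; apply: ae_eq_integral => //.
- exact/measurable_EFinP.
- exact/measurable_EFinP.
- by apply: filterS fg => x -> _.
Qed.

Lemma Rintegral_mul_fst (w : X * Y -> R) (phi : X -> R) (M : R) :
  intg (P \x Q)%E w -> measurable_fun setT phi -> (forall x, `|phi x| <= M) ->
  \int[(P \x Q)%E]_z (w z * phi z.1) =
  \int[P]_x ((\int[Q]_y w (x, y)) * phi x).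
Proof.
move=> iw mphi phiM.
have iwp : intg (P \x Q)%E (fun z => w z * phi z.1).
  apply: (@intgM _ _ _ (prod_prob P Q) _ _ M) => //.
  exact: (measurableT_comp mphi).
rewrite (Rintegral_fubini iwp); apply: Rintegral_ae_eq.
- exact: intg_measurable (intg_fubini iwp).
- by apply: measurable_funM => //; exact: intg_measurable (intg_fubini iw).
apply: filterS (intg_section iw) => x ix /=.
by rewrite RintegralZr.
Qed.

(* The worst test function bounded by 1 is the sign of the partial integral of w. *)
Lemma norm_Rintegral_mul_fst (w : X * Y -> R) (phi : X -> R) (M eps : R) :
  intg (P \x Q)%E w -> measurable_fun setT phi -> (forall x, `|phi x| <= M) ->
  (forall S, measurable S -> `|\int[(P \x Q)%E]_z (w z * \1_S z.1)| <= eps) ->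
  `|\int[(P \x Q)%E]_z (w z * phi z.1)| <= 2 * M * eps.
Proof.
move=> iw mphi phiM weps.
pose h x := \int[Q]_y w (x, y).
have ih : intg P h by exact: intg_fubini.
have mh : measurable_fun setT h by exact: intg_measurable ih.
have M0 : 0 <= M by exact: le_trans (normr_ge0 _) (phiM point).
pose S := [set x | 0 <= h x].
have mS : measurable S.
  rewrite (_ : S = h @^-1` `[0, +oo[%classic).
    by rewrite -[X in measurable X]setTI; apply: mh.
  by apply/seteqP; split => x /=; rewrite in_itv/= andbT.
have indic1 (A : set X) x : `|\1_A x : R| <= 1.
  by rewrite indicE; case: (_ \in _); rewrite ?normr1 ?normr0.
have ihS (A : set X) : measurable A -> intg P (fun x => h x * \1_A x).
  by move=> mA; exact: intgM (indic1 A).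
rewrite (Rintegral_mul_fst iw mphi phiM) -/h.
apply: (@le_trans _ _ (M * (\int[P]_x (h x * \1_S x) - \int[P]_x (h x * \1_(~` S) x)))).
  rewrite -RintegralB//; last 2 first.
  - exact: ihS.
  - by apply: ihS; exact: measurableC.
  have iB : intg P (fun x => h x * \1_S x - h x * \1_(~` S) x).
    by apply: intgB; apply: ihS => //; exact: measurableC.
  rewrite -RintegralZl//; apply: le_Rintegral_norm => //.
  - exact: intgM phiM.
  - exact: intgZl.
  move=> x; rewrite normrM mulrC; apply: ler_pM => //.
  rewrite !indicE in_setC; case: (boolP (x \in S)) => [|/negP xS].
    by rewrite inE => /= h0; rewrite mulr1 mulr0 subr0 ger0_norm.
  have : ~ (0 <= h x) by move=> h0; apply: xS; rewrite inE.
  by move/negP; rewrite -ltNge => /ltW h0; rewrite mulr0 mulr1 sub0r ler0_norm.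
rewrite -mulrA mulrCA; apply: ler_wpM2l => //.
have E (A : set X) : measurable A ->
    `|\int[P]_x (h x * \1_A x)| <= eps.
  move=> mA; have := weps A mA.
  by rewrite (Rintegral_mul_fst iw _ (indic1 A)).
have := E _ mS; have := E _ (measurableC mS).
by rewrite !ler_norml; lra.
Qed.

Lemma swap_law : is_law (P \x Q)%E (Q \x P)%E (fun z => (z.2, z.1)).
Proof.
have ms : measurable_fun setT (fun z : X * Y => (z.2, z.1)).
  exact: measurable_fun_pair.
split => // A mA.
pose mfs : {mfun (X * Y)%type >-> (Y * X)%type} :=
  MeasurableFun.Pack (MeasurableFun.Class (isMeasurableFun.Build _ _ _ _ _ ms)).
apply: esym; apply: (product_measure_unique
  (m' := pushforward (prod_prob P Q) mfs)) => //.
move=> B C mB mC; rewrite /= /pushforward.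
rewrite (_ : _ @^-1` _ = C `*` B); last first.
  by apply/seteqP; split => -[x y] [].
by rewrite muleC; apply: product_measure1E.
Qed.

End sign_lemma.

Section cut_bound.
Context d (T : measurableType d) (R : realType) (P : probability T R).

Definition cut_le (w : T * T -> R) (eps : R) :=
  forall S S', measurable S -> measurable S' ->
  `|\int[(P \x P)%E]_(z in S `*` S') w z| <= eps.

Lemma norm_Rintegral_mul_snd (w : T * T -> R) (phi : T -> R) (M eps : R) :
  intg (P \x P)%E w -> measurable_fun setT phi -> (forall x, `|phi x| <= M) ->
  (forall S, measurable S -> `|\int[(P \x P)%E]_z (w z * \1_S z.2)| <= eps) ->
  `|\int[(P \x P)%E]_z (w z * phi z.2)| <= 2 * M * eps.
Proof.
move=> iw mphi phiM weps.
have mw : measurable_fun setT w by exact: (intg_measurable (P := prod_prob P P) iw).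
pose w' (z : T * T) := w (z.2, z.1).
have [ms _] := swap_law P P.
have E (g : T -> R) : measurable_fun setT g ->
    \int[(P \x P)%E]_z (w z * g z.2) = \int[(P \x P)%E]_z (w' z * g z.1).
  move=> mg; rewrite (Rintegral_law (swap_law P P))//.
  apply: measurable_funM => //; exact: (measurableT_comp mg).
rewrite E//; apply: norm_Rintegral_mul_fst => //.
  apply: (proj1 (integrable_law (swap_law P P) _)) iw.
  exact/measurable_EFinP.
by move=> S mS; rewrite -E//; exact: weps.
Qed.

(** Sets are replaced by bounded functions in one variable at a time; each replacement costs a
    factor 2 from the two signs, whence the 4. *)
Lemma cut_bilinear (w : T * T -> R) (phi psi : T -> R) (M N eps : R) :
  intg (P \x P)%E w -> cut_le w eps ->
  measurable_fun setT phi -> (forall x, `|phi x| <= M) ->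
  measurable_fun setT psi -> (forall x, `|psi x| <= N) ->
  `|\int[(P \x P)%E]_z (w z * phi z.1 * psi z.2)| <= 4 * M * N * eps.
Proof.
move=> iw cw mphi phiM mpsi psiN.
have -> : 4 * M * N * eps = 2 * N * (2 * M * eps) by ring.
have indic1 (A : set T) x : `|\1_A x : R| <= 1.
  by rewrite indicE; case: (_ \in _); rewrite ?normr1 ?normr0.
apply: norm_Rintegral_mul_snd => //.
  apply: (@intgM _ _ _ (prod_prob P P) _ _ M) => //.
  exact: (measurableT_comp mphi).
move=> S mS.
have -> : \int[(P \x P)%E]_z (w z * phi z.1 * \1_S z.2) =
    \int[(P \x P)%E]_z (w z * \1_S z.2 * phi z.1).
  by apply: eq_Rintegral => z _; rewrite mulrAC.
apply: norm_Rintegral_mul_fst => //.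
  apply: (@intgM _ _ _ (prod_prob P P) _ _ 1) => //.
  have m1S : measurable_fun setT (\1_S : T -> R) by exact: measurable_indic.
  exact: (measurableT_comp m1S measurable_snd).
move=> S' mS'.
have -> : \int[(P \x P)%E]_z (w z * \1_S z.2 * \1_S' z.1) =
    \int[(P \x P)%E]_(z in S' `*` S) w z.
  transitivity (\int[(P \x P)%E]_z (w z * \1_(S' `*` S) z)); last first.
    exact/esym/(Rintegral_setE (prod_prob P P)).
  apply: eq_Rintegral => -[x y] _ /=.
  rewrite -mulrA; congr (_ * _); rewrite !indicE in_setX /=.
  by case: (_ \in _); case: (_ \in _); rewrite ?mulr0 ?mulr1.
exact: cw.
Qed.

End cut_bound.

(** * Homomorphism densities *)

Section graph_integrals.
Context d (T : measurableType d) (R : realType) (P : probability T R).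
Variables (v : nat) (E : pred ('I_v * 'I_v)) (D : nat).
Hypothesis D_gt0 : (0 < D)%N.
Hypothesis E_lt : forall e, E e -> (e.1 < e.2)%N.
Hypothesis E_deg :
  forall a, (#|[pred e | E e && ((e.1 == a) || (e.2 == a))]| <= D)%N.

Definition edge_at (x : v.-tuple T) (e : 'I_v * 'I_v) := (tnth x e.1, tnth x e.2).

(* The L^D norm of U is less than N; stated without extracting a root. *)
Definition norm_lt (U : T * T -> R) (N : R) :=
  [/\ 0 < N, measurable_fun setT U &
      (\int[(P \x P)%E]_z (`|U z| ^+ D)%:E < (N ^+ D)%:E)%E].

Lemma edge_law e : E e -> is_law (power_prob P v) (P \x P)%E (edge_at ^~ e).
Proof.
by move=> Ee; apply: pair_law; apply/eqP => ee; have := E_lt Ee; rewrite ee ltnn.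
Qed.

Lemma measurable_edge_at e : measurable_fun setT (edge_at ^~ e).
Proof. by apply: measurable_fun_pair; exact: measurable_tnth. Qed.

Lemma measurable_edge (U : T * T -> R) e : measurable_fun setT U ->
  measurable_fun setT (fun x => U (edge_at x e)).
Proof. by move=> mU; apply: (measurableT_comp mU (measurable_edge_at e)). Qed.

Lemma measurable_norm_pow (U : T * T -> R) : measurable_fun setT U ->
  measurable_fun setT (fun z => (`|U z| ^+ D)%:E).
Proof.
move=> mU; apply/measurable_EFinP; apply: measurable_funX.
exact: measurableT_comp.
Qed.

Lemma finner_kernel_bounded (F : 'I_v * 'I_v -> T * T -> R)
    (M N : 'I_v * 'I_v -> R) :
  (forall e z, 0 <= F e z <= M e) -> (forall e, E e -> norm_lt (F e) (N e)) ->
  \int[power_prob P v]_x \prod_(e | E e) F e (edge_at x e) <= \prod_(e | E e) N e.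
Proof.
move=> FM FN.
(* Outside [E] nothing is known about [F e], not even measurability; the value 0 with norm bound 1
   satisfies the hypotheses of [finner_bounded], which concern all indices. *)
pose F' e x := if E e then F e (edge_at x e) else 0.
pose N' e := if E e then N e else 1.
rewrite (@eq_Rintegral _ _ _ _ _ (fun x => \prod_(e | E e) F' e x)); last first.
  by move=> x _; apply: eq_bigr => e Ee; rewrite /F' Ee.
rewrite (eq_bigr N'); last by move=> e Ee; rewrite /N' Ee.
apply: (@finner_bounded _ _ _ P v _ E D F'
  (fun e a => (e.1 == a) || (e.2 == a)) M N') => //.
- move=> e; rewrite /F'; case: (boolP (E e)) => // Ee.
  by apply: measurable_edge; case: (FN e Ee).
- move=> e x; rewrite /F'; case: ifP => // _.
  by have /andP[F0 FM'] := FM e point; rewrite lexx (le_trans F0).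
- move=> e x y xy; rewrite /F'; case: ifP => // _; rewrite /edge_at.
  by rewrite !xy ?eqxx ?orbT.
- by move=> e; rewrite /N'; case: (boolP (E e)) => // Ee; case: (FN e Ee).
move=> e; rewrite /F' /N'; case: (boolP (E e)) => Ee; last first.
  rewrite expr1n (@eq_Rintegral _ _ _ _ _ (fun=> 0)) ?prob_cst//.
  by move=> x _; rewrite expr0n; case: (D) D_gt0.
have [N0 mF FN'] := FN e Ee.
have mFD : measurable_fun setT (fun z => F e z ^+ D) by exact: measurable_funX.
rewrite -(Rintegral_law (edge_law Ee) mFD) -lte_fin -Rintegral_fin.
  rewrite (eq_integral (fun z => (`|F e z| ^+ D)%:E))// => z _.
  by rewrite ger0_norm//; have /andP[] := FM e z.
apply: (@bounded_intg _ _ _ (prod_prob P P) _ (M e ^+ D)) => // z.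
have /andP[F0 FM'] := FM e z.
by rewrite ger0_norm ?exprn_ge0// lerXn2r ?nnegrE ?(le_trans F0).
Qed.

(** Monotone convergence along the truncations min(|F e|, k) removes the boundedness assumption. *)
Lemma finner_kernel (F : 'I_v * 'I_v -> T * T -> R) (N : 'I_v * 'I_v -> R) :
  (forall e, E e -> norm_lt (F e) (N e)) ->
  (\int[power_prob P v]_x (\prod_(e | E e) `|F e (edge_at x e)|)%:E
    <= (\prod_(e | E e) N e)%:E)%E.
Proof.
move=> FN.
pose Fk (k : nat) e z := Num.min `|F e z| k%:R.
have mF e : E e -> measurable_fun setT (F e) by move=> /FN[].
have Fk0 k e z : 0 <= Fk k e z by rewrite /Fk le_min normr_ge0/=.
have mFk k e : E e -> measurable_fun setT (Fk k e).
  move=> Ee; apply: measurable_minr => //.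
  by apply: measurableT_comp => //; exact: mF.
pose g k x := (\prod_(e | E e) Fk k e (edge_at x e))%:E.
have mg k : measurable_fun setT (g k).
  apply/measurable_EFinP; apply: measurable_bprod => e Ee.
  by apply: measurable_edge; exact: mFk.
have g0 k x : (0 <= g k x)%E by rewrite lee_fin prodr_ge0.
have nd_g x : {homo g ^~ x : m n / (m <= n)%N >-> (m <= n)%E}.
  move=> m n mn; rewrite lee_fin; apply: ler_prod => e _; rewrite Fk0/=.
  rewrite /Fk le_min ge_min lexx/= ge_min.
  by rewrite (_ : m%:R <= n%:R) ?orbT// ler_nat.
have limg x : limn (g ^~ x) = (\prod_(e | E e) `|F e (edge_at x e)|)%:E.
  apply: lim_near_cst => //.
  have [K hK] : exists K, forall e, `|F e (edge_at x e)| <= K.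
    exists (\sum_e `|F e (edge_at x e)|) => e.
    by rewrite (bigD1 e)//= lerDl sumr_ge0.
  near=> k; congr (_%:E); apply: eq_bigr => e _; apply/min_idPl.
  apply: (le_trans (hK e)); near: k.
  exact: nbhs_infty_ger.
under eq_integral do rewrite -limg.
rewrite (monotone_convergence _ measurableT mg (fun k x _ => g0 k x) (fun x _ => nd_g x)).
apply: lime_le.
  apply: ereal_nondecreasing_is_cvgn => m n mn.
  by apply: ge0_le_integral => // x _; exact: nd_g.
apply: nearW => k; rewrite Rintegral_fin; last first.
  apply: (@bounded_intg _ _ _ _ _ (\prod_(e | E e) k%:R)).
    by apply: measurable_bprod => e Ee; apply: measurable_edge; exact: mFk.
  move=> x; rewrite normr_prod; apply: ler_prod => e _; rewrite normr_ge0/=.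
  by rewrite ger0_norm// /Fk ge_min lexx orbT.
rewrite lee_fin; apply: (@finner_kernel_bounded (Fk k) (fun=> k%:R)).
  by move=> e z; rewrite Fk0/= /Fk ge_min lexx orbT.
move=> e Ee; have [N0 mFe FeN] := FN e Ee; split => //; first exact: mFk.
apply: le_lt_trans FeN; apply: ge0_le_integral => //.
- by apply: measurable_norm_pow; exact: mFk.
- exact: measurable_norm_pow.
- move=> z _; rewrite lee_fin (ger0_norm (Fk0 _ _ _)) lerXn2r ?nnegrE//.
  by rewrite /Fk ge_min lexx.
Unshelve. all: by end_near. Qed.

(** Each edge has its own kernel and each vertex its own weight, so that kernels can be exchanged
    edge by edge and the colour r enters as the weight f_r. *)
Definition hom_integrand (U : 'I_v * 'I_v -> T * T -> R) (g : 'I_v -> T -> R) x :=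
  \prod_(e | E e) U e (edge_at x e) * \prod_(a < v) g a (tnth x a).

Definition hom_density U g := \int[power_prob P v]_x hom_integrand U g x.

Definition unit_test (g : 'I_v -> T -> R) :=
  (forall a, measurable_fun setT (g a)) /\ forall a x, `|g a x| <= 1.

Lemma norm_prod_test g (Q : pred 'I_v) x : unit_test g ->
  `|\prod_(a | Q a) g a (tnth x a)| <= 1.
Proof.
move=> [_ g1]; rewrite normr_prod.
apply: (@le_trans _ _ (\prod_(a | Q a) (1 : R))); last by rewrite big1.
by apply: ler_prod => a _; rewrite normr_ge0 g1.
Qed.

Lemma measurable_prod_test g (Q : pred 'I_v) : unit_test g ->
  measurable_fun setT (fun x : v.-tuple T => \prod_(a | Q a) g a (tnth x a)).
Proof. by move=> [mg _]; apply: measurable_bprod => a _; exact: measurable_tnth_fun. Qed.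

Lemma intg_edges U (N : 'I_v * 'I_v -> R) : (forall e, E e -> norm_lt (U e) (N e)) ->
  intg (power_prob P v) (fun x => \prod_(e | E e) U e (edge_at x e)).
Proof.
move=> UN; apply/integrableP; split.
  apply/measurable_EFinP; apply: measurable_bprod => e Ee.
  by apply: measurable_edge; case: (UN e Ee).
apply: le_lt_trans (ltry (\prod_(e | E e) N e)).
by under eq_integral do rewrite /= normr_prod; exact: finner_kernel.
Qed.

Lemma intg_hom U g N : (forall e, E e -> norm_lt (U e) (N e)) -> unit_test g ->
  intg (power_prob P v) (hom_integrand U g).
Proof.
move=> UN ug; apply: (@intgM _ _ _ _ _ _ 1).
- exact: intg_edges UN.
- exact: measurable_prod_test.
- by move=> x; exact: norm_prod_test.
Qed.

Lemma hom_bound U g N : (forall e, E e -> norm_lt (U e) (N e)) -> unit_test g ->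
  `|hom_density U g| <= \prod_(e | E e) N e.
Proof.
move=> UN ug; have iE := intg_edges UN.
have iN : intg (power_prob P v) (fun x => \prod_(e | E e) `|U e (edge_at x e)|).
  have := integrable_norm iE; apply: eq_integrable => // x _ /=.
  by rewrite normr_prod.
rewrite -lee_fin; apply: (le_trans _ (finner_kernel UN)).
rewrite Rintegral_fin// lee_fin; apply: le_Rintegral_norm => //.
  exact: intg_hom UN ug.
move=> x; rewrite normrM normr_prod ler_piMr// ?norm_prod_test//.
by rewrite prodr_ge0.
Qed.

Definition upd (U : 'I_v * 'I_v -> T * T -> R) e0 w e := if e == e0 then w else U e.

(** The density is linear in the kernel of each single edge. The norm bounds serve to make both
    integrands integrable, so that the integrals may be subtracted. *)
Lemma hom_sub U U' e0 g N : E e0 ->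
  (forall e, E e -> norm_lt (U e) (N e)) -> (forall e, E e -> norm_lt (U' e) (N e)) ->
  unit_test g -> (forall e, E e -> e != e0 -> U e = U' e) ->
  hom_density U g - hom_density U' g =
  hom_density (upd U e0 (fun z => U e0 z - U' e0 z)) g.
Proof.
move=> Ee0 UN UN' ug UU'; rewrite /hom_density -RintegralB//; last 2 first.
- exact: intg_hom UN ug.
- exact: intg_hom UN' ug.
apply: eq_Rintegral => x _; rewrite /hom_integrand -mulrBl; congr (_ * _).
rewrite (bigD1 e0)//= [X in _ - X](bigD1 e0)//= [RHS](bigD1 e0)//=.
rewrite /upd eqxx mulrBl; congr (_ - _); congr (_ * _).
  by apply: eq_bigr => e /andP[_ /negbTE->].
by apply: eq_bigr => e /andP[Ee ee0]; rewrite (negbTE ee0) UU'.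
Qed.

Lemma eq_hom U U' g : (forall e, E e -> U e = U' e) ->
  hom_density U g = hom_density U' g.
Proof.
move=> UU'; apply: eq_Rintegral => x _; rewrite /hom_integrand; congr (_ * _).
by apply: eq_bigr => e /UU' ->.
Qed.

Definition hybrid (I : eqType) (X : Type) (A B : I -> X) (C : seq I) i :=
  if i \in C then B i else A i.

(** Telescoping along an enumeration of [I]: [A] is turned into [B] by changing one value at a
    time. *)
Lemma hybrid_le (I : finType) (X : Type) (Phi : (I -> X) -> R) (A B : I -> X)
    (dl : R) :
  (forall C i, `|Phi (hybrid A B C) - Phi (hybrid A B (i :: C))| <= dl) ->
  `|Phi A - Phi B| <= #|I|%:R * dl.
Proof.
move=> h.
have H (C : seq I) : `|Phi A - Phi (hybrid A B C)| <= (size C)%:R * dl.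
  elim: C => [|i C IH].
    by rewrite (_ : hybrid A B [::] = A) ?subrr ?normr0 ?mul0r.
  rewrite (_ : _ - _ = (Phi A - Phi (hybrid A B C)) +
    (Phi (hybrid A B C) - Phi (hybrid A B (i :: C)))); last by ring.
  by rewrite (le_trans (ler_normD _ _))// -natr1 mulrDl mul1r lerD.
have := H (enum I); rewrite -cardE (_ : hybrid A B (enum I) = B)//.
by apply/funext => i; rewrite /hybrid mem_enum.
Qed.

End graph_integrals.

Section clipping.
Context (R : realType).
Implicit Types K u : R.

Definition clip K u := Num.max (- K) (Num.min u K).

Lemma norm_clip K u : 0 <= K -> `|clip K u| <= K.
Proof.
move=> K0; rewrite /clip ler_norml le_max lexx/= ge_max.
by rewrite (le_trans _ K0) ?oppr_le0// ge_min lexx orbT.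
Qed.

Lemma clip_id K u : `|u| <= K -> clip K u = u.
Proof. by rewrite ler_norml /clip => /andP[a b]; rewrite min_l// max_r. Qed.

Lemma clip_le K u : 0 <= K -> `|clip K u| <= `|u|.
Proof.
move=> K0; have [uK|Ku] := leP `|u| K; first by rewrite clip_id.
by rewrite (le_trans (norm_clip _ K0))// ltW.
Qed.

(** Writes the part removed by clipping as a convex function of |u|, the form in which it passes to
    weak limits. *)
Lemma sub_clipE K u : 0 <= K -> `|u - clip K u| = Num.max (`|u| - K) 0.
Proof.
move=> K0; have [uK|Ku] := leP `|u| K.
  by rewrite clip_id// subrr normr0 max_r// subr_le0.
rewrite max_l; last by rewrite subr_ge0 ltW.
rewrite /clip; have [u0|u0] := leP 0 u.
  move: Ku; rewrite ger0_norm// => Ku.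
  rewrite min_r ?(ltW Ku)// max_r ?(le_trans _ K0) ?oppr_le0//.
  by rewrite ger0_norm// subr_ge0 ltW.
move: Ku; rewrite ltr0_norm// => Ku.
rewrite min_l; last by lra.
rewrite max_l; last by lra.
by rewrite ler0_norm; lra.
Qed.

Lemma measurable_clip K : measurable_fun setT (clip K).
Proof. by apply: measurable_maxr => //; exact: measurable_minr. Qed.

End clipping.

(** * Counting lemma for kernels bounded in L^D *)

Section counting_lemma.
Context d (T : measurableType d) (R : realType) (P : probability T R).
Variables (v : nat) (E : pred ('I_v * 'I_v)) (D : nat).
Hypothesis D_gt0 : (0 < D)%N.
Hypothesis E_lt : forall e, E e -> (e.1 < e.2)%N.
Hypothesis E_deg :
  forall a, (#|[pred e | E e && ((e.1 == a) || (e.2 == a))]| <= D)%N.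

Local Notation norm_lt := (norm_lt P D).
Local Notation hom_density := (hom_density P E).
Local Notation m := #|{: 'I_v * 'I_v}|.

Lemma norm_lt_le (U U' : T * T -> R) N : measurable_fun setT U' ->
  (forall z, `|U' z| <= `|U z|) -> norm_lt U N -> norm_lt U' N.
Proof.
move=> mU' UU' [N0 mU UN]; split => //; apply: le_lt_trans UN.
apply: ge0_le_integral => //; [exact: measurable_norm_pow..|].
by move=> z _; rewrite lee_fin lerXn2r ?nnegrE.
Qed.

Lemma norm_lt_leN (U : T * T -> R) N N' : N <= N' -> norm_lt U N -> norm_lt U N'.
Proof.
move=> NN' [N0 mU UN]; split => //; first exact: lt_le_trans NN'.
apply: (lt_le_trans UN); rewrite lee_fin lerXn2r ?nnegrE// ltW//.
exact: lt_le_trans NN'.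
Qed.

Lemma norm_lt0 N : 0 < N -> norm_lt (fun=> 0) N.
Proof.
move=> N0; split => //.
rewrite (eq_integral (fun=> 0%E)); last first.
  by move=> z _; rewrite normr0 expr0n; case: (D) D_gt0.
by rewrite integral0 lte_fin exprn_gt0.
Qed.

(** A crude triangle inequality without Minkowski: |a - b|^D is at most 2^D (|a|^D + |b|^D), and 2^D
    times 2 is at most 4^D since D is positive. *)
Lemma norm_ltB (U U' : T * T -> R) N : norm_lt U N -> norm_lt U' N ->
  norm_lt (fun z => U z - U' z) (4 * N).
Proof.
move=> [N0 mU UN] [_ mU' UN']; split; first by rewrite mulr_gt0.
  exact: measurable_funB.
apply: (@le_lt_trans _ _ ((2 ^+ D)%:E * (\int[(P \x P)%E]_z (`|U z| ^+ D)%:E +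
   \int[(P \x P)%E]_z (`|U' z| ^+ D)%:E))%E).
  have m1 := measurable_norm_pow D mU.
  have m2 := measurable_norm_pow D mU'.
  have m12 := emeasurable_funD m1 m2.
  rewrite -ge0_integralD// -ge0_integralZl//; last first.
    by move=> z _; rewrite -EFinD lee_fin addr_ge0.
  apply: ge0_le_integral => //.
  - by apply: measurable_norm_pow; exact: measurable_funB.
  - exact: measurable_funeM.
  move=> z _; rewrite -EFinD -EFinM lee_fin.
  have B : `|U z - U' z| <= 2 * Num.max `|U z| `|U' z|.
    rewrite (le_trans (ler_normB _ _))//.
    have : `|U z| <= Num.max `|U z| `|U' z| by rewrite le_max lexx.
    have : `|U' z| <= Num.max `|U z| `|U' z| by rewrite le_max lexx orbT.
    by lra.
  apply: (@le_trans _ _ ((2 * Num.max `|U z| `|U' z|) ^+ D)).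
    by rewrite lerXn2r ?nnegrE ?(le_trans (normr_ge0 _) B).
  rewrite exprMn ler_wpM2l ?exprn_ge0//.
  by have [_|_] := leP `|U z| `|U' z|; rewrite ?lerDl ?lerDr exprn_ge0.
rewrite exprMn; apply: (@lt_le_trans _ _ ((2 ^+ D)%:E * ((N ^+ D)%:E + (N ^+ D)%:E))%E).
  rewrite lte_pmul2l// ?lte_fin ?exprn_gt0//; first exact: lteD.
rewrite -EFinD -EFinM lee_fin.
have -> : (4 : R) = 2 * 2 by lra.
rewrite exprMn -mulrA ler_wpM2l ?exprn_ge0//.
have -> : N ^+ D + N ^+ D = 2 * N ^+ D by ring.
by rewrite ler_wpM2r ?exprn_ge0 ?(ltW N0)// ler_eXnr// ler1n.
Qed.

Lemma prod_le_pow (Q : pred ('I_v * 'I_v)) (F : 'I_v * 'I_v -> R) N :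
  1 <= N -> (forall e, 0 <= F e <= N) -> \prod_(e | Q e) F e <= N ^+ m.
Proof.
move=> N1 FN; apply: le_trans (ler_norm _) _.
by apply: norm_prod_card => // e _; have /andP[F0 F1] := FN e; rewrite ger0_norm.
Qed.

(** Kernels are exchanged edge by edge. In Finner's bound for one exchange the changed edge
    contributes [eta], every other edge at most [N]. *)
Lemma hom_change (A B : 'I_v * 'I_v -> T * T -> R) g (N eta : R) :
  1 <= N -> 0 < eta ->
  (forall e, E e -> norm_lt (A e) N) -> (forall e, E e -> norm_lt (B e) N) ->
  (forall e, E e -> norm_lt (fun z => A e z - B e z) eta) -> unit_test g ->
  `|hom_density A g - hom_density B g| <= m%:R * (eta * N ^+ m).
Proof.
move=> N1 eta0 AN BN ABeta ug.
have dl0 : 0 <= eta * N ^+ m.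
  by rewrite mulr_ge0 ?ltW// exprn_gt0// (lt_le_trans _ N1).
apply: (hybrid_le (Phi := hom_density ^~ g)) => C i.
have HN e s : E e -> norm_lt (hybrid A B s e) N.
  by move=> Ee; rewrite /hybrid; case: ifP => _; [exact: BN|exact: AN].
have [Ei|Ei] := boolP (E i); last first.
  rewrite (@eq_hom _ _ _ P _ E (hybrid A B (i :: C)) (hybrid A B C)) ?subrr ?normr0//.
  move=> e Ee; rewrite /hybrid inE; case: eqP => //= ei.
  by rewrite -ei Ee in Ei.
have [iC|iC] := boolP (i \in C).
  rewrite (_ : hybrid A B (i :: C) = hybrid A B C) ?subrr ?normr0//.
  by apply/funext => e; rewrite /hybrid inE; case: eqP => //= ->; rewrite iC.
rewrite (@hom_sub _ _ _ P _ E D D_gt0 E_lt E_deg _ _ i g (fun=> N))//; last 3 first.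
- by move=> e Ee; exact: HN.
- by move=> e Ee; exact: HN.
- by move=> e Ee /negbTE ei; rewrite /hybrid inE ei.
apply: (le_trans (@hom_bound _ _ _ P _ E D D_gt0 E_lt E_deg _ g
   (fun e => if e == i then eta else N) _ ug)).
  move=> e Ee; rewrite /upd; case: eqP => [ei|_]; last exact: HN.
  by rewrite /hybrid inE eqxx (negbTE iC)/=; exact: ABeta.
rewrite (bigD1 i)//= eqxx ler_pM2l//.
rewrite (eq_bigr (fun=> N)); last by move=> e /andP[_ /negbTE->].
by apply: prod_le_pow => // e; rewrite lexx (le_trans _ N1).
Qed.

(** Freeze all coordinates except the endpoints a < b of [e0]. No other edge joins a to b, so the
    remaining integrand is a bounded function of x_a times a bounded function of x_b, and
    [cut_bilinear] applies to the kernel [w] on [e0]. *)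
Lemma cut_edge (B : 'I_v * 'I_v -> T * T -> R) e0 (w : T * T -> R) g (K eps : R) :
  E e0 -> 1 <= K ->
  intg (P \x P)%E w -> cut_le P w eps ->
  (forall e, measurable_fun setT (B e)) -> (forall e z, `|B e z| <= K) ->
  unit_test g ->
  `|hom_density (upd B e0 w) g| <= 4 * K ^+ m * K ^+ m * eps.
Proof.
move=> Ee0 K1 iw cw mB BK ug.
set a := e0.1; set b := e0.2.
have ltab : (a < b)%N by exact: E_lt.
have ab : a != b by apply/eqP => ab; rewrite ab ltnn in ltab.
have mw : measurable_fun setT w by exact: (intg_measurable (P := prod_prob P P) iw).
pose Q e := E e && (e != e0).
pose rest x := \prod_(e | Q e) B e (edge_at x e) * \prod_(i < v) g i (tnth x i).
have restE x : hom_integrand E (upd B e0 w) g x = w (edge_at x e0) * rest x.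
  rewrite /hom_integrand (bigD1 e0)//= /upd eqxx -mulrA; congr (_ * (_ * _)).
  by apply: eq_bigr => e /andP[_ /negbTE->].
have mrest : measurable_fun setT rest.
  apply: measurable_funM; last exact: measurable_prod_test.
  by apply: measurable_bprod => e _; exact: measurable_edge.
have restK x : `|rest x| <= K ^+ m.
  rewrite /rest normrM -[leRHS]mulr1 ler_pM// ?norm_prod_test//.
  exact: norm_prod_card.
have iwe : intg (power_prob P v) (fun x => w (edge_at x e0)).
  apply: (proj1 (integrable_law (edge_law P E_lt Ee0) _)) iw.
  exact/measurable_EFinP.
have iF : intg (power_prob P v) (hom_integrand E (upd B e0 w) g).
  rewrite (_ : hom_integrand _ _ _ = fun x => w (edge_at x e0) * rest x).
    exact: intgM restK.
  by apply/funext => x; exact: restE.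
have mF : measurable_fun setT (hom_integrand E (upd B e0 w) g).
  exact: intg_measurable iF.
rewrite /hom_density (Rintegral_law (replace2_law P ab))//.
have iF2 := proj1 (integrable_law (replace2_law P ab)
  ((measurable_EFinP _ _).2 mF)) iF.
rewrite [X in `|X|](Rintegral_fubini iF2).
have mI := intg_measurable (intg_fubini iF2).
apply: (Rintegral_bound _ mI) => x /=.
pose rep y z := replace2 a b (x, (y, z)).
(* An arbitrary filler: the factors put in [phi] do not see the value at b, those put in [psi] do
   not see the value at a. *)
pose y0 := tnth x a.
pose phi y := \prod_(e | Q e && ~~ ((e.1 == b) || (e.2 == b)))
    B e (edge_at (rep y y0) e) * \prod_(i < v | i != b) g i (tnth (rep y y0) i).
pose psi z := \prod_(e | Q e && ((e.1 == b) || (e.2 == b)))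
    B e (edge_at (rep y0 z) e) * g b z.
have repb y z : tnth (rep y z) b = z.
  by rewrite tnth_mktuple eq_sym (negbTE ab) eqxx.
have repa y z : tnth (rep y z) a = y by rewrite tnth_mktuple eqxx.
have rep1 y z z' i : i != b -> tnth (rep y z) i = tnth (rep y z') i.
  by move=> ib; rewrite !tnth_mktuple (negbTE ib).
have rep2 y y' z i : i != a -> tnth (rep y z) i = tnth (rep y' z) i.
  by move=> ia; rewrite !tnth_mktuple (negbTE ia).
have -> : \int[prod_prob P P]_y
     hom_integrand E (upd B e0 w) g (replace2 a b (x, y)) =
   \int[(P \x P)%E]_z (w z * phi z.1 * psi z.2).
  apply: eq_Rintegral => -[y z] _; rewrite restE /= -/(rep y z).
  rewrite /edge_at -/a -/b repa repb -mulrA; congr (_ * _).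
  rewrite /rest (bigID (fun e : 'I_v * 'I_v => (e.1 == b) || (e.2 == b)))/=.
  rewrite (bigD1 b)//= repb /phi /psi.
  rewrite [in LHS](eq_bigr (fun e => B e (edge_at (rep y0 z) e))); last first.
    move=> e /andP[/andP[Ee ee0] eb]; have := E_lt Ee; rewrite /edge_at => lte.
    (* An edge through b other than [e0] avoids a: oriented from a to b it would be [e0], and the
       opposite orientation contradicts a < b. *)
    have e1 : e.1 != a.
      apply/eqP => e1a; move: eb; rewrite e1a (negbTE ab)/= => /eqP e2b.
      by move: ee0; rewrite [e]surjective_pairing [e0]surjective_pairing e1a e2b eqxx.
    have e2 : e.2 != a.
      apply/eqP => e2a; move: eb; rewrite e2a (negbTE ab) orbF => /eqP e1b.
      by move: lte; rewrite e1b e2a ltnNge (ltnW ltab).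
    by rewrite !(rep2 y y0).
  rewrite [X in _ * X * _ = _](eq_bigr (fun e => B e (edge_at (rep y y0) e))); last first.
    move=> e /andP[_]; rewrite negb_or /edge_at => /andP[e1 e2].
    by rewrite !(rep1 y z y0).
  rewrite [X in _ * (_ * X) = _](eq_bigr (fun i => g i (tnth (rep y y0) i))); last first.
    by move=> i ib; rewrite (rep1 y z y0).
  by ring.
have mrep (f : T -> T * T) : measurable_fun setT f ->
    measurable_fun setT (fun y => replace2 a b (x, f y)).
  have [mr _] := replace2_law P ab.
  move=> mf; apply: (measurableT_comp mr).
  by apply: measurable_fun_pair => //; exact: measurable_cst.
have mrep1 : measurable_fun setT (fun y => rep y y0).
  exact/mrep/measurable_fun_pair.
have mrep2 : measurable_fun setT (fun z => rep y0 z).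
  exact/mrep/measurable_fun_pair.
apply: cut_bilinear => //.
- apply: measurable_funM; first apply: measurable_bprod => e _.
    exact: (measurableT_comp (measurable_edge _ _) mrep1).
  exact: (measurableT_comp (measurable_prod_test _ ug) mrep1).
- move=> y; rewrite /phi normrM -[leRHS]mulr1 ler_pM// ?norm_prod_test//.
  exact: norm_prod_card.
- apply: measurable_funM; last by case: ug.
  apply: measurable_bprod => e _.
  exact: (measurableT_comp (measurable_edge _ _) mrep2).
- move=> z; rewrite /psi normrM -[leRHS]mulr1 ler_pM//; last by case: ug.
  exact: norm_prod_card.
Qed.

Lemma norm_lt_intg (U : T * T -> R) N : norm_lt U N -> intg (P \x P)%E U.
Proof.
move=> [N0 mU UN].
have m1U := measurable_norm_pow D mU.
have iD : intg (P \x P)%E (fun z => `|U z| ^+ D + 1).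
  apply: (@intgD _ _ _ (prod_prob P P)); last exact: (intg_cst (prod_prob P P)).
  apply/integrableP; split => //; apply: lt_trans (ltry (N ^+ D)).
  by under eq_integral do rewrite /= ger0_norm//.
apply: (@le_intg _ _ _ (prod_prob P P) _ _ mU iD) => z.
rewrite [leRHS]ger0_norm ?addr_ge0//.
have [U1|U1] := leP `|U z| 1; first by rewrite (le_trans U1)// lerDr.
apply: (@le_trans _ _ (`|U z| ^+ D)); last by rewrite lerDl.
by rewrite ler_eXnr// ltW.
Qed.

(** Change [u] into [w] one edge at a time. At each step the kernels on the other edges are clipped
    at [K], which costs [eta] by Finner's inequality; the bounded remainder then allows the cut norm
    to act on u - w. The factor 4 N bounds the norm of that difference. *)
Lemma counting_lemma (u w : T * T -> R) g (N K eta eps : R) :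
  1 <= N -> 1 <= K -> 0 <= eps ->
  norm_lt u N -> norm_lt w N ->
  norm_lt (fun z => u z - clip K (u z)) eta ->
  norm_lt (fun z => w z - clip K (w z)) eta ->
  cut_le P (fun z => u z - w z) eps -> unit_test g ->
  `|hom_density (fun=> u) g - hom_density (fun=> w) g| <=
  m%:R * (m%:R * (eta * (4 * N) ^+ m) + 4 * K ^+ m * K ^+ m * eps).
Proof.
move=> N1 K1 eps0 uN wN ueta weta cuw ug.
have eta0 : 0 < eta by case: ueta.
have N0 : 0 < N by case: uN.
have K0 : 0 <= K by exact: le_trans K1.
have N4 : N <= 4 * N by lra.
have [_ mu _] := uN; have [_ mw _] := wN.
have uwN := norm_ltB uN wN.
apply: (hybrid_le (Phi := hom_density ^~ g)) => C i.
pose H := hybrid (fun=> u) (fun=> w) C.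
have bound0 : 0 <= m%:R * (eta * (4 * N) ^+ m) + 4 * K ^+ m * K ^+ m * eps.
  by rewrite addr_ge0// !mulr_ge0// ?exprn_ge0// ?mulr_ge0// ltW.
have HN e s : norm_lt (hybrid (fun=> u) (fun=> w) s e) N.
  by rewrite /hybrid; case: ifP.
have [Ei|Ei] := boolP (E i); last first.
  rewrite (@eq_hom _ _ _ P _ E (hybrid _ _ (i :: C)) H) ?subrr ?normr0//.
  move=> e Ee; rewrite /H /hybrid inE; case: eqP => //= ei.
  by rewrite -ei Ee in Ei.
have [iC|iC] := boolP (i \in C).
  rewrite (_ : hybrid _ _ (i :: C) = H) ?subrr ?normr0//.
  by apply/funext => e; rewrite /H /hybrid inE; case: eqP => //= ->; rewrite iC.
rewrite (@hom_sub _ _ _ P _ E D D_gt0 E_lt E_deg _ _ i g (fun=> N))//; last 3 first.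
- by move=> e Ee; exact: HN.
- by move=> e Ee; exact: HN.
- by move=> e Ee /negbTE ei; rewrite /hybrid inE ei.
have -> : (fun z => hybrid (fun=> u) (fun=> w) C i z -
    hybrid (fun=> u) (fun=> w) (i :: C) i z) = (fun z => u z - w z).
  by apply/funext => z; rewrite /hybrid inE eqxx (negbTE iC).
(* Only the other edges are clipped; the difference u - w at edge [i] stays unclipped, as the cut
   norm is known for it and not for a difference of clipped kernels. *)
pose Hc e z := clip K (H e z).
have mH e : measurable_fun setT (H e) by rewrite /H /hybrid; case: ifP.
have mHc e : measurable_fun setT (Hc e).
  by apply: (measurableT_comp (measurable_clip K)); exact: mH.
rewrite -[hom_density _ _](subrK (hom_density (upd Hc i (fun z => u z - w z)) g)).
rewrite (le_trans (ler_normD _ _))// lerD//.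
  apply: hom_change => //.
  - by rewrite (le_trans N1).
  - move=> e _; rewrite /upd; case: eqP => // _.
    by apply: norm_lt_leN N4 _; exact: HN.
  - move=> e _; rewrite /upd; case: eqP => // _.
    apply: norm_lt_leN N4 _; apply: (@norm_lt_le (H e)) => //; last exact: HN.
    by move=> z; exact: clip_le.
  move=> e _; rewrite /upd; case: eqP => _.
    rewrite (_ : (fun _ => _) = fun=> 0); first exact: norm_lt0.
    by apply/funext => z; rewrite subrr.
  by rewrite /Hc /H /hybrid; case: ifP.
apply: cut_edge => //; first exact: norm_lt_intg uwN.
by move=> e z; exact: norm_clip.
Qed.

End counting_lemma.

(** * Weak limits and truncation *)

Section simple_maps.
Context d (X : measurableType d) (R : realType).

Lemma measurable_ord (L : nat) (kappa : X -> 'I_L.+1) :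
  (forall j, measurable (kappa @^-1` [set j])) -> measurable_fun setT kappa.
Proof.
move=> mk _ A _; rewrite setTI.
rewrite (_ : _ @^-1` A = \bigcup_(j in A) (kappa @^-1` [set j])).
  by apply: fin_bigcup_measurable => [|j _]; [exact: finite_finset|exact: mk].
apply/seteqP; split => x /=; first by move=> Ax; exists (kappa x).
by move=> [j Aj ->].
Qed.

Lemma measurable_fiber (L : nat) (kappa : X -> 'I_L.+1) (A : set 'I_L.+1) :
  measurable_fun setT kappa -> measurable (kappa @^-1` A).
Proof. by move=> mk; rewrite -[X in measurable X]setTI; exact: mk. Qed.

Lemma measurable_ord_fun (L : nat) (kappa : X -> 'I_L.+1) (h : 'I_L.+1 -> R) :
  measurable_fun setT kappa -> measurable_fun setT (fun x => h (kappa x)).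
Proof. by move=> mk; apply: (measurableT_comp (f := h)). Qed.

Lemma sum_fiber (L : nat) (kappa : X -> 'I_L.+1) (h : 'I_L.+1 -> R) x :
  h (kappa x) = \sum_j h j * \1_(kappa @^-1` [set j]) x.
Proof.
rewrite (bigD1 (kappa x))//= indicE mem_set// mulr1 big1 ?addr0// => j jx.
rewrite indicE memNset ?mulr0//= => /eqP.
by rewrite eq_sym (negbTE jx).
Qed.

(* Rounding f down to a multiple of 1 / k.+1. *)
Lemma quantize (f : X -> R) (M : R) (k : nat) : measurable_fun setT f ->
  (forall x, 0 <= f x <= M) ->
  exists L (kappa : X -> 'I_L.+1) (h : 'I_L.+1 -> R),
    [/\ measurable_fun setT kappa,
        forall x, 0 <= h (kappa x) <= f x &
        forall x, f x <= h (kappa x) + k.+1%:R^-1].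
Proof.
move=> mf fM; pose L := Num.truncn (k.+1%:R * M).
pose t x := Num.truncn (k.+1%:R * f x).
have tL x : (t x <= L)%N.
  by apply: le_truncn; rewrite ler_pM2l//; have /andP[] := fM x.
have kf0 x : 0 <= k.+1%:R * f x by rewrite mulr_ge0//; have /andP[] := fM x.
have tE x : (inord (t x) : 'I_L.+1) = t x :> nat by rewrite inordK// ltnS.
exists L, (fun x => inord (t x)), (fun j => (j : nat)%:R / k.+1%:R); split.
- apply: measurable_ord => j.
  rewrite (_ : _ @^-1` _ =
    (fun x => k.+1%:R * f x) @^-1` `[j%:R, j.+1%:R[%classic).
    have mkf : measurable_fun setT (fun x => k.+1%:R * f x) by exact: measurable_funM.
    by rewrite -[X in measurable X]setTI; apply: mkf.
  apply/seteqP; split => x /=.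
    by move=> jx; rewrite in_itv/= -jx tE truncn_itv.
  rewrite in_itv/= => jx; apply/val_inj; rewrite /= tE.
  exact: truncn_def.
- move=> x; rewrite tE divr_ge0//= ler_pdivrMr// mulrC.
  by have /andP[] := truncn_itv (kf0 x).
- move=> x; rewrite tE -[X in _ + X]mul1r -mulrDl natr1 ler_pdivlMr// mulrC ltW//.
  by have /andP[] := truncn_itv (kf0 x).
Qed.

End simple_maps.

Section weak_limits.
Context d (X : measurableType d) (R : realType) (Q : probability X R).
Context (I : Type) (F : set_system I) {FF : Filter F}.

Lemma cvg_sum0 (J : Type) (s : seq J) (a : J -> I -> R) :
  (forall j, a j i @[i --> F] --> (0 : R)) ->
  (\sum_(j <- s) a j i) @[i --> F] --> (0 : R).
Proof.
move=> a0; elim: s => [|j s IH].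
  rewrite (_ : (fun i => _) = fun=> 0); first exact: cvg_cst.
  by apply/funext => i; rewrite big_nil.
rewrite (_ : (fun i => _) = (fun i => a j i + \sum_(j <- s) a j i)); last first.
  by apply/funext => i; rewrite big_cons.
by have h := cvgD (a0 j) IH; rewrite addr0 in h; exact: h.
Qed.

Lemma indic_norm_le1 (A : set X) x : `|\1_A x : R| <= 1.
Proof. by rewrite indicE; case: (_ \in _); rewrite ?normr1 ?normr0. Qed.

Lemma intg_indic (f : X -> R) A : intg Q f -> measurable A ->
  intg Q (fun x => f x * \1_A x).
Proof.
move=> fi mA; apply: (@intgM _ _ _ _ _ _ 1) => //.
by move=> x; exact: indic_norm_le1.
Qed.

Lemma weak_simple (h : I -> X -> R) (L : nat) (kappa : X -> 'I_L.+1)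
    (c : 'I_L.+1 -> R) :
  (forall i, intg Q (h i)) -> measurable_fun setT kappa ->
  (forall A, measurable A -> \int[Q]_x (h i x * \1_A x) @[i --> F] --> (0 : R)) ->
  \int[Q]_x (h i x * c (kappa x)) @[i --> F] --> (0 : R).
Proof.
move=> ih mk h0.
have mA j : measurable (kappa @^-1` [set j]) by exact: measurable_fiber.
have E i : \int[Q]_x (h i x * c (kappa x)) =
    \sum_j c j * \int[Q]_x (h i x * \1_(kappa @^-1` [set j]) x).
  transitivity (\int[Q]_x \sum_j c j * (h i x * \1_(kappa @^-1` [set j]) x)).
    apply: eq_Rintegral => x _; rewrite sum_fiber mulr_sumr.
    by apply: eq_bigr => j _; rewrite mulrCA.
  rewrite Rintegral_sum; last first.
    by move=> j _; apply: intgZl; exact: intg_indic.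
  by apply: eq_bigr => j _; rewrite RintegralZl//; exact: intg_indic.
rewrite (_ : (fun i => _) = fun i =>
    \sum_j c j * \int[Q]_x (h i x * \1_(kappa @^-1` [set j]) x)); last first.
  by apply/funext => i; exact: E.
apply: cvg_sum0 => j.
by have hM := cvgM (cvg_cst (c j)) (h0 _ (mA j)); rewrite mulr0 in hM; exact: hM.
Qed.

End weak_limits.

Section weak_dynkin.
Context d (X : measurableType d) (R : realType) (Q : probability X R).

(** Dominated convergence: a point lies in at most one of the disjoint sets, hence leaves the tail
    unions eventually. *)
Lemma tail_integral_cvg0 (g : X -> R) (F : (set X)^nat) :
  intg Q g -> (forall k, measurable (F k)) -> trivIset setT F ->
  \int[Q]_x (g x * \1_(\bigcup_(k in [set k | (m <= k)%N]) F k) x) @[m --> \oo]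
    --> (0 : R).
Proof.
move=> ig mF tF.
pose B m := \bigcup_(k in [set k | (m <= k)%N]) F k.
have mB m : measurable (B m) by apply: bigcup_measurable => k _; exact: mF.
pose f_ m x := (g x * \1_(B m) x)%:E.
have mf m : measurable_fun setT (f_ m).
  apply/measurable_EFinP; apply: measurable_funM; first exact: intg_measurable ig.
  exact: measurable_indic.
have f_f x : setT x -> f_ ^~ x @ \oo --> (0 : \bar R).
  move=> _; apply: cvg_near_cst.
  have [[k0 Fk0]|nF] := pselect (exists k, F k x); last first.
    apply: nearW => m; rewrite /f_ indicE memNset ?mulr0// => -[k _ Fk].
    by apply: nF; exists k.
  near=> m; rewrite /f_ indicE memNset ?mulr0// => -[k /= mk Fk].
  have kk0 : k = k0.
    by apply: (tF k k0 I I); exists x.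
  have : (k0 < m)%N by near: m; exact: nbhs_infty_gt.
  by rewrite -kk0 ltnNge mk.
have := @dominated_cvg _ _ _ Q setT measurableT f_ (cst 0%E)
  (fun x => `|g x|%:E) mf f_f (fun _ _ => isT) (integrable_norm ig) _.
rewrite integral0 => /(_ _) h.
have : forall n x, setT x -> (`|f_ n x| <= `|g x|%:E)%E.
  move=> n x _; rewrite /f_ /= lee_fin normrM -[leRHS]mulr1 ler_wpM2l//.
  exact: indic_norm_le1.
move=> {}/h h.
have -> : (0 : R) = fine (0 : \bar R) by [].
by apply: fine_cvg.
Unshelve. all: by end_near. Qed.

(* The second hypothesis is the uniform integrability which makes the convergence
   pass to countable disjoint unions. *)
Lemma weak_dynkin (h : nat -> X -> R) (G : set (set X)) :
  (forall n, intg Q (h n)) ->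
  (forall dl, 0 < dl -> exists g, intg Q g /\ \forall n \near \oo,
     forall B, measurable B ->
     `|\int[Q]_x (h n x * \1_B x)| <= dl + \int[Q]_x (g x * \1_B x)) ->
  @measurable _ X = <<s G >> -> setI_closed G -> G setT ->
  (forall A, G A -> \int[Q]_x (h n x * \1_A x) @[n --> \oo] --> (0 : R)) ->
  forall A, measurable A ->
  \int[Q]_x (h n x * \1_A x) @[n --> \oo] --> (0 : R).
Proof.
move=> ih hui GE GI GT G0 A; rewrite GE.
have GM B : G B -> measurable B by move=> GB; rewrite GE; exact: sub_sigma_algebra.
apply: (@dynkin_induction _ X G
  (fun A => \int[Q]_x (h n x * \1_A x) @[n --> \oo] --> (0 : R))) => //.
- exact: G0.
- move=> S mS S0.
  have E n : \int[Q]_x (h n x * \1_(~` S) x) =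
      \int[Q]_x (h n x * \1_setT x) - \int[Q]_x (h n x * \1_S x).
    rewrite -RintegralB//; try exact: intg_indic.
    apply: eq_Rintegral => x _; rewrite -mulrBr; congr (_ * _).
    by rewrite !indicE in_setC in_setT; case: (_ \in _); rewrite ?subrr ?subr0.
  rewrite (_ : (fun n => _) = fun n =>
      \int[Q]_x (h n x * \1_setT x) - \int[Q]_x (h n x * \1_S x)); last first.
    by apply/funext => n; exact: E.
  by have hB := cvgB (G0 _ GT) S0; rewrite subr0 in hB; exact: hB.
move=> F mF tF F0.
pose B m := \bigcup_(k in [set k | (m <= k)%N]) F k.
have mB m : measurable (B m) by apply: bigcup_measurable => k _; exact: mF.
have E n m : \int[Q]_x (h n x * \1_(\bigcup_k F k) x) =
    \sum_(k < m) \int[Q]_x (h n x * \1_(F k) x) + \int[Q]_x (h n x * \1_(B m) x).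
  rewrite -Rintegral_sum; last by move=> k _; exact: intg_indic.
  rewrite -RintegralD//; last 2 first.
  - by apply: intg_sum => k _; exact: intg_indic.
  - exact: intg_indic.
  apply: eq_Rintegral => x _; rewrite -mulr_sumr -mulrDr; congr (_ * _).
  have uniqF k l : F k x -> F l x -> k = l.
    by move=> Fk Fl; apply: (tF k l I I); exists x.
  have [[k0 Fk0]|nF] := pselect (exists k, F k x); last first.
    rewrite !indicE memNset; last by move=> [k _ Fk]; apply: nF; exists k.
    rewrite memNset; last by move=> [k _ Fk]; apply: nF; exists k.
    rewrite big1 ?addr0// => k _; rewrite indicE memNset// => Fk.
    by apply: nF; exists k.
  rewrite indicE mem_set; last by exists k0.
  have [k0m|mk0] := ltnP k0 m.
    rewrite (bigD1 (Ordinal k0m))//= indicE mem_set// big1; last first.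
      move=> k kk0; rewrite indicE memNset// => /(uniqF _ _ Fk0) k0k.
      by move: kk0; rewrite -val_eqE /= k0k eqxx.
    rewrite addr0 indicE memNset ?addr0// => -[k /= mk /(uniqF _ _ Fk0) k0k].
    by move: k0m; rewrite k0k ltnNge mk.
  rewrite big1; last first.
    move=> k _; rewrite indicE memNset// => /(uniqF _ _ Fk0) k0k.
    by move: mk0; rewrite k0k leqNgt ltn_ord.
  by rewrite add0r indicE mem_set//; exists k0.
apply/cvgr0Pnorm_le => eps eps0.
have e3 : 0 < eps / 3 by rewrite divr_gt0.
have [g [ig hg]] := hui _ e3.
(* The cut-off [m] is chosen before [n]: the dominating function makes the tail small for all large
   n, and only a finite sum is left to converge. *)
have /cvgr0Pnorm_le/(_ _ e3)[m _ /(_ m (leqnn m)) gm] := tail_integral_cvg0 ig mF tF.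
have S0 : (\sum_(k < m) \int[Q]_x (h n x * \1_(F k) x)) @[n --> \oo] --> (0 : R).
  apply: (@cvg_sum0 R nat _ _ _ _ (fun (k : 'I_m) n => \int[Q]_x (h n x * \1_(F k) x))).
  by move=> k; exact: F0.
move/cvgr0Pnorm_le: S0 => /(_ _ e3) S0.
near=> n.
rewrite (E n m) (le_trans (ler_normD _ _))//.
have -> : eps = eps / 3 + (eps / 3 + eps / 3) by field.
apply: lerD; first by near: n.
apply: (@le_trans _ _ (eps / 3 + \int[Q]_x (g x * \1_(B m) x))).
  have : forall B, measurable B ->
     `|\int[Q]_x (h n x * \1_B x)| <= eps / 3 + \int[Q]_x (g x * \1_B x) by near: n.
  by apply; exact: mB.
by rewrite lerD2l (le_trans (ler_norm _)).
Unshelve. all: by end_near. Qed.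

End weak_dynkin.

Lemma limn_esup_le (R : realType) (u : nat -> \bar R) (c : \bar R) :
  (\forall n \near \oo, (u n <= c)%E) -> (limn_esup u <= c)%E.
Proof.
move=> [n0 _ h]; rewrite limn_esup_lim (cvg_lim _ (@cvg_esups_inf _ u))//.
apply: ge_ereal_inf; exists (esups u n0); first by exists n0.
by apply: ge_ereal_sup => _ [k /= nk <-]; exact: h.
Qed.

Lemma limn_einf_ge (R : realType) (u : nat -> \bar R) (c : \bar R) :
  (\forall n \near \oo, (c <= u n)%E) -> (c <= limn_einf u)%E.
Proof.
move=> h; rewrite /limn_einf leeNr; apply: limn_esup_le.
by apply: filterS h => n; rewrite leeN2.
Qed.

Lemma limn_esup_lt_near (R : realType) (u : nat -> \bar R) (c : \bar R) :
  (limn_esup u < c)%E -> \forall n \near \oo, (u n < c)%E.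
Proof.
rewrite limn_esup_lim (cvg_lim _ (@cvg_esups_inf _ u))//.
move=> /ereal_inf_lt[_ [n0 _ <-] h]; exists n0 => // k /= nk.
by apply: le_lt_trans h; apply: ereal_sup_ubound; exists k.
Qed.

Lemma exprn_tangent (R : realType) (D : nat) (a b : R) : 0 <= a -> 0 <= b ->
  a ^+ D.+1 + D.+1%:R * a ^+ D * (b - a) <= b ^+ D.+1.
Proof.
move=> a0 b0; elim: D => [|D IH]; first by rewrite !expr1 expr0; lra.
(* The difference of the two sides for the next exponent is exactly the sum of this term and the
   multiple of (b - a)^2 below. *)
have : 0 <= b * (b ^+ D.+1 - (a ^+ D.+1 + D.+1%:R * a ^+ D * (b - a))).
  by rewrite mulr_ge0// subr_ge0.
have : 0 <= D.+1%:R * a ^+ D * (b - a) ^+ 2.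
  by rewrite mulr_ge0 ?sqr_ge0// mulr_ge0// exprn_ge0.
rewrite [b ^+ D.+2]exprS [a ^+ D.+2]exprS [a ^+ D.+1]exprS -[D.+2%:R]natr1.
move: (a ^+ D) (b ^+ D.+1) (D.+1%:R : R) => A B c.
nra.
Qed.

Section lower_semicontinuity.
Context d (X : measurableType d) (R : realType) (Q : probability X R).
Variables (V : nat -> X -> R) (W : X -> R) (D : nat) (K C : R).
Hypothesis D_gt0 : (0 < D)%N.
Hypothesis K0 : 0 <= K.
Hypothesis iV : forall n, intg Q (V n).
Hypothesis iW : intg Q W.
Hypothesis VW : forall A, measurable A ->
  \int[Q]_x ((V n x - W x) * \1_A x) @[n --> \oo] --> (0 : R).

Let phi (x : R) := (Num.max (x - K) 0) ^+ D.
Let slope (s : R) : R := if K < s then D%:R * (s - K) ^+ D.-1 else 0.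

Hypothesis VC : \forall n \near \oo, (\int[Q]_x (phi (V n x))%:E <= C%:E)%E.

Let phi_ge0 x : 0 <= phi x.
Proof. by rewrite exprn_ge0// le_max lexx orbT. Qed.

Let phi_tangent s u : phi s + slope s * (u - s) <= phi u.
Proof.
rewrite /slope; case: ltP => [Ks|sK]; last first.
  rewrite mul0r addr0 (_ : phi s = 0)//.
  by rewrite /phi max_r ?subr_le0// expr0n gtn_eqF.
have b0 : 0 <= Num.max (u - K) 0 by rewrite le_max lexx orbT.
have bu : u - K <= Num.max (u - K) 0 by rewrite le_max lexx.
have sK0 : 0 <= s - K by rewrite subr_ge0 ltW.
rewrite /phi [Num.max (s - K) 0]max_l//.
case: D D_gt0 => //= E _; apply: le_trans (exprn_tangent E sK0 b0).
rewrite lerD2l ler_wpM2l ?mulr_ge0// ?exprn_ge0//; lra.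
Qed.

Let mphi : measurable_fun setT phi.
Proof.
apply: measurable_funX; apply: measurable_maxr => //.
exact: measurable_funB.
Qed.

(** Integrate the tangent inequality between [V n] and the simple function h. The tangent slope
    takes finitely many values, so weak convergence allows [V n] to be exchanged for [W], and h lies
    below [W] wherever the slope is nonzero. *)
Let phi_simple_le L (kappa : X -> 'I_L.+1) (h : 'I_L.+1 -> R) :
  measurable_fun setT kappa ->
  (forall x, 0 <= h (kappa x) <= Num.max (W x) 0) ->
  \int[Q]_x phi (h (kappa x)) <= C.
Proof.
move=> mk hW.
have bounded (g : 'I_L.+1 -> R) : exists M, forall x, `|g (kappa x)| <= M.
  exists (\sum_j `|g j|) => x.
  by rewrite (bigD1 (kappa x))//= lerDl sumr_ge0.
have ibnd (g : 'I_L.+1 -> R) : intg Q (fun x => g (kappa x)).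
  by have [M gM] := bounded g; apply: bounded_intg gM; exact: measurable_ord_fun.
have iM (g : 'I_L.+1 -> R) f : intg Q f -> intg Q (fun x => f x * g (kappa x)).
  by move=> fi; have [M gM] := bounded g; apply: intgM gM => //;
    exact: measurable_ord_fun.
have lim0 : \int[Q]_x ((V n x - W x) * slope (h (kappa x))) @[n --> \oo]
    --> (0 : R).
  by apply: (weak_simple (slope \o h)) => // n; exact: intgB.
apply/ler_addgt0Pr => e e0.
have /cvgr0Pnorm_le/(_ _ e0) He := lim0.
near \oo => n.
have Hn : `|\int[Q]_x ((V n x - W x) * slope (h (kappa x)))| <= e by near: n.
have HC : (\int[Q]_x (phi (V n x))%:E <= C%:E)%E by near: n.
have iphi : intg Q (fun x => phi (V n x)).
  apply/integrableP; split.
    apply/measurable_EFinP; apply: (measurableT_comp mphi).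
    exact: intg_measurable (iV n).
  apply: le_lt_trans (ltry C); apply: le_trans HC.
  rewrite (eq_integral (fun x => (phi (V n x))%:E))// => x _.
  by rewrite /= ger0_norm.
rewrite Rintegral_fin// lee_fin in HC.
rewrite -lerBlDr; apply: (le_trans _ HC).
have i1 : intg Q (fun x => phi (h (kappa x))) by exact: (ibnd (phi \o h)).
have i2 : intg Q (fun x => (V n x - W x) * slope (h (kappa x))).
  by apply: (iM (slope \o h)); exact: intgB.
apply: (@le_trans _ _ (\int[Q]_x (phi (h (kappa x)) +
    (V n x - W x) * slope (h (kappa x))))).
  by rewrite RintegralD// lerD2l; move: Hn; rewrite ler_norml => /andP[].
apply: le_Rintegral => //; first exact: intgD.
move=> x _; apply: (le_trans _ (phi_tangent (h (kappa x)) (V n x))).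
(* A nonzero slope means h > K, hence h > 0 as K is nonnegative, and then h is at most [W] itself
   and not merely at most its positive part. *)
rewrite lerD2l mulrC /slope; case: ltP => [Ks|_]; last by rewrite !mul0r.
rewrite ler_wpM2l ?mulr_ge0// ?exprn_ge0// ?subr_ge0 ?(ltW Ks)//.
rewrite lerD2l lerN2.
have /andP[h0 hWx] := hW x.
by move: hWx; rewrite le_max => /orP[//|hn];
  have := lt_le_trans Ks hn; rewrite ltNge K0.
Unshelve. all: by end_near. Qed.

(* The tangents of the convex function phi at quantized values of W have bounded
   slopes, which are legitimate test functions. *)
Lemma tail_lower_semicontinuous : (\int[Q]_x (phi (W x))%:E <= C%:E)%E.
Proof.
have mW := intg_measurable iW.
(* The excess over K ignores the negative part of [W]. Truncation at [k] makes the positive part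
   quantizable, and Fatou's lemma undoes truncation and rounding together. *)
pose f (k : nat) x := Num.min (Num.max (W x) 0) k%:R.
have mf k : measurable_fun setT (f k).
  by apply: measurable_minr => //; exact: measurable_maxr.
have f0 k x : 0 <= f k x <= k%:R.
  by rewrite /f le_min ge_min lexx orbT le_max lexx orbT/= ler0n.
pose s_ex k := quantize k (mf k) (f0 k).
have [s [ms s0 sf fs sC]] : exists s : nat -> X -> R,
   [/\ forall k, measurable_fun setT (s k), forall k x, 0 <= s k x,
       forall k x, s k x <= f k x, forall k x, f k x <= s k x + k.+1%:R^-1 &
       forall k, (\int[Q]_x (phi (s k x))%:E <= C%:E)%E].
  have /choice[s Hs] : forall k, exists s : X -> R,
     [/\ measurable_fun setT s, forall x, 0 <= s x,
       forall x, s x <= f k x, forall x, f k x <= s x + k.+1%:R^-1 &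
       (\int[Q]_x (phi (s x))%:E <= C%:E)%E].
    move=> k; have [L [kappa [h [mk hf fh]]]] := s_ex k.
    exists (fun x => h (kappa x)); split.
    - exact: measurable_ord_fun.
    - by move=> x; have /andP[] := hf x.
    - by move=> x; have /andP[] := hf x.
    - by [].
    rewrite Rintegral_fin; last first.
      have [M HM] : exists M, forall x, `|phi (h (kappa x))| <= M.
        exists (\sum_j `|phi (h j)|) => x.
        by rewrite (bigD1 (kappa x))//= lerDl sumr_ge0.
      apply: bounded_intg HM; exact: (measurable_ord_fun (phi \o h)).
    rewrite lee_fin; apply: phi_simple_le => // x.
    have /andP[-> hfx] := hf x; rewrite (le_trans hfx)//.
    by rewrite /f ge_min lexx.
  by exists s; split; move=> k; have [] := Hs k.
have cvgs x : s ^~ x @ \oo --> Num.max (W x) 0.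
  apply/cvgrPdist_le => e e0; near=> k.
  have Wk : Num.max (W x) 0 <= k%:R by near: k; exact: nbhs_infty_ger.
  have ke : k.+1%:R^-1 <= e.
    rewrite -[e]invrK lef_pV2 ?posrE ?invr_gt0//.
    apply: (@le_trans _ _ k%:R); last by rewrite ler_nat.
    by near: k; exact: nbhs_infty_ger.
  have := sf k x; have := fs k x; rewrite /f (min_l Wk) => h1 h2.
  by rewrite ger0_norm ?subr_ge0// lerBlDl (le_trans h1)// lerD2l.
have phimax (w : R) : phi (Num.max w 0) = phi w.
  rewrite /phi; congr (_ ^+ _); have [w0|w0] := leP w 0; last by [].
  by rewrite !max_r//; move: K0; lra.
have cphi : continuous phi.
  move=> y; apply: (@continuous_comp _ _ _ (fun x => Num.max (x - K) 0) (fun x => x ^+ D)).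
    apply: (@continuous_max _ _ (fun x => x - K) (fun=> 0)) => //; last exact: cvg_cst.
    by apply: cvgB; [exact: cvg_id|exact: cvg_cst].
  exact: exprn_continuous.
have mphis k : measurable_fun setT (fun x => (phi (s k x))%:E).
  by apply/measurable_EFinP; exact: (measurableT_comp mphi).
have := @fatou _ _ _ Q setT measurableT (fun k x => (phi (s k x))%:E) mphis
  (fun k x _ => phi_ge0 _ : (0 <= (phi (s k x))%:E)%E).
rewrite (eq_integral (fun x => (phi (W x))%:E)); last first.
  move=> x _; have cx : (fun k => (phi (s k x))%:E) @ \oo --> (phi (W x))%:E.
    apply: cvg_EFin; first exact: nearW.
    rewrite -phimax; apply: (cvg_comp _ _ (cvgs x)); exact: cphi.
  exact: (cvg_limn_einf_sup cx).1.
move=> /le_trans; apply; apply: (le_trans (limn_einf_sup _)).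
by apply: limn_esup_le; exact: nearW.
Unshelve. all: by end_near. Qed.

End lower_semicontinuity.

(** * Passage of the tail bounds to the limit kernel *)

Section kernel_limits.
Context d (T : measurableType d) (R : realType) (P : probability T R) (D : nat).
Hypothesis D_gt0 : (0 < D)%N.
Variables (U : nat -> T * T -> R) (W : T * T -> R).
Hypothesis iU : forall n, intg (P \x P)%E (U n).
Hypothesis iW : intg (P \x P)%E W.
Hypothesis UW : forall eps : R, 0 < eps ->
  \forall n \near \oo, cut_le P (fun z => U n z - W z) eps.
Hypothesis Utail : forall eta : R, 0 < eta -> exists2 K, 1 <= K &
  \forall n \near \oo, norm_lt P D (fun z => U n z - clip K (U n z)) eta.

Local Notation P2 := (prod_prob P P).

Let indic1 := @indic_norm_le1 _ (T * T)%type R.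

(** Pointwise |h| is at most dl + |h|^D / dl^(D-1), according to whether |h| is below or above dl;
    each summand has integral at most dl. *)
Lemma norm_lt_integral (h : T * T -> R) (dl : R) : norm_lt P D h dl ->
  \int[P2]_z `|h z| <= 2 * dl.
Proof.
move=> hdl; have [dl0 mh hD] := hdl; have ih := norm_lt_intg D_gt0 hdl.
have ihD : intg P2 (fun z => `|h z| ^+ D).
  apply/integrableP; split; first exact: measurable_norm_pow.
  apply: lt_trans (ltry (dl ^+ D)).
  by under eq_integral do rewrite /= ger0_norm//.
have iabs : intg P2 (fun z => `|h z|) by exact: integrable_norm.
have ibound : intg P2 (fun z => dl + `|h z| ^+ D / dl ^+ D.-1).
  apply: intgD; first exact: intg_cst.
  by under eq_fun do rewrite mulrC; exact: intgZl.
apply: (@le_trans _ _ (\int[P2]_z (dl + `|h z| ^+ D / dl ^+ D.-1))).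
  apply: le_Rintegral => // z _.
  have [hl|hg] := leP `|h z| dl.
    by rewrite (le_trans hl)// lerDl divr_ge0// exprn_ge0// ltW.
  rewrite (@le_trans _ _ (`|h z| ^+ D / dl ^+ D.-1))//; last by rewrite lerDr ltW.
  rewrite ler_pdivlMr ?exprn_gt0// -[in leRHS](prednK D_gt0) exprS ler_wpM2l//.
  by rewrite lerXn2r ?nnegrE// ltW.
rewrite RintegralD//; last 2 first.
- exact: intg_cst.
- by under eq_fun do rewrite mulrC; exact: intgZl.
rewrite prob_cst RintegralZr// mulrDl mul1r lerD2l.
rewrite ler_pdivrMr ?exprn_gt0// -exprS prednK//.
by rewrite -lee_fin -Rintegral_fin//; exact: ltW.
Qed.

(** The cut norm only tests rectangles, which form a generating pi-system. The difference U_n - W is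
    dominated by K + |W| up to the clipped tail of U_n, and this is the uniform integrability asked
    for by [weak_dynkin]. *)
Lemma weak_cvg A : measurable A ->
  \int[P2]_z ((U n z - W z) * \1_A z) @[n --> \oo] --> (0 : R).
Proof.
apply: (@weak_dynkin _ _ _ P2 (fun n z => U n z - W z)
  [set A `*` B | A in measurable & B in measurable]).
- by move=> n; exact: (@intgB _ _ _ P2).
(* Half of [dl], since [norm_lt_integral] doubles the bound. *)
- move=> dl dl0; have [K K1 HK] := Utail (divr_gt0 dl0 (ltr0n R 2)).
  exists (fun z => K + `|W z|); split.
    apply: (@intgD _ _ _ P2); first exact: (intg_cst P2).
    exact: integrable_norm.
  apply: filterS HK => n HK B mB.
  have K0 : 0 <= K by exact: le_trans K1.
  have i1 : intg P2 (fun z => `|U n z - clip K (U n z)|).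
    by apply: integrable_norm; exact: (norm_lt_intg D_gt0 HK).
  have i2 : intg P2 (fun z => (K + `|W z|) * \1_B z).
    apply: intg_indic => //; apply: intgD; first exact: intg_cst.
    exact: integrable_norm.
  apply: (@le_trans _ _ (\int[P2]_z (`|U n z - clip K (U n z)| +
      (K + `|W z|) * \1_B z))).
    apply: le_Rintegral_norm.
    - by apply: intg_indic => //; exact: intgB.
    - exact: intgD.
    move=> z; rewrite normrM [`|\1_B z|]ger0_norm ?indicE//.
    case: (_ \in _); rewrite ?mulr0 ?mulr1 ?addr0//.
    have := ler_normD (U n z - clip K (U n z)) (clip K (U n z) - W z).
    rewrite addrA subrK => /le_trans; apply; rewrite lerD2l.
    by rewrite (le_trans (ler_normB _ _))// lerD2r norm_clip.
  rewrite RintegralD// lerD2r (le_trans (norm_lt_integral HK))//.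
  by rewrite mulrC divfK.
- exact: measurable_prod_measurableType.
- move=> _ _ [A1 mA1 [B1 mB1 <-]] [A2 mA2 [B2 mB2 <-]].
  rewrite -setXI; exists (A1 `&` A2); first exact: measurableI.
  by exists (B1 `&` B2) => //; exact: measurableI.
- by exists setT => //; exists setT => //; rewrite setXTT.
move=> _ [A1 mA1 [B1 mB1 <-]]; apply/cvgr0Pnorm_le => e e0.
apply: filterS (UW e0) => n cutn.
by rewrite -Rintegral_setE; exact: cutn.
Qed.

(** [W] is merely integrable; its tail is controlled by lower semicontinuity along U_n. The excess
    of |W| is the sum of those of W and -W, which the sign [s] treats in turn, and 2 eta^D is
    strictly below (3 eta)^D. *)
Lemma limit_tail (K eta : R) : 0 <= K ->
  (\forall n \near \oo, norm_lt P D (fun z => U n z - clip K (U n z)) eta) ->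
  norm_lt P D (fun z => W z - clip K (W z)) (3 * eta).
Proof.
move=> K0 HK.
have eta0 : 0 < eta by near \oo => n; have [] : norm_lt P D (fun z => U n z - clip K (U n z)) eta by near: n.
have mW : measurable_fun setT W by exact: (intg_measurable (P := P2) iW).
have mclip : measurable_fun setT (fun z => W z - clip K (W z)).
  by apply: measurable_funB => //; apply: (measurableT_comp (measurable_clip K)).
pose phi (x : R) := (Num.max (x - K) 0) ^+ D.
have mphi (f : T * T -> R) : measurable_fun setT f -> measurable_fun setT (fun z => (phi (f z))%:E).
  move=> mf; apply/measurable_EFinP; apply: measurable_funX.
  by apply: measurable_maxr => //; exact: measurable_funB.
have phi0 x : 0 <= phi x by rewrite exprn_ge0// le_max lexx orbT.
have half (s : R) : `|s| = 1 ->
    (\int[P2]_z (phi (s * W z))%:E <= (eta ^+ D)%:E)%E.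
  move=> s1.
  apply: (@tail_lower_semicontinuous _ _ _ P2 (fun n z => s * U n z)
    (fun z => s * W z) D K (eta ^+ D)) => //.
  - by move=> n; apply: intgZl; exact: iU.
  - exact: intgZl.
  - move=> A mA.
    rewrite (_ : (fun n => _) = fun n => s * \int[P2]_z ((U n z - W z) * \1_A z)).
      have hM := cvgM (cvg_cst s) (weak_cvg mA); rewrite mulr0 in hM; exact: hM.
    apply/funext => n; rewrite -RintegralZl//.
      by apply: eq_Rintegral => z _; rewrite mulrA mulrBr.
    by apply: intg_indic => //; exact: (@intgB _ _ _ P2).
  apply: filterS HK => n [_ mUn /ltW]; apply: le_trans.
  have mU : measurable_fun setT (U n) by exact: (intg_measurable (P := P2) (iU n)).
  apply: ge0_le_integral => //.
  - by move=> z _; rewrite lee_fin; exact: phi0.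
  - by apply: (mphi (fun z => s * U n z)); exact: measurable_funM.
  - exact: measurable_norm_pow.
  have nn (x : R) : 0 <= Num.max x 0 by rewrite le_max lexx orbT.
  move=> z _; rewrite lee_fin sub_clipE// /phi lerXn2r ?nnegrE ?nn//.
  rewrite ge_max; apply/andP; split; last by rewrite le_max lexx orbT.
  rewrite le_max; apply/orP; left.
  by rewrite lerD2r (le_trans (ler_norm _))// normrM s1 mul1r.
split => //; first by rewrite mulr_gt0.
apply: (@le_lt_trans _ _ (\int[P2]_z ((phi (1 * W z))%:E + (phi (- 1 * W z))%:E))%E).
  apply: ge0_le_integral => //.
  - exact: measurable_norm_pow.
  - by apply: emeasurable_funD; apply: mphi; exact: measurable_funM.
  move=> z _; rewrite -EFinD lee_fin sub_clipE// mul1r mulN1r.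
  have [w0|w0] := leP 0 (W z).
    by rewrite ger0_norm// lerDl.
  by rewrite ltr0_norm// lerDr.
rewrite ge0_integralD//; last 4 first.
- by move=> z _; rewrite lee_fin.
- by apply: mphi; exact: measurable_funM.
- by move=> z _; rewrite lee_fin.
- by apply: mphi; exact: measurable_funM.
have := leeD (half 1 (normr1 _)) (half (-1) (normrN1 _)).
move=> /le_lt_trans; apply; rewrite -EFinD lte_fin exprMn.
apply: (@lt_le_trans _ _ (3 * eta ^+ D)).
  have : 0 < eta ^+ D by rewrite exprn_gt0.
  by lra.
by rewrite ler_wpM2r ?exprn_ge0 ?(ltW eta0)// ler_eXnr// ler1n.
Unshelve. all: by end_near. Qed.

End kernel_limits.

(** * Block kernels and counts *)

(** Bounds the number of non-injective maps. Passing from v to v + 1 adds at most v n^v to the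
    defect, and v^2 + v is at most (v + 1)^2. *)
Lemma leq_expn_ffact n v : (n ^ v <= n ^_ v + v ^ 2 * n ^ v.-1)%N.
Proof.
elim: v => [|v IH]; first by rewrite expn0 ffactn0.
rewrite expnS ffactnSr mulnC.
have h : (n ^_ v * n <= n ^_ v * (n - v) + v * n ^ v)%N.
  have le1 : (n ^_ v <= n ^ v)%N.
    by elim: (v) => // w IHw; rewrite ffactnSr expnSr leq_mul// leq_subr.
  move: (n ^_ v)%N (n ^ v)%N le1 => a b ab.
  have [vn|nv] := leqP v n; first by have e := subnK vn; nia.
  by rewrite (eqP (ltnW nv : (n - v)%N == 0%N)); nia.
case: v IH h => [|v] IH h.
  by rewrite !expn0 /= ffactn0 mul1n mul1n subn0 leq_addr.
apply: (@leq_trans ((n ^_ v.+1 + v.+1 ^ 2 * n ^ v) * n)).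
  by rewrite leq_mul2r IH orbT.
rewrite mulnDl -mulnA -expnSr.
apply: (@leq_trans (n ^_ v.+1 * (n - v.+1) + v.+1 * n ^ v.+1 + v.+1 ^ 2 * n ^ v.+1)).
  by rewrite leq_add2r.
rewrite -addnA leq_add2l -mulnDl leq_mul2r /= orbC; apply/orP; left.
nia.
Qed.

Section block_kernels.
Context d (T : measurableType d) (R : realType) (P : probability T R).
Variables (m : nat) (kappa : T -> 'I_m.+1).
Hypothesis mkappa : measurable_fun setT kappa.

Definition block_mass (g : T -> R) (j : 'I_m.+1) :=
  \int[P]_x (g x * \1_(kappa @^-1` [set j]) x).

Lemma measurable_block j : measurable (kappa @^-1` [set j]).
Proof. exact: measurable_fiber. Qed.

Lemma indic_block x j : \1_(kappa @^-1` [set j]) x = (kappa x == j)%:R :> R.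
Proof.
rewrite indicE; congr (_%:R); congr nat_of_bool; apply/idP/eqP.
  by rewrite inE.
by move=> <-; rewrite inE.
Qed.

Definition block_kernel (Q : 'M[R]_m.+1) (z : T * T) : R := Q (kappa z.1) (kappa z.2).

Lemma measurable_block2 (F : 'I_m.+1 -> 'I_m.+1 -> R) :
  measurable_fun setT (fun z : T * T => F (kappa z.1) (kappa z.2)).
Proof.
rewrite (_ : (fun z => _) = fun z : T * T => \sum_i \sum_j
    F i j * (\1_(kappa @^-1` [set i]) z.1 * \1_(kappa @^-1` [set j]) z.2)).
  apply: measurable_sum => i; apply: measurable_sum => j.
  apply: measurable_funM => //; apply: measurable_funM.
    have m1 : measurable_fun setT (\1_(kappa @^-1` [set i]) : T -> R).
      exact/measurable_indic/measurable_block.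
    exact: (measurableT_comp m1 measurable_fst).
  have m2 : measurable_fun setT (\1_(kappa @^-1` [set j]) : T -> R).
    exact/measurable_indic/measurable_block.
  exact: (measurableT_comp m2 measurable_snd).
apply/funext => z; rewrite (bigD1 (kappa z.1))//= (bigD1 (kappa z.2))//=.
rewrite !indic_block !eqxx !mulr1 big1 ?addr0; last first.
  by move=> j /negbTE jz; rewrite indic_block eq_sym jz !mulr0.
rewrite big1 ?addr0// => i /negbTE iz; rewrite big1// => j _.
by rewrite indic_block eq_sym iz mul0r mulr0.
Qed.

Lemma bounded_block2 (F : 'I_m.+1 -> 'I_m.+1 -> R) (z : T * T) :
  `|F (kappa z.1) (kappa z.2)| <= \sum_i \sum_j `|F i j|.
Proof.
rewrite (bigD1 (kappa z.1))//= (bigD1 (kappa z.2))//= -addrA lerDl addr_ge0//.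
  by rewrite sumr_ge0.
by rewrite sumr_ge0// => i _; rewrite sumr_ge0.
Qed.

Lemma intg_block2 (F : 'I_m.+1 -> 'I_m.+1 -> R) :
  intg (P \x P)%E (fun z : T * T => F (kappa z.1) (kappa z.2)).
Proof.
apply: (@bounded_intg _ _ _ (prod_prob P P)); first exact: measurable_block2.
exact: bounded_block2.
Qed.

Hypothesis kappaP : forall j, P (kappa @^-1` [set j]) = (m.+1%:R^-1)%:E.

(** The right-hand side does not mention [kappa]: moments of a block kernel are unaffected by a
    relabelling of the blocks. *)
Lemma Rintegral_block2 (F : 'I_m.+1 -> 'I_m.+1 -> R) :
  \int[prod_prob P P]_z F (kappa z.1) (kappa z.2) =
  m.+1%:R ^- 2 * \sum_i \sum_j F i j.
Proof.
pose B i j := kappa @^-1` [set i] `*` kappa @^-1` [set j].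
have mB i j : measurable (B i j) by apply: measurableX; exact: measurable_block.
rewrite (@eq_Rintegral _ _ _ _ _ (fun z => \sum_i \sum_j F i j * \1_(B i j) z)).
  rewrite Rintegral_sum; last first.
    move=> i _; apply: intg_sum => j _; apply: intgZl.
    exact: integrable_indic.
  rewrite mulr_sumr; apply: eq_bigr => i _.
  rewrite Rintegral_sum; last first.
    by move=> j _; apply: intgZl; exact: integrable_indic.
  rewrite mulr_sumr; apply: eq_bigr => j _.
  rewrite RintegralZl//; last exact: integrable_indic.
  rewrite mulrC Rintegral_indic//; congr (_ * _).
  rewrite (_ : prod_prob P P (B i j) =
    P (kappa @^-1` [set i]) * P (kappa @^-1` [set j]))%E; last first.
    by apply: product_measure1E; exact: measurable_block.
  by rewrite !kappaP -EFinM /= -exprVn expr2.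
move=> [y z] _; rewrite (bigD1 (kappa y))//= (bigD1 (kappa z))//=.
rewrite /B indicE mem_set// mulr1 big1 ?addr0; last first.
  move=> j jz; rewrite indicE memNset ?mulr0// => -[_ /= zj].
  by rewrite -zj eqxx in jz.
rewrite big1 ?addr0// => i iy; rewrite big1// => j _.
rewrite indicE memNset ?mulr0// => -[/= yi _].
by rewrite -yi eqxx in iy.
Qed.

Variables (v : nat) (E : pred ('I_v * 'I_v)).

(** Expand the integrand according to the blocks containing the coordinates; the product measure
    then factorizes. The density thus becomes a polynomial in finitely many block masses. *)
Lemma hom_block (Q : 'M[R]_m.+1) g : unit_test g ->
  hom_density P E (fun=> block_kernel Q) g =
  \sum_(j : {ffun 'I_v -> 'I_m.+1})
    (\prod_(e | E e) Q (j e.1) (j e.2)) * \prod_(a < v) block_mass (g a) (j a).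
Proof.
move=> [mg g1].
have mgj (j : {ffun 'I_v -> 'I_m.+1}) a :
    measurable_fun setT (fun x => g a x * \1_(kappa @^-1` [set j a]) x).
  by apply: measurable_funM => //; exact/measurable_indic/measurable_block.
have bgj (j : {ffun 'I_v -> 'I_m.+1}) a x :
    `|g a x * \1_(kappa @^-1` [set j a]) x| <= 1.
  by rewrite normrM -[leRHS]mulr1 ler_pM// indic_norm_le1.
transitivity (\int[power_prob P v]_x \sum_(j : {ffun 'I_v -> 'I_m.+1})
  (\prod_(e | E e) Q (j e.1) (j e.2)) *
  \prod_(a < v) (g a (tnth x a) * \1_(kappa @^-1` [set j a]) (tnth x a))).
  apply: eq_Rintegral => x _.
  rewrite (bigD1 [ffun a => kappa (tnth x a)])//= /hom_integrand.
  rewrite [X in _ = _ + X]big1 ?addr0.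
    congr (_ * _).
      by apply: eq_bigr => e _; rewrite !ffunE.
    by apply: eq_bigr => a _; rewrite ffunE indic_block eqxx mulr1.
  move=> j jx.
  have [a ja] : exists a, kappa (tnth x a) != j a.
    apply: contrapT => h; move/negP: jx; apply; apply/eqP/ffunP => a.
    rewrite ffunE; apply/eqP; rewrite eq_sym; apply: contraT => ja.
    by exfalso; apply: h; exists a.
  by rewrite (bigD1 a)//= indic_block (negbTE ja) mulr0 mul0r mulr0.
have iprod (j : {ffun 'I_v -> 'I_m.+1}) : intg (power_prob P v) (fun x =>
    \prod_(a < v) (g a (tnth x a) * \1_(kappa @^-1` [set j a]) (tnth x a))).
  apply: (@bounded_intg _ _ _ _ _ (1 ^+ #|'I_v|)).
    apply: measurable_bprod => a _.
    by apply: (measurable_tnth_fun a (mgj j a)).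
  by move=> x; apply: norm_prod_card => // a _; exact: bgj.
rewrite Rintegral_sum; last by move=> j _; exact: intgZl.
apply: eq_bigr => j _; rewrite RintegralZl//; congr (_ * _).
exact: (Rintegral_power_prod P (mgj j) (bgj j)).
Qed.

End block_kernels.

(** * Relative entropy *)

Section relative_entropy_bounds.
Context (R : realType) (I : finType) (p : I -> R).
Hypothesis p_gt0 : forall r, 0 < p r.
Hypothesis p_sum : \sum_r p r = 1.

Definition prob_vec (y : I -> R) := (forall r, 0 <= y r <= 1) /\ \sum_r y r = 1.

Definition kl (y : I -> R) := \sum_r y r * ln (y r / p r).

(* The log-likelihood ratio of y against p, smoothed by theta so that it is
   bounded also when y vanishes at some colour. *)
Definition llr (theta : R) (y : I -> R) r :=
  ln (((1 - theta) * y r + theta * p r) / p r).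

(** The Gibbs variational principle: linear functionals with exponential moment at most 1 lie below
    the relative entropy. It holds term by term by 1 + x <= exp x, with the convention 0 ln 0 = 0
    covering [z r] = 0. *)
Lemma gibbs (z lam : I -> R) : prob_vec z ->
  \sum_r p r * expR (lam r) <= 1 -> \sum_r z r * lam r <= kl z.
Proof.
move=> [z01 z1] hlam; rewrite -subr_ge0 /kl -sumrB.
apply: (@le_trans _ _ (\sum_r (z r - p r * expR (lam r)))).
  by rewrite sumrB z1 subr_ge0.
apply: ler_sum => r _; have /andP[z0 _] := z01 r.
move: z0; rewrite le_eqVlt => /predU1P[<-|z0].
  rewrite !mul0r subr0 sub0r oppr_le0.
  by rewrite mulr_ge0// ?ltW// expR_gt0.
have := expR_ge1Dx (lam r - ln (z r / p r)).
rewrite expRB lnK ?posrE ?divr_gt0// invf_div => h.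
have : z r * (1 + (lam r - ln (z r / p r))) <= z r * (expR (lam r) * (p r / z r)).
  by rewrite ler_wpM2l// ltW.
have -> : z r * (expR (lam r) * (p r / z r)) = p r * expR (lam r).
  by field; rewrite gt_eqF.
by lra.
Qed.

Lemma kl_ge0 z : prob_vec z -> 0 <= kl z.
Proof.
move=> hz; apply: le_trans (@gibbs z (fun=> 0) hz _).
  by rewrite big1// => r _; rewrite mulr0.
by rewrite (eq_bigr p) ?p_sum// => r _; rewrite expR0 mulr1.
Qed.

Lemma kl_le z : prob_vec z -> kl z <= \sum_r `|ln (p r)|.
Proof.
move=> [z01 _]; apply: ler_sum => r _; have /andP[z0 z1] := z01 r.
move: z0; rewrite le_eqVlt => /predU1P[<-|z0]; first by rewrite mul0r.
rewrite ln_div ?posrE// (@le_trans _ _ (z r * `|ln (p r)|))//.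
  rewrite ler_pM2l//.
  have := ln_le0 z1; have := ler_norm (- ln (p r)); rewrite normrN; lra.
by rewrite ler_piMl.
Qed.

Variable theta : R.
Hypothesis theta01 : 0 < theta < 1.

Let mix_gt0 y r : prob_vec y -> 0 < (1 - theta) * y r + theta * p r.
Proof.
move=> [y01 _]; have /andP[y0 _] := y01 r; have /andP[t0 t1] := theta01.
by rewrite ltr_wpDl ?mulr_gt0// mulr_ge0// subr_ge0 ltW.
Qed.

Lemma sum_expR_llr y : prob_vec y -> \sum_r p r * expR (llr theta y r) = 1.
Proof.
move=> hy; have [_ y1] := hy.
rewrite (eq_bigr (fun r => (1 - theta) * y r + theta * p r)); last first.
  move=> r _; rewrite /llr lnK ?posrE ?divr_gt0 ?mix_gt0//.
  by field; rewrite gt_eqF.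
by rewrite big_split /= -!mulr_sumr y1 p_sum; ring.
Qed.

(** Converse of [gibbs] up to ln (1 - theta): the smoothed vector dominates (1 - theta) y. *)
Lemma kl_le_llr y : prob_vec y ->
  kl y + ln (1 - theta) <= \sum_r y r * llr theta y r.
Proof.
move=> hy; have [y01 y1] := hy; have /andP[t0 t1] := theta01.
rewrite (_ : ln (1 - theta) = \sum_r y r * ln (1 - theta)); last first.
  by rewrite -mulr_suml y1 mul1r.
rewrite -big_split /=.
apply: ler_sum => r _; have /andP[y0 _] := y01 r.
move: (y0); rewrite le_eqVlt => /predU1P[<-|yr0]; first by rewrite !mul0r addr0.
rewrite -mulrDr ler_wpM2l// -lnM ?posrE ?divr_gt0 ?subr_gt0//.
rewrite /llr ler_ln ?posrE ?mulr_gt0 ?divr_gt0 ?subr_gt0 ?mix_gt0 ?invr_gt0//.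
rewrite mulrAC ler_pM2r ?invr_gt0// mulrC lerDl mulr_ge0// ltW//.
Qed.

(** The smoothed ratio lies between theta and 1 / p r, so the bound is uniform in [y]. *)
Lemma norm_llr_le y r : prob_vec y ->
  `|llr theta y r| <= `|ln theta| + \sum_r `|ln (p r)|.
Proof.
move=> hy; have [y01 y1] := hy; have /andP[t0 t1] := theta01.
have /andP[y0 yle1] := y01 r.
have p1 : p r <= 1.
  by rewrite -p_sum (bigD1 r)//= lerDl sumr_ge0// => s _; exact: ltW.
have mix0 := mix_gt0 r hy.
have mixt : theta * p r <= (1 - theta) * y r + theta * p r.
  by rewrite lerDr mulr_ge0// subr_ge0 ltW.
have mix1 : (1 - theta) * y r + theta * p r <= 1 by nra.
have lnp : `|ln (p r)| <= \sum_r `|ln (p r)|.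
  by rewrite [leRHS](bigD1 r)//= lerDl sumr_ge0.
rewrite ler_norml; apply/andP; split.
  apply: (@le_trans _ _ (ln theta)).
    have : 0 <= \sum_r `|ln (p r)| by rewrite sumr_ge0.
    by have := ler_norm (- ln theta); rewrite normrN; lra.
  rewrite /llr ler_ln ?posrE ?divr_gt0//.
  by rewrite ler_pdivlMr.
apply: (@le_trans _ _ (- ln (p r))); last first.
  have := ler_norm (- ln (p r)); rewrite normrN => /le_trans; apply.
  by rewrite (le_trans lnp)// lerDr.
rewrite -lnV ?posrE// /llr ler_ln ?posrE ?divr_gt0 ?invr_gt0//.
by rewrite ler_piMl// ltW// invr_gt0.
Qed.

End relative_entropy_bounds.

Section profiles.
Context d (T : measurableType d) (R : realType) (P : probability T R).
Variables (c : nat) (p : 'I_c -> R).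
Hypothesis p_gt0 : forall r, 0 < p r.
Hypothesis p_sum : \sum_r p r = 1.

(** Unlike in [colour_profile], the constraint is imposed at every point of the space;
    [extend_profile] bridges the two notions. *)
Definition profile (f : 'I_c -> T -> R) :=
  (forall r, measurable_fun setT (f r)) /\ forall x, prob_vec (f ^~ x).

Definition entropy (f : 'I_c -> T -> R) := \int[P]_u kl p (f ^~ u).

Lemma profile_bound f r x : profile f -> `|f r x| <= 1.
Proof. by move=> [_ /(_ x)[/(_ r)/andP[f0 f1] _]]; rewrite ger0_norm. Qed.

Lemma profile_test (v : nat) f r : profile f ->
  unit_test (fun _ : 'I_v => f r).
Proof. by move=> fp; split=> [a|a x]; [case: fp|exact: profile_bound]. Qed.

Lemma intg_profile f r : profile f -> intg P (f r).
Proof.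
move=> fp; apply: (@bounded_intg _ _ _ _ _ 1); first by case: fp.
by move=> x; exact: profile_bound.
Qed.

Lemma intg_kl f : profile f -> intg P (fun u => kl p (f ^~ u)).
Proof.
move=> [mf fp]; apply: (@bounded_intg _ _ _ _ _ (\sum_r `|ln (p r)|)).
  apply: measurable_sum => r; apply: measurable_funM => //.
  apply: (measurableT_comp (@measurable_ln R)).
  by apply: measurable_funM.
by move=> x; rewrite ger0_norm ?kl_ge0 ?kl_le.
Qed.

Lemma entropy_ge0 f : profile f -> 0 <= entropy f.
Proof. by move=> [_ fp]; apply: Rintegral_ge0 => x _; exact: kl_ge0. Qed.

Lemma intg_pairing f (lam : 'I_c -> T -> R) (B : R) : profile f ->
  (forall r, measurable_fun setT (lam r)) -> (forall r x, `|lam r x| <= B) ->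
  intg P (fun u => \sum_r f r u * lam r u).
Proof.
move=> fp ml lB; apply: intg_sum => r _; apply: intgM (ml r) (lB r).
exact: intg_profile.
Qed.

Lemma entropy_ge f (lam : 'I_c -> T -> R) (B : R) : profile f ->
  (forall r, measurable_fun setT (lam r)) -> (forall r x, `|lam r x| <= B) ->
  (forall x, \sum_r p r * expR (lam r x) <= 1) ->
  \int[P]_u \sum_r f r u * lam r u <= entropy f.
Proof.
move=> fp ml lB l1; apply: le_Rintegral => //.
- exact: intg_pairing ml lB.
- exact: intg_kl.
by move=> x _; apply: gibbs => //; case: fp.
Qed.

(** With [entropy_ge], this exhibits the entropy as a supremum of pairings with bounded test
    functions. *)
Lemma entropy_le_llr f (theta : R) : profile f -> 0 < theta < 1 ->
  entropy f + ln (1 - theta) <=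
  \int[P]_u \sum_r f r u * llr p theta (f ^~ u) r.
Proof.
move=> fp t01.
have [mf fpv] := fp.
rewrite -[ln _](prob_cst P) -RintegralD//; last 2 first.
- exact: intg_kl.
- exact: intg_cst.
apply: le_Rintegral => //.
- by apply: intgD; [exact: intg_kl|exact: intg_cst].
- apply: (@intg_pairing _ _ (`|ln theta| + \sum_r `|ln (p r)|)) => // [r|r x].
    apply: (measurableT_comp (@measurable_ln R)); apply: measurable_funM => //.
    apply: measurable_funD => //; exact: measurable_funM.
  exact: norm_llr_le.
by move=> x _; exact: kl_le_llr.
Qed.

End profiles.

(** * Coloured counts and densities of block kernels *)

Section block_counts.
Context d (T : measurableType d) (R : realType) (P : probability T R).
Variables (v c : nat) (H : rel 'I_v) (D : nat).
Hypothesis v_gt0 : (0 < v)%N.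
Hypothesis D_gt0 : (0 < D)%N.
Hypothesis H_deg : forall a : 'I_v,
  (#|[pred e : 'I_v * 'I_v | edge H e && ((e.1 == a) || (e.2 == a))]| <= D)%N.

Local Notation E := (edge H).
Local Notation m := #|{: 'I_v * 'I_v}|.

Lemma edge_lt e : E e -> (e.1 < e.2)%N.
Proof. by case/andP. Qed.

Definition graph_density (W : T * T -> R) (f : 'I_c -> T -> R) :=
  \sum_r hom_density P E (fun=> W) (fun=> f r).

Section one_block_kernel.
Variables (n : nat) (kappa : T -> 'I_n.+1) (Q : 'M[R]_n.+1).
Hypothesis mkappa : measurable_fun setT kappa.
Hypothesis kappaP : forall j, P (kappa @^-1` [set j]) = (n.+1%:R^-1)%:E.

Definition colouring_profile (x : 'I_n.+1 -> 'I_c) (r : 'I_c) (u : T) : R :=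
  (x (kappa u) == r)%:R.

Lemma colouring_profileP x : profile (colouring_profile x).
Proof.
split=> [r|u]; first exact: (measurable_ord_fun (fun j => (x j == r)%:R)).
split=> [r|]; first by rewrite /colouring_profile ler0n lern1 leq_b1.
rewrite (bigD1 (x (kappa u)))//= /colouring_profile eqxx big1 ?addr0// => r.
by rewrite eq_sym => /negbTE->.
Qed.

Lemma block_mass_cst (h : 'I_n.+1 -> R) j :
  block_mass P kappa (fun u => h (kappa u)) j = h j / n.+1%:R.
Proof.
rewrite /block_mass (@eq_Rintegral _ _ _ _ _
  (fun u => h j * \1_(kappa @^-1` [set j]) u)); last first.
  by move=> u _; rewrite indic_block; case: eqP => [->|]//; rewrite !mulr0.
rewrite RintegralZl//; last by apply: integrable_indic; exact: measurable_block.
by rewrite Rintegral_indic ?kappaP//; exact: measurable_block.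
Qed.

(** Only the common colour can give a nonzero product; a vertex is needed to read that colour off,
    whence [v_gt0]. *)
Lemma colour_matchE (x : 'I_n.+1 -> 'I_c) (j : {ffun 'I_v -> 'I_n.+1}) :
  \sum_r \prod_(a < v) ((x (j a) == r)%:R : R) =
  [forall a, forall b, x (j a) == x (j b)]%:R.
Proof.
pose a0 := Ordinal v_gt0.
case: (boolP [forall a, _]) => [/forallP h|].
  rewrite (bigD1 (x (j a0)))//= big1; last first.
    by move=> a _; have /forallP/(_ a0)-> := h a.
  rewrite big1 ?addr0// => r; rewrite eq_sym => /negbTE nr.
  by rewrite (bigD1 a0)//= nr mul0r.
rewrite negb_forall => /existsP[a]; rewrite negb_forall => /existsP[b xab].
rewrite big1// => r _.
have [xar|xar] := eqVneq (x (j a)) r.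
  by rewrite (bigD1 b)//= -xar eq_sym (negbTE xab) mul0r.
by rewrite (bigD1 a)//= (negbTE xar) mul0r.
Qed.

(** The same sum as in [N2], but extended over all maps instead of the injective ones. *)
Lemma graph_density_colouring (x : 'I_n.+1 -> 'I_c) :
  graph_density (block_kernel kappa Q) (colouring_profile x) =
  n.+1%:R ^- v * \sum_(j : {ffun 'I_v -> 'I_n.+1})
    [forall a, forall b, x (j a) == x (j b)]%:R *
    \prod_(e | E e) Q (j e.1) (j e.2).
Proof.
rewrite /graph_density (eq_bigr (fun r => \sum_(j : {ffun 'I_v -> 'I_n.+1})
  n.+1%:R ^- v * ((\prod_(a < v) ((x (j a) == r)%:R : R)) *
    \prod_(e | E e) Q (j e.1) (j e.2)))).
  rewrite exchange_big mulr_sumr; apply: eq_bigr => j _.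
  by rewrite -mulr_sumr -mulr_suml colour_matchE.
move=> r _; rewrite hom_block//; last exact: profile_test (colouring_profileP x).
apply: eq_bigr => j _.
rewrite [X in _ * X = _](eq_bigr (fun a => (x (j a) == r)%:R * n.+1%:R^-1)).
  rewrite big_split /= prodr_const card_ord exprVn.
  by rewrite [RHS]mulrC -mulrA [RHS]mulrCA.
move=> a _; exact: (block_mass_cst (fun i => (x i == r)%:R)).
Qed.

Lemma hom_block1 (Q' : 'M[R]_n.+1) :
  hom_density P E (fun=> block_kernel kappa Q') (fun _ _ => 1) =
  n.+1%:R ^- v * \sum_(j : {ffun 'I_v -> 'I_n.+1}) \prod_(e | E e) Q' (j e.1) (j e.2).
Proof.
rewrite hom_block//; last by split => // a x; rewrite normr1.
rewrite mulr_sumr; apply: eq_bigr => j _; rewrite mulrC; congr (_ * _).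
rewrite (eq_bigr (fun a => n.+1%:R^-1)).
  by rewrite prodr_const card_ord exprVn.
by move=> a _; rewrite (block_mass_cst (fun=> 1)) mul1r.
Qed.

Lemma card_noninjective :
  (#|[pred j : {ffun 'I_v -> 'I_n.+1} | ~~ injectiveb j]| <= v ^ 2 * n.+1 ^ v.-1)%N.
Proof.
have := cardC [pred j : {ffun 'I_v -> 'I_n.+1} | injectiveb j].
rewrite card_ffun !card_ord.
have -> : #|[pred j : {ffun 'I_v -> 'I_n.+1} | injectiveb j]| = n.+1 ^_ v.
  by have := card_inj_ffuns 'I_v 'I_n.+1; rewrite !card_ord => <-; rewrite cardsE.
have := leq_expn_ffact n.+1 v => h1 h2.
rewrite -(leq_add2l (n.+1 ^_ v)) (leq_trans _ h1)// -h2 leq_add2l.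
by apply/subset_leq_card/fintype.subsetP => j; rewrite !inE.
Qed.

(** The difference is the contribution of the non-injective maps. With the kernel clipped, each of
    at most v^2 n^(v-1) maps contributes at most K^m; what clipping removes is bounded over all maps
    by a difference of two densities, to which [hom_change] applies. *)
Lemma N2_graph_density (x : 'I_n.+1 -> 'I_c) (N K eta : R) :
  1 <= N -> 1 <= K -> norm_lt P D (block_kernel kappa Q) N ->
  norm_lt P D (fun z => block_kernel kappa Q z - clip K (block_kernel kappa Q z)) eta ->
  `|N2 H Q x - graph_density (block_kernel kappa Q) (colouring_profile x)| <=
  K ^+ m * (v ^ 2)%:R / n.+1%:R + m%:R * (eta * N ^+ m).
Proof.
move=> N1 K1 UN Ueta; have K0 : 0 <= K by exact: le_trans K1.
have eta0 : 0 < eta by case: Ueta.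
rewrite graph_density_colouring /N2 -mulrBr.
set match_ := fun j : {ffun 'I_v -> 'I_n.+1} =>
  [forall a, forall b, x (j a) == x (j b)].
rewrite [X in _ * (_ - X)](bigID (fun j : {ffun 'I_v -> 'I_n.+1} => injectiveb j))/=.
rewrite opprD addNKr normrM normrN ger0_norm ?invr_ge0 ?exprn_ge0//.
pose Qn : 'M[R]_n.+1 := \matrix_(i, j) `|Q i j|.
pose Qc : 'M[R]_n.+1 := \matrix_(i, j) `|clip K (Q i j)|.
pose S (Q' : 'M[R]_n.+1) j := \prod_(e | E e) Q' (j e.1) (j e.2).
have SnE (j : {ffun 'I_v -> 'I_n.+1}) :
    `|(match_ j)%:R * \prod_(e | E e) Q (j e.1) (j e.2)| <= S Qn j.
  rewrite normrM normr_prod /S [leRHS](eq_bigr (fun e => `|Q (j e.1) (j e.2)|)).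
    by rewrite ler_piMl ?prodr_ge0// normr_nat lern1 leq_b1.
  by move=> e _; rewrite mxE.
have Scn j : 0 <= S Qc j <= S Qn j.
  rewrite prodr_ge0/=; last by move=> e _; rewrite mxE.
  by apply: ler_prod => e _; rewrite !mxE normr_ge0 clip_le.
have ScK j : S Qc j <= K ^+ m.
  apply: prod_le_pow => // e; by rewrite mxE normr_ge0 norm_clip.
have n0 : 0 < n.+1%:R :> R by rewrite ltr0n.
apply: (@le_trans _ _ (n.+1%:R ^- v * (\sum_(j : {ffun 'I_v -> 'I_n.+1} | ~~ injectiveb j) S Qc j
   + (\sum_(j : {ffun 'I_v -> 'I_n.+1}) S Qn j - \sum_(j : {ffun 'I_v -> 'I_n.+1}) S Qc j)))).
  rewrite ler_wpM2l ?invr_ge0 ?exprn_ge0// (le_trans (ler_norm_sum _ _ _))//.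
  apply: (@le_trans _ _ (\sum_(j : {ffun 'I_v -> 'I_n.+1} | ~~ injectiveb j) S Qn j)).
    by apply: ler_sum => j _; exact: SnE.
  (* [S Qn] dominates [S Qc] termwise, so the excess may be summed over all maps, where it is a
     difference of densities. *)
  rewrite -lerBlDl -sumrB -sumrB [leRHS](bigID (fun j : {ffun 'I_v -> 'I_n.+1} => injectiveb j))/=.
  rewrite lerDr sumr_ge0// => j _.
  by have /andP[_] := Scn j; rewrite subr_ge0.
rewrite mulrDr; apply: lerD.
  apply: (@le_trans _ _ (n.+1%:R ^- v * ((v ^ 2 * n.+1 ^ v.-1)%:R * K ^+ m))).
    rewrite ler_wpM2l ?invr_ge0 ?exprn_ge0//.
    apply: (@le_trans _ _ (\sum_(j : {ffun 'I_v -> 'I_n.+1} | ~~ injectiveb j) K ^+ m)).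
      by apply: ler_sum => j _.
    rewrite [leLHS](_ : _ = K ^+ m *+
        #|[pred j : {ffun 'I_v -> 'I_n.+1} | ~~ injectiveb j]|); last first.
      by rewrite -sumr_const; apply: eq_bigl => j; rewrite inE.
    rewrite -[leLHS]mulr_natl ler_wpM2r ?exprn_ge0// ler_nat.
    exact: card_noninjective.
  have Ev : n.+1%:R ^+ v = n.+1%:R ^+ v.-1 * n.+1%:R :> R by rewrite -exprSr prednK.
  rewrite natrM Ev [(n.+1 ^ _)%:R]natrX.
  move: ((v ^ 2)%:R : R) (K ^+ m) (n.+1%:R : R) n0 => w Km n' n'0.
  rewrite le_eqVlt; apply/orP; left; apply/eqP; field.
  by rewrite expf_neq0 ?gt_eqF.
rewrite mulrBr -!hom_block1.
have blockn z : block_kernel kappa Qn z = `|block_kernel kappa Q z| by rewrite /block_kernel mxE.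
have blockc z : block_kernel kappa Qc z = `|clip K (block_kernel kappa Q z)|.
  by rewrite /block_kernel mxE.
have mb Q' : measurable_fun setT (block_kernel kappa Q') by exact: measurable_block2.
apply: (le_trans (ler_norm _)).
apply: (@hom_change _ _ _ P v E D D_gt0 edge_lt H_deg) => //.
- move=> e _; apply: norm_lt_le UN => // z; by rewrite blockn normr_id.
- by move=> e _; apply: norm_lt_le UN => // z; rewrite blockc normr_id clip_le.
- move=> e _; apply: norm_lt_le Ueta; first exact: measurable_funB.
  by move=> z; rewrite blockn blockc; exact: ler_dist_dist.
by split => // a y; rewrite normr1.
Qed.

End one_block_kernel.
End block_counts.

(** * Uniform convergence of densities *)

Section density_limits.
Context d (T : measurableType d) (R : realType) (P : probability T R).
Variables (v c : nat) (H : rel 'I_v) (D : nat).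
Hypothesis v_gt0 : (0 < v)%N.
Hypothesis D_gt0 : (0 < D)%N.
Hypothesis H_deg : forall a : 'I_v,
  (#|[pred e : 'I_v * 'I_v | edge H e && ((e.1 == a) || (e.2 == a))]| <= D)%N.
Variables (kappa : forall n, T -> 'I_n.+1) (Q : forall n, 'M[R]_n.+1).
Variable W : T * T -> R.
Hypothesis mkappa : forall n, measurable_fun setT (kappa n).
Hypothesis kappaP : forall n j, P (kappa n @^-1` [set j]) = (n.+1%:R^-1)%:E.
Hypothesis iW : intg (P \x P)%E W.

Local Notation U n := (block_kernel (kappa n) (Q n)).
Local Notation m := #|{: 'I_v * 'I_v}|.

Hypothesis UW : forall eps : R, 0 < eps ->
  \forall n \near \oo, cut_le P (fun z => U n z - W z) eps.
Hypothesis Utail : forall eta : R, 0 < eta -> exists2 K, 1 <= K &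
  \forall n \near \oo, norm_lt P D (fun z => U n z - clip K (U n z)) eta.

Lemma norm_lt_clip (u : T * T -> R) (K eta : R) : 0 <= K -> measurable_fun setT u ->
  norm_lt P D (fun z => u z - clip K (u z)) eta -> norm_lt P D u (4 * (K + 1 + eta)).
Proof.
move=> K0 mu ueta; have eta0 : 0 < eta by case: ueta.
have mclip : measurable_fun setT (fun z => - clip K (u z)).
  apply: measurableT_comp => //.
  exact: (measurableT_comp (measurable_clip K)).
(* K + 1 instead of K, because [norm_lt] is strict. *)
have h : norm_lt P D (fun z => - clip K (u z)) (K + 1).
  split => //; first by rewrite ltr_wpDl.
  apply: (@le_lt_trans _ _ (\int[(P \x P)%E]_z (K ^+ D)%:E)%E).
    apply: ge0_le_integral => //.
    - exact: measurable_norm_pow.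
    - by move=> z _; rewrite lee_fin normrN lerXn2r ?nnegrE// norm_clip.
  rewrite (Rintegral_fin (intg_cst (prod_prob P P) (K ^+ D))).
  rewrite (prob_cst (prod_prob P P)) lte_fin.
  by rewrite ltr_pXn2r// ?nnegrE ?addr_ge0// ltrDl.
have le1 : K + 1 <= K + 1 + eta by rewrite lerDl ltW.
have le2 : eta <= K + 1 + eta by rewrite lerDr addr_ge0.
have := norm_ltB D_gt0 (norm_lt_leN le2 ueta) (norm_lt_leN le1 h).
by apply: norm_lt_le => // z; rewrite opprK subrK.
Qed.

Let mU n : measurable_fun setT (U n).
Proof. exact: measurable_block2. Qed.

Let iU n : intg (P \x P)%E (U n).
Proof. exact: (intg_block2 P (@mkappa n) (Q n)). Qed.

Let mW : measurable_fun setT W.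
Proof. exact: (intg_measurable (P := prod_prob P P) iW). Qed.

Lemma kernel_norms : exists N, [/\ 1 <= N, norm_lt P D W N &
  \forall n \near \oo, norm_lt P D (U n) N].
Proof.
have [K K1 HK] := Utail ltr01; have K0 : 0 <= K by exact: le_trans K1.
have WK := limit_tail D_gt0 iU iW UW Utail K0 HK.
exists (4 * (K + 1 + 3)); split; first lra.
  by have := norm_lt_clip K0 mW WK; rewrite mulr1.
apply: filterS HK => n /(norm_lt_clip K0 (@mU n)); apply: norm_lt_leN.
by lra.
Qed.

(** The estimate of [counting_lemma] does not involve the vertex weights, hence the uniformity in
    [g]. The parameters are chosen in the order N, eta, K, eps': the cut norm has to beat a power of
    K. *)
Lemma hom_density_cvg (eps : R) : 0 < eps -> \forall n \near \oo,
  forall g, unit_test g ->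
  `|hom_density P (edge H) (fun=> U n) g - hom_density P (edge H) (fun=> W) g| <= eps.
Proof.
move=> eps0; have [N [N1 WN UN]] := kernel_norms.
have N0 : 0 <= N by exact: le_trans N1.
pose A : R := m%:R * (m%:R * (4 * N) ^+ m).
have A0 : 0 <= A by rewrite !mulr_ge0// exprn_ge0// mulr_ge0.
pose eta := eps / (2 * (A + 1)).
have eta0 : 0 < eta by rewrite divr_gt0// mulr_gt0// ltr_wpDl.
(* A third of [eta], since [limit_tail] triples the bound for [W]. *)
have [K K1 HK] := Utail (divr_gt0 eta0 (ltr0n R 3)).
have K0 : 0 <= K by exact: le_trans K1.
have WK : norm_lt P D (fun z => W z - clip K (W z)) eta.
  by have := limit_tail D_gt0 iU iW UW Utail K0 HK; rewrite mulrC divfK.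
pose B : R := m%:R * (4 * K ^+ m * K ^+ m).
have B0 : 0 <= B by rewrite !mulr_ge0// exprn_ge0.
pose eps' := eps / (2 * (B + 1)).
have eps'0 : 0 < eps' by rewrite divr_gt0// mulr_gt0// ltr_wpDl.
apply: filterS3 UN HK (UW eps'0) => n UNn HKn cutn g ug.
have HKn' : norm_lt P D (fun z => U n z - clip K (U n z)) eta.
  by apply: norm_lt_leN HKn; rewrite ler_piMr ?ltW// invf_lt1// ltr1n.
have elt e : edge H e -> (e.1 < e.2)%N by case/andP.
apply: (le_trans (counting_lemma D_gt0 elt H_deg N1 K1 (ltW eps'0) UNn WN HKn' WK cutn ug)).
rewrite mulrDr.
have -> : m%:R * (m%:R * (eta * (4 * N) ^+ m)) = A * eta by rewrite /A; ring.
have -> : m%:R * (4 * K ^+ m * K ^+ m * eps') = B * eps' by rewrite /B; ring.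
have e1 : A * eta <= eps / 2.
  rewrite /eta; have -> : A * (eps / (2 * (A + 1))) = eps / 2 * (A / (A + 1)).
    by field; rewrite gt_eqF// ltr_wpDl.
  rewrite ler_piMr// ?ler_pdivrMr ?mul1r ?lerDl// ?ltr_wpDl//.
  by rewrite divr_ge0// ltW.
have e2 : B * eps' <= eps / 2.
  rewrite /eps'; have -> : B * (eps / (2 * (B + 1))) = eps / 2 * (B / (B + 1)).
    by field; rewrite gt_eqF// ltr_wpDl.
  rewrite ler_piMr// ?ler_pdivrMr ?mul1r ?lerDl// ?ltr_wpDl//.
  by rewrite divr_ge0// ltW.
by rewrite [leRHS](splitr eps) lerD.
Qed.

Local Notation G := (graph_density P c H).

Lemma graph_density_cvg (eps : R) : 0 < eps -> \forall n \near \oo,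
  forall f : 'I_c -> T -> R, profile f ->
  `|graph_density P H (U n) f - graph_density P H W f| <= eps.
Proof.
move=> eps0; have e0 : 0 < eps / (c%:R + 1) by rewrite divr_gt0// ltr_wpDl.
apply: filterS (hom_density_cvg e0) => n hn f fp.
rewrite /graph_density -sumrB (le_trans (ler_norm_sum _ _ _))//.
apply: (@le_trans _ _ (\sum_(r < c) eps / (c%:R + 1))).
  by apply: ler_sum => r _; apply: hn; exact: profile_test.
rewrite sumr_const card_ord -[leLHS]mulr_natl mulrCA ler_piMr ?(ltW eps0)//.
by rewrite ler_pdivrMr ?mul1r ?lerDl// ltr_wpDl.
Qed.

Lemma N2_cvg (eps : R) : 0 < eps -> \forall n \near \oo, forall x : 'I_n.+1 -> 'I_c,
  `|N2 H (Q n) x - graph_density P H (U n) (colouring_profile R (kappa n) x)| <= eps.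
Proof.
move=> eps0; have [N [N1 WN UN]] := kernel_norms.
have N0 : 0 <= N by exact: le_trans N1.
pose A : R := m%:R * N ^+ m.
have A0 : 0 <= A by rewrite !mulr_ge0// exprn_ge0.
pose eta := eps / (2 * (A + 1)).
have eta0 : 0 < eta by rewrite divr_gt0// mulr_gt0// ltr_wpDl.
have [K K1 HK] := Utail eta0.
have K0 : 0 <= K by exact: le_trans K1.
have e1 : m%:R * (eta * N ^+ m) <= eps / 2.
  have -> : m%:R * (eta * N ^+ m) = A * eta by rewrite /A; ring.
  rewrite /eta; have -> : A * (eps / (2 * (A + 1))) = eps / 2 * (A / (A + 1)).
    by field; rewrite gt_eqF// ltr_wpDl.
  rewrite ler_piMr// ?ler_pdivrMr ?mul1r ?lerDl// ?ltr_wpDl//.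
  by rewrite divr_ge0// ltW.
pose C := K ^+ m * (v ^ 2)%:R.
have large : \forall n \near \oo, C / n.+1%:R <= eps / 2.
  near=> n; rewrite ler_pdivrMr// mulrC -ler_pdivrMr ?divr_gt0//.
  apply: (@le_trans _ _ n%:R); last by rewrite ler_nat.
  by near: n; exact: nbhs_infty_ger.
apply: filterS3 UN HK large => n UNn HKn Cn x.
have h := N2_graph_density v_gt0 D_gt0 H_deg (@mkappa n) (@kappaP n) x N1 K1 UNn HKn.
apply: (le_trans h).
by rewrite [leRHS](splitr eps) lerD.
Unshelve. all: by end_near. Qed.

End density_limits.

(** * Product weights *)

Section product_weights.
Context (R : realType) (n c : nat).

Definition prod_weight (q : 'I_n -> 'I_c -> R) (x : {ffun 'I_n -> 'I_c}) :=
  \prod_i q i (x i).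

Lemma sum_prod_weight (q : 'I_n -> 'I_c -> R) :
  \sum_x prod_weight q x = \prod_i \sum_r q i r.
Proof. by rewrite bigA_distr_bigA. Qed.

Lemma sum_prod_weightM (q F : 'I_n -> 'I_c -> R) :
  \sum_x prod_weight q x * \prod_i F i (x i) = \prod_i \sum_r q i r * F i r.
Proof.
rewrite bigA_distr_bigA; apply: eq_bigr => x _.
by rewrite /prod_weight -big_split.
Qed.

Lemma expR_sum_prod (J : finType) (a : J -> R) :
  expR (\sum_j a j) = \prod_j expR (a j).
Proof. exact: (big_morph expR (@expRD R) (@expR0 R)). Qed.

(** Jensen's inequality, from the tangent to the exponential at the mean. *)
Lemma expR_convex (J : finType) (w a : J -> R) : (forall j, 0 <= w j) ->
  \sum_j w j = 1 -> expR (\sum_j w j * a j) <= \sum_j w j * expR (a j).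
Proof.
move=> w0 w1; set A := \sum_j w j * a j.
apply: (@le_trans _ _ (\sum_j w j * (expR A * (1 + (a j - A))))); last first.
  apply: ler_sum => j _; rewrite ler_wpM2l//.
  have := expR_ge1Dx (a j - A); rewrite expRD expRN => h.
  rewrite -ler_pdivlMl ?expR_gt0// mulrC.
  exact: h.
rewrite (eq_bigr (fun j => expR A * (w j * (1 - A) + w j * a j))); last first.
  by move=> j _; ring.
rewrite -mulr_sumr big_split /= -mulr_suml w1 -/A mul1r.
by rewrite ler_peMr ?expR_ge0//; lra.
Qed.

Variable q : 'I_n -> 'I_c -> R.
Hypothesis q_prob : forall i, prob_vec (q i).

Lemma prod_weight_ge0 x : 0 <= prod_weight q x.
Proof.
by apply: prodr_ge0 => i _; have [/(_ (x i))/andP[]] := q_prob i.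
Qed.

Lemma sum_prod_weight1 : \sum_x prod_weight q x = 1.
Proof. by rewrite sum_prod_weight big1// => i _; have [] := q_prob i. Qed.

Lemma sum_prod_weight_marginal (phi : 'I_n -> 'I_c -> R) :
  \sum_x prod_weight q x * \sum_i phi i (x i) = \sum_i \sum_r q i r * phi i r.
Proof.
rewrite (eq_bigr (fun x => \sum_i prod_weight q x * phi i (x i))); last first.
  by move=> x _; rewrite mulr_sumr.
rewrite exchange_big; apply: eq_bigr => i _.
pose F k r := if k == i then phi i r else 1.
rewrite (eq_bigr (fun x => prod_weight q x * \prod_k F k (x k))); last first.
  move=> x _; congr (_ * _); rewrite (bigD1 i)//= /F eqxx big1 ?mulr1// => k.
  by move=> /negbTE->.
rewrite sum_prod_weightM (bigD1 i)//= [X in _ * X]big1 ?mulr1.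
  by rewrite /F eqxx.
move=> k /negbTE ki; rewrite /F ki.
by under eq_bigr do rewrite mulr1; have [] := q_prob k.
Qed.

Lemma markov_weight (A : pred {ffun 'I_n -> 'I_c}) (h : {ffun 'I_n -> 'I_c} -> R)
    (s C : R) : (forall x, A x -> s <= h x) ->
  \sum_x prod_weight q x * expR (h x) <= C ->
  \sum_(x | A x) prod_weight q x <= C * expR (- s).
Proof.
move=> hs hC; rewrite expRN ler_pdivlMr ?expR_gt0// (le_trans _ hC)//.
rewrite mulr_suml [leRHS](bigID A)/=.
apply: (@le_trans _ _ (\sum_(x | A x) prod_weight q x * expR (h x))).
  apply: ler_sum => x Ax; rewrite ler_wpM2l ?prod_weight_ge0//.
  by rewrite ler_expR hs.
rewrite lerDl sumr_ge0// => x _.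
by rewrite mulr_ge0 ?prod_weight_ge0// expR_ge0.
Qed.

(** exp y is at most 1 / (1 - y), and the quadratic times 1 - y equals 1 + y^2 (1 - 2 y), which is
    at least 1 here. *)
Lemma expR_le_quad (y : R) : `|y| <= 2^-1 -> expR y <= 1 + y + 2 * y ^+ 2.
Proof.
move=> y2; have := expR_ge1Dx (- y); rewrite expRN => h.
have y1 : 0 < 1 - y by have := ler_norm y; lra.
have : expR y <= (1 - y)^-1.
  by rewrite -[expR y]invrK lef_pV2 ?posrE ?invr_gt0 ?expR_gt0.
move=> /le_trans; apply; rewrite -[leLHS]mul1r ler_pdivrMr//.
have := ler_norm y; have y0 : 0 <= y ^+ 2 by rewrite sqr_ge0.
have -> : (1 + y + 2 * y ^+ 2) * (1 - y) = 1 + y ^+ 2 * (1 - 2 * y) by ring.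
move=> h2; rewrite lerDl mulr_ge0//; lra.
Qed.

Section weighted_frequencies.
Variables (m : nat) (w : 'I_n -> 'I_m -> R).
Hypothesis w_ge0 : forall i j, 0 <= w i j.
Hypothesis w_sum : forall i, \sum_j w i j = 1.

(** The weights [w i] spread index i over several blocks. Convexity of the exponential moves this
    average outside, so it is enough to control the exponential moment of each [lam j]. *)
Lemma chernoff (lam : 'I_m -> 'I_c -> R) :
  (forall i j, \sum_r q i r * expR (lam j r) <= 1) ->
  \sum_x prod_weight q x * expR (\sum_i \sum_j w i j * lam j (x i)) <= 1.
Proof.
move=> hlam.
rewrite (eq_bigr (fun x => prod_weight q x *
  \prod_i expR (\sum_j w i j * lam j (x i)))); last first.
  by move=> x _; rewrite expR_sum_prod.
rewrite (sum_prod_weightM q (fun i r => expR (\sum_j w i j * lam j r))).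
rewrite -[leRHS](@big1_eq R 1 *%R 'I_n (index_enum 'I_n) predT).
apply: ler_prod => i _; have [q01 _] := q_prob i.
rewrite sumr_ge0/=; last first.
  by move=> r _; have /andP[q0 _] := q01 r; rewrite mulr_ge0// expR_ge0.
apply: (@le_trans _ _ (\sum_r q i r * \sum_j w i j * expR (lam j r))).
  apply: ler_sum => r _; have /andP[q0 _] := q01 r.
  by rewrite ler_wpM2l// expR_convex.
rewrite (eq_bigr (fun r => \sum_j w i j * (q i r * expR (lam j r)))); last first.
  by move=> r _; rewrite mulr_sumr; apply: eq_bigr => j _; rewrite mulrCA.
rewrite exchange_big -(w_sum i); apply: ler_sum => j _.
by rewrite -mulr_sumr ler_piMr.
Qed.

Definition frequency (x : {ffun 'I_n -> 'I_c}) j r := \sum_i w i j * (x i == r)%:R.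
Definition mean_frequency j r := \sum_i w i j * q i r.

Let w_le1 i j : w i j <= 1.
Proof. by rewrite -(w_sum i) (bigD1 j)//= lerDl sumr_ge0. Qed.

Lemma frequency_deviation j r (s dl : R) : `|s| = 1 -> 0 < dl <= 1 ->
  \sum_(x | n%:R * dl <= s * (frequency x j r - mean_frequency j r)) prod_weight q x
  <= expR (- (n%:R * (dl ^+ 2 / 8))).
Proof.
(* The increments below are centred and bounded by t, so their exponential moment is at most exp (2
   n t^2). The exponent 2 t^2 - t dl is least at t = dl / 4, where it equals -dl^2 / 8. *)
move=> s1 /andP[dl0 dl1]; pose t := dl / 4.
have t0 : 0 <= t by rewrite divr_ge0// ltW.
pose y i r' := t * s * (w i j * ((r' == r)%:R - q i r)).
have yt i r' : `|y i r'| <= t.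
  rewrite /y normrM normrM s1 mulr1 (ger0_norm t0) ler_piMr//.
  rewrite normrM -[leRHS]mulr1 ler_pM//; first by rewrite ger0_norm.
  have [/(_ r)/andP[q0 q1] _] := q_prob i.
  by rewrite ler_norml; case: (r' == r) => /=; apply/andP; split; lra.
have H : \sum_x prod_weight q x * expR (\sum_i y i (x i)) <= expR (n%:R * (2 * t ^+ 2)).
  rewrite (eq_bigr (fun x => prod_weight q x * \prod_i expR (y i (x i)))); last first.
    by move=> x _; rewrite expR_sum_prod.
  rewrite (sum_prod_weightM q (fun i r => expR (y i r))).
  rewrite mulr_natl -[n in leRHS]card_ord -sumr_const expR_sum_prod.
  apply: ler_prod => i _; have [q01 q1] := q_prob i.
  rewrite sumr_ge0/=; last first.
    by move=> r' _; have /andP[q0 _] := q01 r'; rewrite mulr_ge0// expR_ge0.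
  apply: (@le_trans _ _ (\sum_r' (q i r' * (1 + 2 * t ^+ 2) + q i r' * y i r'))).
    apply: ler_sum => r' _; have /andP[q0 _] := q01 r'.
    rewrite -mulrDr ler_wpM2l//.
    have yh : `|y i r'| <= 2^-1 by rewrite (le_trans (yt i r'))// /t; lra.
    apply: (le_trans (expR_le_quad yh)).
    have : y i r' ^+ 2 <= t ^+ 2 by rewrite -real_normK ?num_real// lerXn2r ?nnegrE.
    by lra.
  rewrite big_split /= -mulr_suml q1 mul1r [X in _ + X](_ : _ = 0).
    rewrite addr0; exact: expR_ge1Dx.
  rewrite /y (eq_bigr (fun r' => t * s * w i j *
      (q i r' * (r' == r)%:R - q i r' * q i r))); last first.
    by move=> r' _; ring.
  rewrite -mulr_sumr sumrB -mulr_suml q1 mul1r (bigD1 r)//= eqxx mulr1.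
  rewrite big1 ?addr0 ?subrr ?mulr0// => r' /negbTE->.
  by rewrite mulr0.
have := @markov_weight (fun x => n%:R * dl <= s * (frequency x j r - mean_frequency j r))
  (fun x => \sum_i y i (x i)) (t * (n%:R * dl)) _ _ H.
have -> : expR (n%:R * (2 * t ^+ 2)) * expR (- (t * (n%:R * dl))) =
    expR (- (n%:R * (dl ^+ 2 / 8))).
  by rewrite -expRD; congr expR; rewrite /t; field.
apply=> x hx; have -> : \sum_i y i (x i) = t * (s * (frequency x j r - mean_frequency j r)).
  rewrite /frequency /mean_frequency -sumrB !mulr_sumr; apply: eq_bigr => i _.
  by rewrite /y; ring.
by rewrite ler_wpM2l.
Qed.

Lemma frequency_concentration (dl : R) : 0 < dl <= 1 ->
  1 - (m * c * 2)%:R * expR (- (n%:R * (dl ^+ 2 / 8))) <=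
  \sum_(x | [forall j, forall r,
     `|frequency x j r - mean_frequency j r| <= n%:R * dl]) prod_weight q x.
Proof.
move=> dl01; rewrite lerBlDl -{1}sum_prod_weight1.
pose A x := [forall j, forall r,
  `|frequency x j r - mean_frequency j r| <= n%:R * dl].
rewrite (bigID A)/= addrC lerD2r.
(* Union bound over block, colour and the sign of the deviation, encoded by the boolean. *)
pose B (k : 'I_m * 'I_c * bool) (x : {ffun 'I_n -> 'I_c}) :=
  n%:R * dl <= (-1) ^+ k.2 * (frequency x k.1.1 k.1.2 - mean_frequency k.1.1 k.1.2).
apply: (@le_trans _ _ (\sum_k \sum_(x | B k x) prod_weight q x)); last first.
  apply: (@le_trans _ _ (\sum_(k : 'I_m * 'I_c * bool) expR (- (n%:R * (dl ^+ 2 / 8))))).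
    apply: ler_sum => k _; apply: frequency_deviation => //.
    by rewrite normrX normrN1 expr1n.
  by rewrite sumr_const -[leLHS]mulr_natl !card_prod !card_ord card_bool.
rewrite (exchange_big_dep predT)//= big_mkcond; apply: ler_sum => x _.
case: ifPn => [|_]; last by rewrite sumr_ge0// => k _; exact: prod_weight_ge0.
rewrite /A negb_forall => /existsP[j]; rewrite negb_forall => /existsP[r].
rewrite -ltNge ltr_normr => /orP[h|h].
  rewrite (bigD1 (j, r, false))/=; last by rewrite /B/= expr0 mul1r ltW.
  by rewrite lerDl sumr_ge0// => k _; exact: prod_weight_ge0.
rewrite (bigD1 (j, r, true))/=; last by rewrite /B/= expr1 mulN1r ltW.
by rewrite lerDl sumr_ge0// => k _; exact: prod_weight_ge0.
Qed.

End weighted_frequencies.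

Variable p : 'I_c -> R.
Hypothesis p_gt0 : forall r, 0 < p r.
Hypothesis p_sum : \sum_r p r = 1.

Local Notation pw := (prod_weight (fun _ : 'I_n => p)).

Lemma p_prob_vec : prob_vec p.
Proof.
split=> // r; rewrite ltW//= -p_sum (bigD1 r)//= lerDl sumr_ge0// => s _.
exact: ltW.
Qed.

Lemma pw_gt0 x : 0 < pw x.
Proof. by apply: prodr_gt0. Qed.

(* The Donsker-Varadhan inequality for the tilted weight q. *)
Lemma tilting (h : {ffun 'I_n -> 'I_c} -> R) (Z : R) : 0 < Z ->
  \sum_x pw x * expR (h x) <= Z ->
  \sum_x prod_weight q x * h x <= \sum_i kl p (q i) + ln Z.
Proof.
move=> Z0 hZ.
have <- : \sum_x prod_weight q x * \sum_i ln (q i (x i) / p (x i)) = \sum_i kl p (q i).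
  exact: (sum_prod_weight_marginal (fun i r => ln (q i r / p r))).
rewrite -[ln Z]mul1r -sum_prod_weight1 mulr_suml -big_split /= -subr_ge0 -sumrB.
apply: (@le_trans _ _ (\sum_x (prod_weight q x - pw x * expR (h x) / Z))).
  rewrite sumrB sum_prod_weight1 -mulr_suml subr_ge0 ler_pdivrMr// mul1r.
  exact: hZ.
apply: ler_sum => x _; have := prod_weight_ge0 x.
rewrite le_eqVlt => /predU1P[<-|qx0].
  rewrite !mul0r addr0 !subr0 sub0r oppr_le0 divr_ge0 ?(ltW Z0)//.
  by rewrite mulr_ge0 ?expR_ge0// ltW// pw_gt0.
have qi0 i : 0 < q i (x i).
  have [/(_ (x i))/andP[+ _] _] := q_prob i.
  rewrite le_eqVlt => /predU1P[qi|//].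
  by move: qx0; rewrite /prod_weight (bigD1 i)//= -qi mul0r ltxx.
have lnq : expR (\sum_i ln (q i (x i) / p (x i))) = prod_weight q x / pw x.
  rewrite expR_sum_prod (eq_bigr (fun i => q i (x i) / p (x i))); last first.
    by move=> i _; rewrite lnK// posrE divr_gt0.
  by rewrite big_split /= prodfV.
set S := \sum_i _ in lnq *.
have := expR_ge1Dx (h x - S - ln Z).
rewrite !expRB lnK ?posrE// lnq => hx.
have : prod_weight q x * (1 + (h x - S - ln Z)) <= pw x * expR (h x) / Z.
  have -> : pw x * expR (h x) / Z =
      prod_weight q x * (expR (h x) / (prod_weight q x / pw x) / Z).
    by field; rewrite !gt_eqF// pw_gt0.
  by rewrite ler_pM2l.
by lra.
Qed.

(** Apply [tilting] to the function equal to -ln s on [A] and to 0 elsewhere, where s is the weight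
    of [A]: its exponential moment is at most 1 from [A] plus 1 from the complement. *)
Lemma tilted_lower_bound (A : pred {ffun 'I_n -> 'I_c}) (a : R) : 0 < a ->
  a <= \sum_(x | A x) prod_weight q x ->
  expR (- ((\sum_i kl p (q i) + ln 2) / a)) <= \sum_(x | A x) pw x.
Proof.
move=> a0 qA.
set s := \sum_(x | A x) pw x.
have s0 : 0 < s.
  have [/existsP[x Ax]|/existsPn nA] := boolP [exists x, A x].
    rewrite /s (bigD1 x)//= ltr_pwDl ?pw_gt0// sumr_ge0// => y _.
    by rewrite ltW// pw_gt0.
  move: (lt_le_trans a0 qA); rewrite big_pred0 ?ltxx// => x.
  by apply/negbTE/nA.
have spw : \sum_x pw x = 1.
  by rewrite sum_prod_weight big1.
have s1 : s <= 1.
  rewrite -spw /s [leRHS](bigID A)/= lerDl sumr_ge0// => y _.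
  by rewrite ltW// pw_gt0.
have := @tilting (fun x => if A x then - ln s else 0) 2 (ltr0n _ 2) _.
have -> : \sum_x prod_weight q x * (if A x then - ln s else 0) =
    (\sum_(x | A x) prod_weight q x) * - ln s.
  rewrite (bigID A)/= [X in _ + X]big1 ?addr0; last first.
    by move=> x /negbTE->; rewrite mulr0.
  by rewrite mulr_suml; apply: eq_bigr => x ->.
have hZ : \sum_x pw x * expR (if A x then - ln s else 0) <= 2.
  rewrite (bigID A)/=.
  rewrite (eq_bigr (fun x => pw x / s)); last first.
    by move=> x ->; rewrite expRN lnK ?posrE.
  rewrite [X in _ + X](eq_bigr pw); last first.
    by move=> x /negbTE->; rewrite expR0 mulr1.
  rewrite -mulr_suml -/s divff ?gt_eqF//.
  have : \sum_(x | ~~ A x) pw x <= 1.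
    rewrite -spw [leRHS](bigID A)/= lerDr sumr_ge0// => y _.
    by rewrite ltW// pw_gt0.
  by lra.
move=> /(_ hZ) h.
have lns : 0 <= - ln s by rewrite oppr_ge0 ln_le0.
have : a * - ln s <= \sum_i kl p (q i) + ln 2.
  by rewrite (le_trans _ h)// ler_wpM2r.
by move=> h'; rewrite -[leRHS]lnK ?posrE// ler_expR lerNl ler_pdivlMr// mulrC.
Qed.

End product_weights.

(** * Block averages *)

Section block_averages.
Context d (T : measurableType d) (R : realType) (P : probability T R).
Variables (m c : nat) (kappa : T -> 'I_m.+1).
Hypothesis mkappa : measurable_fun setT kappa.
Hypothesis kappaP : forall j, P (kappa @^-1` [set j]) = (m.+1%:R^-1)%:E.
Variable p : 'I_c -> R.
Hypothesis p_gt0 : forall r, 0 < p r.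
Hypothesis p_sum : \sum_r p r = 1.

Local Notation mass := (block_mass P kappa).
Implicit Types f g : 'I_c -> T -> R.

(** Conditional averages on block j, whose measure is 1 / m.+1. *)
Definition block_vec (f : 'I_c -> T -> R) j r := m.+1%:R * mass (f r) j.

Definition block_avg f r (u : T) := block_vec f (kappa u) r.

Lemma intg_block f r j : profile f ->
  intg P (fun x => f r x * \1_(kappa @^-1` [set j]) x).
Proof.
by move=> fp; apply: intg_indic; [exact: intg_profile|exact: measurable_block].
Qed.

Lemma mass_ge0 f r j : profile f -> 0 <= mass (f r) j.
Proof.
move=> [_ fp]; apply: Rintegral_ge0 => x _.
by have [/(_ r)/andP[f0 _] _] := fp x; rewrite mulr_ge0// indicE.
Qed.

Lemma mass_sum f j : profile f -> \sum_r mass (f r) j = m.+1%:R^-1.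
Proof.
move=> fp; rewrite -Rintegral_sum; last by move=> r _; exact: intg_block.
rewrite (@eq_Rintegral _ _ _ _ _ (\1_(kappa @^-1` [set j]))).
  by rewrite Rintegral_indic ?kappaP//; exact: measurable_block.
by move=> x _; rewrite -mulr_suml; have [_ /(_ x)[_ ->]] := fp; rewrite mul1r.
Qed.

Lemma block_vec_prob f j : profile f -> prob_vec (block_vec f j).
Proof.
move=> fp; have n0 : m.+1%:R != 0 :> R by rewrite pnatr_eq0.
have s1 : \sum_r block_vec f j r = 1.
  by rewrite /block_vec -mulr_sumr mass_sum// divff.
have v0 r : 0 <= block_vec f j r by rewrite mulr_ge0// mass_ge0.
by split=> // r; rewrite v0/= -s1 (bigD1 r)//= lerDl sumr_ge0.
Qed.

Lemma mass_le1 f r j : profile f -> mass (f r) j <= 1.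
Proof.
move=> fp; apply: (le_trans (ler_norm _)).
apply: Rintegral_bound => [|x].
  apply: measurable_funM; first by case: fp.
  exact/measurable_indic/measurable_block.
by rewrite normrM -[leRHS]mulr1 ler_pM// ?profile_bound// indic_norm_le1.
Qed.

Lemma block_avgP f : profile f -> profile (block_avg f).
Proof.
move=> fp; split=> [r|x]; last exact: block_vec_prob.
exact: (measurable_ord_fun (fun j => block_vec f j r)).
Qed.

Lemma block_avg_mass f r j : mass (block_avg f r) j = mass (f r) j.
Proof.
have := @block_mass_cst _ _ _ P m kappa mkappa kappaP (fun j => block_vec f j r) j.
by rewrite /block_avg => ->; rewrite /block_vec mulrC mulKf// pnatr_eq0.
Qed.

Lemma pairing_block f (lam : 'I_m.+1 -> 'I_c -> R) : profile f ->
  \int[P]_u \sum_r f r u * lam (kappa u) r = \sum_j \sum_r lam j r * mass (f r) j.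
Proof.
move=> fp; transitivity (\int[P]_u \sum_j \sum_r
    lam j r * (f r u * \1_(kappa @^-1` [set j]) u)).
  apply: eq_Rintegral => u _; rewrite exchange_big; apply: eq_bigr => r _.
  rewrite (sum_fiber kappa (fun j => lam j r)) mulr_sumr; apply: eq_bigr => j _.
  by rewrite mulrCA.
rewrite Rintegral_sum; last first.
  by move=> j _; apply: intg_sum => r _; apply: intgZl; exact: intg_block.
apply: eq_bigr => j _; rewrite Rintegral_sum; last first.
  by move=> r _; apply: intgZl; exact: intg_block.
by apply: eq_bigr => r _; rewrite RintegralZl//; exact: intg_block.
Qed.

Lemma entropy_avg_llr f theta : profile f -> 0 < theta < 1 ->
  entropy P p (block_avg f) + ln (1 - theta) <=
  \sum_j \sum_r llr p theta (block_vec f j) r * mass (f r) j.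
Proof.
move=> fp t01.
apply: (le_trans (entropy_le_llr P p_gt0 p_sum (block_avgP fp) t01)).
have := pairing_block (fun j => llr p theta (block_vec f j)) (block_avgP fp).
rewrite /block_avg => ->.
under eq_bigr do under eq_bigr do rewrite -/(block_avg f _) block_avg_mass.
by [].
Qed.

(** The smoothed ratio of the averages is constant on blocks, so it pairs equally with [f] and with
    its average. It is also an admissible test function for the entropy of [f]; let theta tend to
    0. *)
Lemma entropy_avg_le f : profile f -> entropy P p (block_avg f) <= entropy P p f.
Proof.
move=> fp; have h theta : 0 < theta < 1 ->
    entropy P p (block_avg f) + ln (1 - theta) <= entropy P p f.
  move=> t01; apply: (le_trans (entropy_avg_llr fp t01)).
  rewrite -pairing_block//.
  apply: (entropy_ge P p_gt0 p_sum (lam := fun r u => llr p theta (block_vec f (kappa u)) r)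
    (B := `|ln theta| + \sum_r `|ln (p r)|) fp).
  - by move=> r; exact: (measurable_ord_fun (fun j => llr p theta (block_vec f j) r)).
  - by move=> r x; apply: norm_llr_le => //; exact: block_vec_prob.
  - by move=> x; rewrite sum_expR_llr//; exact: block_vec_prob.
apply/ler_addgt0Pr => e e0.
(* This theta satisfies ln (1 - theta) = -e. *)
have t01 : 0 < 1 - expR (- e) < 1.
  by rewrite subr_gt0 expR_lt1 oppr_lt0 e0/= gtrBl expR_gt0.
by have := h _ t01; rewrite subKr expRK lerBlDr.
Qed.

Lemma entropy_avgE f : profile f ->
  entropy P p (block_avg f) = m.+1%:R^-1 * \sum_j kl p (block_vec f j).
Proof.
move=> fp; rewrite /entropy.
transitivity (\int[P]_u \sum_j kl p (block_vec f j) * \1_(kappa @^-1` [set j]) u).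
  by apply: eq_Rintegral => u _; rewrite (sum_fiber kappa (fun j => kl p (block_vec f j))).
have i1 j : intg P (\1_(kappa @^-1` [set j]) : T -> R).
  by apply: integrable_indic; exact: measurable_block.
rewrite Rintegral_sum; last by move=> j _; exact: intgZl.
rewrite mulr_sumr; apply: eq_bigr => j _.
rewrite RintegralZl// Rintegral_indic; last exact: measurable_block.
by rewrite kappaP/= mulrC.
Qed.

Variables (v : nat) (H : rel 'I_v).

Lemma prod_dist_le (x y : 'I_v -> R) (dl : R) : 0 <= dl ->
  (forall a, 0 <= x a <= 1) -> (forall a, 0 <= y a <= 1) ->
  (forall a, `|x a - y a| <= dl) ->
  `|\prod_a x a - \prod_a y a| <= v%:R * dl.
Proof.
move=> dl0 x01 y01 xy; apply: (@le_trans _ _ (#|'I_v|%:R * dl)); last by rewrite card_ord.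
apply: (hybrid_le (Phi := fun F : 'I_v -> R => \prod_a F a)) => C i.
have h01 s a : 0 <= hybrid x y s a <= 1 by rewrite /hybrid; case: ifP.
rewrite (bigD1 i)//= [X in _ - X](bigD1 i)//=.
rewrite [X in _ - _ * X](eq_bigr (hybrid x y C)); last first.
  by move=> a /negbTE ai; rewrite /hybrid inE ai.
rewrite -mulrBl normrM -[leRHS]mulr1 ler_pM//.
  rewrite /hybrid inE eqxx/=; case: ifP => _; last exact: xy.
  by rewrite subrr normr0.
rewrite ger0_norm; last by apply: prodr_ge0 => a _; have /andP[] := h01 C a.
apply: (@le_trans _ _ (\prod_(a | a != i) (1 : R))); last by rewrite big1.
by apply: ler_prod => a _; exact: h01.
Qed.

(** By [hom_block] the density is a polynomial in block masses, which lie in [0,1]; the constant is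
    c times v times the sum of the absolute values of its coefficients. *)
Lemma graph_density_lipschitz (Q : 'M[R]_m.+1) : exists2 C : R, 0 <= C &
  forall f g (dl : R), profile f -> profile g -> 0 <= dl ->
    (forall j r, `|mass (f r) j - mass (g r) j| <= dl) ->
  `|graph_density P H (block_kernel kappa Q) f -
    graph_density P H (block_kernel kappa Q) g| <= C * dl.
Proof.
pose S := \sum_(j : {ffun 'I_v -> 'I_m.+1})
  `|\prod_(e | edge H e) Q (j e.1) (j e.2)|.
have S0 : 0 <= S by exact: sumr_ge0.
exists (c%:R * (S * v%:R)) => [|f g dl fp gp dl0 fg]; first by rewrite !mulr_ge0.
rewrite /graph_density -sumrB (le_trans (ler_norm_sum _ _ _))//.
apply: (@le_trans _ _ (\sum_(r < c) S * v%:R * dl)); last first.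
  by rewrite sumr_const card_ord -[leLHS]mulr_natl mulrA.
apply: ler_sum => r _.
rewrite !hom_block//; [|exact: profile_test gp|exact: profile_test fp].
rewrite -sumrB (le_trans (ler_norm_sum _ _ _))// -mulrA mulr_suml.
apply: ler_sum => j _; rewrite -mulrBr normrM ler_wpM2l//.
by apply: prod_dist_le => // a; rewrite mass_ge0// mass_le1.
Qed.

End block_averages.

Section two_partitions.
Context d (T : measurableType d) (R : realType) (P : probability T R).
Variables (n m : nat) (kn : T -> 'I_n.+1) (km : T -> 'I_m.+1).
Hypothesis mkn : measurable_fun setT kn.
Hypothesis mkm : measurable_fun setT km.
Hypothesis knP : forall i, P (kn @^-1` [set i]) = (n.+1%:R^-1)%:E.

(** The share of the fine cell i lying in the coarse block j. The two partitions may come from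
    different relabellings, so cells need not be contained in blocks. *)
Definition overlap i j := n.+1%:R * block_mass P kn (\1_(km @^-1` [set j])) i.

Let i1 i j : intg P (fun u => \1_(km @^-1` [set j]) u * \1_(kn @^-1` [set i]) u : R).
Proof.
apply: intg_indic; last exact: measurable_block.
by apply: integrable_indic; exact: measurable_block.
Qed.

Lemma overlap_ge0 i j : 0 <= overlap i j.
Proof.
rewrite mulr_ge0//; apply: Rintegral_ge0 => u _.
by rewrite mulr_ge0// indicE.
Qed.

Lemma overlap_sum i : \sum_j overlap i j = 1.
Proof.
rewrite /overlap -mulr_sumr -Rintegral_sum; last by move=> j _; exact: i1.
rewrite (@eq_Rintegral _ _ _ _ _ (\1_(kn @^-1` [set i]))).
  rewrite Rintegral_indic ?knP/= ?divff ?pnatr_eq0//; exact: measurable_block.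
move=> u _; rewrite -mulr_suml.
have := @sum_fiber _ T R _ km (fun=> 1) u.
under eq_bigr do rewrite mul1r.
by move=> <-; rewrite mul1r.
Qed.

Lemma mass_overlap (h : 'I_n.+1 -> R) j :
  block_mass P km (fun u => h (kn u)) j = n.+1%:R^-1 * \sum_i overlap i j * h i.
Proof.
rewrite /block_mass.
transitivity (\int[P]_u \sum_i h i *
    (\1_(km @^-1` [set j]) u * \1_(kn @^-1` [set i]) u)).
  apply: eq_Rintegral => u _; rewrite (sum_fiber kn h) mulr_suml.
  by apply: eq_bigr => i _; rewrite -mulrA; congr (_ * _); rewrite mulrC.
rewrite Rintegral_sum; last by move=> i _; exact: intgZl.
rewrite mulr_sumr; apply: eq_bigr => i _; rewrite RintegralZl//.
by rewrite /overlap -mulrA mulKf ?pnatr_eq0// mulrC.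
Qed.

End two_partitions.

(** * Exponential bounds *)

Section coarse_upper_bound.
Context d (T : measurableType d) (R : realType) (P : probability T R).
Variables (m c : nat) (km : T -> 'I_m.+1).
Hypothesis mkm : measurable_fun setT km.
Hypothesis kmP : forall j, P (km @^-1` [set j]) = (m.+1%:R^-1)%:E.
Variable p : 'I_c -> R.
Hypothesis p_gt0 : forall r, 0 < p r.
Hypothesis p_sum : \sum_r p r = 1.

Local Notation pw n := (prod_weight (fun _ : 'I_n => p)).

Section one_resolution.
Variables (n : nat) (kn : T -> 'I_n.+1).
Hypothesis mkn : measurable_fun setT kn.
Hypothesis knP : forall i, P (kn @^-1` [set i]) = (n.+1%:R^-1)%:E.

Local Notation cmass x j r := (block_mass P km (colouring_profile R kn x r) j).

Lemma colouring_mass (x : {ffun 'I_n.+1 -> 'I_c}) j r :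
  cmass x j r = n.+1%:R^-1 * frequency (overlap P kn km) x j r.
Proof.
exact: (mass_overlap P mkn mkm (fun i => (x i == r)%:R)).
Qed.

Lemma pairing_colouring (lam : 'I_m.+1 -> 'I_c -> R) (x : {ffun 'I_n.+1 -> 'I_c}) :
  n.+1%:R * (\sum_j \sum_r lam j r * cmass x j r) =
  \sum_i \sum_j overlap P kn km i j * lam j (x i).
Proof.
rewrite mulr_sumr exchange_big; apply: eq_bigr => j _.
transitivity (\sum_r \sum_i overlap P kn km i j * (lam j r * (x i == r)%:R)).
  rewrite mulr_sumr; apply: eq_bigr => r _.
  rewrite colouring_mass /frequency mulrCA mulVKf ?pnatr_eq0// mulr_sumr.
  by apply: eq_bigr => i _; rewrite mulrCA.
rewrite exchange_big; apply: eq_bigr => i _; rewrite -mulr_sumr; congr (_ * _).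
rewrite (bigD1 (x i))//= eqxx mulr1 big1 ?addr0// => r /negbTE.
by rewrite eq_sym => ->; rewrite mulr0.
Qed.

Definition mass_code (N : nat) (x : {ffun 'I_n.+1 -> 'I_c}) :=
  [ffun jr : 'I_m.+1 * 'I_c =>
    inord (Num.truncn (N%:R * cmass x jr.1 jr.2)) : 'I_N.+1].

Lemma mass_code_close N x y : (0 < N)%N -> mass_code N x = mass_code N y ->
  forall j r, `|cmass x j r - cmass y j r| <= N%:R^-1.
Proof.
move=> N0 xy j r; have NR : 0 < N%:R :> R by rewrite ltr0n.
have cm0 z : 0 <= cmass z j r by apply: mass_ge0 => //; exact: colouring_profileP.
have cm1 z : cmass z j r <= 1 by apply: mass_le1 => //; exact: colouring_profileP.
have tr z : (Num.truncn (N%:R * cmass z j r) < N.+1)%N.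
  have a0 : 0 <= N%:R * cmass z j r by rewrite mulr_ge0.
  have /andP[h _] := truncn_itv a0.
  by rewrite ltnS -(ler_nat R) (le_trans h)// ler_piMr.
have : Num.truncn (N%:R * cmass x j r) = Num.truncn (N%:R * cmass y j r).
  have := congr1 (fun F : {ffun _} => nat_of_ord (F (j, r))) xy.
  by rewrite !ffunE/= !inordK.
move=> e; have ax : 0 <= N%:R * cmass x j r by rewrite mulr_ge0.
have ay : 0 <= N%:R * cmass y j r by rewrite mulr_ge0.
have /andP[x1 x2] := truncn_itv ax; have /andP[y1 y2] := truncn_itv ay.
rewrite -(ler_pM2l NR) divff ?gt_eqF// -[X in X * _]ger0_norm// -normrM mulrBr.
rewrite e in x1 x2; rewrite -natr1 in x2 y2.
by rewrite ler_norml; lra.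
Qed.

(** A member x0 of the class supplies the tilt: the smoothed ratio of its block averages. Any other
    member has masses within 1 / N of those of x0, so its pairing with the tilt loses at most [dl],
    while [chernoff] bounds the exponential moment by 1. *)
Lemma code_class_bound (A : pred {ffun 'I_n.+1 -> 'I_c}) (b theta dl : R) N
    (k : {ffun 'I_m.+1 * 'I_c -> 'I_N.+1}) :
  0 < theta < 1 -> (0 < N)%N ->
  (m.+1 * c)%:R * (`|ln theta| + \sum_r `|ln (p r)|) <= dl * N%:R ->
  (forall x, A x -> b <= entropy P p (block_avg P km (colouring_profile R kn x))) ->
  \sum_(x | A x && (mass_code N x == k)) pw n.+1 x <=
  expR (- (n.+1%:R * (b + ln (1 - theta) - dl))).
Proof.
move=> t01 N0 NB Ab; set B := _ + _ in NB.
case: (pickP (fun x => A x && (mass_code N x == k))) => [x0 /andP[Ax0 /eqP cx0]|];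
  last by move=> h; rewrite big_pred0//; exact: expR_ge0.
have pr (x : {ffun 'I_n.+1 -> 'I_c}) : profile (colouring_profile R kn x) by exact: colouring_profileP.
pose lam j := llr p theta (block_vec P km (colouring_profile R kn x0) j).
have lamB j r : `|lam j r| <= B.
  by apply: norm_llr_le => //; exact: block_vec_prob.
rewrite -[leRHS]mul1r.
apply: (markov_weight (fun=> p_prob_vec p_gt0 p_sum)
  (h := fun x => \sum_i \sum_j overlap P kn km i j * lam j (x i))) => [x|]; last first.
  apply: chernoff => [|i j||i j].
  - by move=> i; exact: p_prob_vec.
  - exact: overlap_ge0.
  - by move=> i; exact: overlap_sum.
  - by rewrite /lam sum_expR_llr//; exact: block_vec_prob.
move=> /andP[Ax /eqP cx]; rewrite -pairing_colouring ler_pM2l ?ltr0n//.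
have cl := mass_code_close N0 (etrans cx (esym cx0)).
apply: (@le_trans _ _ (\sum_j \sum_r lam j r * cmass x0 j r - dl)).
  rewrite lerD2r (le_trans _ (entropy_avg_llr mkm kmP p_gt0 p_sum (pr x0) t01))//.
  by rewrite lerD2r; exact: Ab.
rewrite lerBlDl -lerBlDr -sumrB; apply: (le_trans (ler_norm _)).
apply: (le_trans (ler_norm_sum _ _ _)).
apply: (@le_trans _ _ (\sum_(j < m.+1) \sum_(r < c) B * N%:R^-1)).
  apply: ler_sum => j _; rewrite -sumrB; apply: (le_trans (ler_norm_sum _ _ _)).
  apply: ler_sum => r _; rewrite -mulrBr normrM distrC.
  by apply: ler_pM => //; exact: cl.
rewrite !sumr_const !card_ord -mulrnA -[leLHS]mulr_natl mulrA mulnC.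
by rewrite ler_pdivrMr ?ltr0n.
Qed.

End one_resolution.

(* Finitely many codes suffice, uniformly in n, to describe the colour masses of
   the blocks of km up to an error which is negligible for the entropy. *)
Lemma coarse_upper (theta dl : R) : 0 < theta < 1 -> 0 < dl -> exists2 C : R, 0 < C &
  forall n (kn : T -> 'I_n.+1), measurable_fun setT kn ->
    (forall i, P (kn @^-1` [set i]) = (n.+1%:R^-1)%:E) ->
  forall (A : pred {ffun 'I_n.+1 -> 'I_c}) b,
  (forall x, A x -> b <= entropy P p (block_avg P km (colouring_profile R kn x))) ->
  \sum_(x | A x) pw n.+1 x <= C * expR (- (n.+1%:R * (b + ln (1 - theta) - dl))).
Proof.
move=> t01 dl0; set B := `|ln theta| + \sum_r `|ln (p r)|.
have B0 : 0 <= B by rewrite addr_ge0 ?sumr_ge0.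
pose N := (Num.truncn ((m.+1 * c)%:R * B / dl)).+1.
have NB : (m.+1 * c)%:R * B <= dl * N%:R.
  have a0 : 0 <= (m.+1 * c)%:R * B / dl by rewrite divr_ge0 ?mulr_ge0// ltW.
  by have /andP[_ h] := truncn_itv a0; rewrite [leRHS]mulrC -ler_pdivrMr// ltW.
exists #|{ffun 'I_m.+1 * 'I_c -> 'I_N.+1}|%:R.
  by rewrite ltr0n; apply/card_gt0P; exists [ffun=> ord0].
move=> n kn mkn knP A b Ab.
rewrite (partition_big (mass_code kn N) predT)//=.
rewrite mulr_natl -sumr_const; apply: ler_sum => k _.
exact: code_class_bound.
Qed.

End coarse_upper_bound.

Section coarse_lower_bound.
Context d (T : measurableType d) (R : realType) (P : probability T R).
Variables (m c : nat) (km : T -> 'I_m.+1).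
Hypothesis mkm : measurable_fun setT km.
Variable p : 'I_c -> R.
Hypothesis p_gt0 : forall r, 0 < p r.
Hypothesis p_sum : \sum_r p r = 1.

Local Notation pw n := (prod_weight (fun _ : 'I_n => p)).

(** Colour cell i independently with the law given by the average of [f] there. The coarse masses
    concentrate around those of [block_avg P kn f], and the cost is n times the entropy of the
    average, at most n times that of [f]. *)
Lemma coarse_lower (f : 'I_c -> T -> R) (dl eta : R) : profile f ->
  0 < dl <= 1 -> 0 < eta -> \forall n \near \oo,
  forall kn : T -> 'I_n.+1, measurable_fun setT kn ->
    (forall i, P (kn @^-1` [set i]) = (n.+1%:R^-1)%:E) ->
  forall A : pred {ffun 'I_n.+1 -> 'I_c},
  (forall x : {ffun 'I_n.+1 -> 'I_c}, (forall j r,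
     `|block_mass P km (colouring_profile R kn x r) j -
       block_mass P km (block_avg P kn f r) j| <= dl) -> A x) ->
  expR (- (n.+1%:R * (entropy P p f + eta))) <= \sum_(x | A x) pw n.+1 x.
Proof.
move=> fp /andP[dl0 dl1] eta0; set S := entropy P p f.
have S0 : 0 <= S by apply: entropy_ge0.
(* With a = 1 - s one has (S + eta) a = S + eta / 2; the remaining eta / 2 absorbs the term ln 2 of
   [tilted_lower_bound] for large n. *)
pose s := eta / 2 / (S + eta).
have s0 : 0 < s by rewrite !divr_gt0// ltr_wpDl.
(* Beyond this threshold the union bound for the deviations is below s, by exp (- y) <= 1 / y. *)
pose K : R := (m.+1 * c * 2)%:R * 8 / (dl ^+ 2) / s.
near=> n => kn mkn knP A hA.
have nK : K <= n.+1%:R.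
  by apply: (@le_trans _ _ n%:R); [near: n; exact: nbhs_infty_ger|rewrite ler_nat].
have n2 : ln 2 / (eta / 2) <= n.+1%:R :> R.
  by apply: (@le_trans _ _ n%:R); [near: n; exact: nbhs_infty_ger|rewrite ler_nat].
rewrite ler_pdivrMr in n2; last by rewrite divr_gt0.
pose q := block_vec P kn f.
have qp i : prob_vec (q i) by exact: block_vec_prob.
have n1 : 0 < n.+1%:R :> R by rewrite ltr0n.
pose a : R := 1 - s.
have dl2 : 0 < dl ^+ 2 by rewrite exprn_gt0.
have aA : a <= \sum_(x | A x) prod_weight q x.
  have w0 := @overlap_ge0 _ T R P _ _ kn km.
  have w1 := overlap_sum mkn mkm knP.
  have := frequency_concentration qp w0 w1 (dl := dl).
  rewrite dl0 dl1 => /(_ isT) h; apply: (le_trans (le_trans _ h)).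
    rewrite lerD2l lerN2.
    have y0 : 0 < n.+1%:R * (dl ^+ 2 / 8) :> R by rewrite mulr_gt0// divr_gt0.
    apply: (@le_trans _ _ ((m.+1 * c * 2)%:R * (n.+1%:R * (dl ^+ 2 / 8))^-1)).
      rewrite ler_wpM2l// expRN lef_pV2 ?posrE ?expR_gt0//.
      by rewrite (le_trans _ (expR_ge1Dx _))// lerDr.
    rewrite ler_pdivrMr// -ler_pdivrMl//.
    have -> : n.+1%:R * (dl ^+ 2 / 8) = n.+1%:R / (8 / dl ^+ 2) :> R.
      by rewrite invf_div.
    rewrite ler_pdivlMr ?divr_gt0// (le_trans _ nK)// /K.
    by rewrite -[leLHS]mulrA [leLHS]mulrC [in leLHS]mulrA.
  rewrite [leLHS]big_mkcond [leRHS]big_mkcond/=; apply: ler_sum => x _.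
  case: ifPn => [xc|_]; last by case: ifP => // _; exact: prod_weight_ge0.
  rewrite hA// => j r.
  have -> : block_mass P km (block_avg P kn f r) j =
      n.+1%:R^-1 * mean_frequency q (overlap P kn km) j r.
    exact: (mass_overlap P mkn mkm (fun i => q i r)).
  rewrite colouring_mass// -mulrBr normrM ger0_norm ?invr_ge0//.
  by rewrite mulrC ler_pdivrMr// [leRHS]mulrC; move/forallP: xc => /(_ j)/forallP.
have SE : 0 < S + eta by rewrite ltr_wpDl.
have sE : s * (S + eta) = eta / 2 by rewrite /s divfK ?gt_eqF.
have a0 : 0 < a.
  by rewrite subr_gt0 /s ltr_pdivrMr// mul1r; lra.
apply: le_trans (tilted_lower_bound qp p_gt0 p_sum a0 aA).
rewrite ler_expR lerN2 ler_pdivrMr//.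
have kS : \sum_i kl p (q i) <= n.+1%:R * S.
  have -> : \sum_i kl p (q i) = n.+1%:R * entropy P p (block_avg P kn f).
    by rewrite entropy_avgE// mulrA divff ?gt_eqF// mul1r.
  by rewrite ler_pM2l//; exact: entropy_avg_le.
rewrite (_ : n.+1%:R * (S + eta) * a = n.+1%:R * S + n.+1%:R * (eta / 2)); last first.
  by rewrite /a -mulrA mulrBr mulr1 [_ * s]mulrC sE; field.
exact: lerD.
Unshelve. all: by end_near. Qed.

End coarse_lower_bound.

(** A block kernel sees a profile only through its block masses, which averaging preserves. *)
Lemma graph_density_block_avg d (T : measurableType d) (R : realType)
    (P : probability T R) (v c n : nat) (H : rel 'I_v) (kappa : T -> 'I_n.+1)
    (Q : 'M[R]_n.+1) (f : 'I_c -> T -> R) :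
  measurable_fun setT kappa ->
  (forall j, P (kappa @^-1` [set j]) = (n.+1%:R^-1)%:E) -> profile f ->
  graph_density P H (block_kernel kappa Q) (block_avg P kappa f) =
  graph_density P H (block_kernel kappa Q) f.
Proof.
move=> mk kP fp; apply: eq_bigr => r _.
rewrite !hom_block//; [|exact: profile_test fp|]; last first.
  exact: profile_test (block_avgP mk kP fp).
by apply: eq_bigr => j _; congr (_ * _); apply: eq_bigr => a _; exact: block_avg_mass.
Qed.

(** * Exponential estimates for the counts *)

Section count_probabilities.
Context d (T : measurableType d) (R : realType) (P : probability T R).
Variables (v c : nat) (H : rel 'I_v) (D : nat).
Hypothesis v_gt0 : (0 < v)%N.
Hypothesis D_gt0 : (0 < D)%N.
Hypothesis H_deg : forall a : 'I_v,
  (#|[pred e : 'I_v * 'I_v | edge H e && ((e.1 == a) || (e.2 == a))]| <= D)%N.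
Variables (kappa : forall n, T -> 'I_n.+1) (Q : forall n, 'M[R]_n.+1).
Variable W : T * T -> R.
Hypothesis mkappa : forall n, measurable_fun setT (kappa n).
Hypothesis kappaP : forall n j, P (kappa n @^-1` [set j]) = (n.+1%:R^-1)%:E.
Hypothesis iW : intg (P \x P)%E W.
Hypothesis UW : forall eps : R, 0 < eps ->
  \forall n \near \oo, cut_le P (fun z => block_kernel (kappa n) (Q n) z - W z) eps.
Hypothesis Utail : forall eta : R, 0 < eta -> exists2 K, 1 <= K &
  \forall n \near \oo, norm_lt P D (fun z => block_kernel (kappa n) (Q n) z -
    clip K (block_kernel (kappa n) (Q n) z)) eta.
Variable p : 'I_c -> R.
Hypothesis p_gt0 : forall r, 0 < p r.
Hypothesis p_sum : \sum_r p r = 1.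

Local Notation G := (graph_density P H).
Local Notation U n := (block_kernel (kappa n) (Q n)).
Local Notation pw n := (prod_weight (fun _ : 'I_n => p)).

Let G_cvg := graph_density_cvg c D_gt0 H_deg mkappa iW UW Utail.
Let N_cvg := N2_cvg c v_gt0 D_gt0 H_deg mkappa kappaP iW UW Utail.

Lemma count_lower (f : 'I_c -> T -> R) (F : set R) (eps eta : R) : profile f ->
  0 < eps -> (forall t, `|t - G W f| < eps -> F t) -> 0 < eta ->
  \forall n \near \oo, expR (- (n.+1%:R * (entropy P p f + eta))) <=
    \sum_(x : {ffun 'I_n.+1 -> 'I_c} | `[< F (N2 H (Q n) x) >]) pw n.+1 x.
Proof.
move=> fp eps0 fF eta0; pose e := eps / 8.
have e0 : 0 < e by rewrite divr_gt0.
have [M _ /(_ M (leqnn M)) hM] := G_cvg e0.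
have [C C0 lipC] := graph_density_lipschitz P c (@mkappa M) H (Q M).
have C1 : 0 < C + 1 by rewrite ltr_wpDl.
pose dl := Num.min 1 (e / (C + 1)).
have dl0 : 0 < dl by rewrite lt_min ltr01 divr_gt0.
have dl1 : dl <= 1 by rewrite ge_min lexx.
have Cdl : C * dl <= e.
  apply: (@le_trans _ _ ((C + 1) * dl)); first by rewrite ler_pM2r// lerDl.
  by rewrite mulrC -ler_pdivlMr// ge_min lexx orbT.
have dl01 : 0 < dl <= 1 by rewrite dl0 dl1.
have := coarse_lower P (@mkappa M) p_gt0 p_sum fp dl01 eta0.
move: (G_cvg e0) (N_cvg e0); apply: filterS3 => n hn hN low.
apply: (low _ (@mkappa n) (@kappaP n)) => x hx.
apply/asboolP; apply: fF.
have gp := colouring_profileP R (@mkappa n) x.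
have ap := block_avgP (@mkappa n) (@kappaP n) fp.
have h1 := hN x; have h2 := hn _ gp; have h3 := hM _ gp.
have h4 := lipC _ _ _ gp ap (ltW dl0) hx.
have h5 := hM _ ap; have h6 := hn _ ap; have h7 := hn _ fp.
have h8 := graph_density_block_avg H (Q n) (@mkappa n) (@kappaP n) fp.
(* The count is joined to the density of [f] by seven comparisons, each costing at most e = eps / 8:
   to U_n, W and U_M at the colouring, across to the average of [f] at U_M, then to W and U_n there,
   and back to W at [f]. *)
rewrite h8 in h6.
have eE : eps = 8 * e by rewrite /e; field.
move: h1 h2 h3 h4 h5 h6 h7; rewrite !ler_norml ltr_norml eE => *; lra.
Qed.

Lemma count_upper (F : set R) (eps b dl : R) : 0 < eps ->
  (forall f, profile f -> entropy P p f < b -> forall t, F t -> eps <= `|t - G W f|) ->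
  0 < dl ->
  \forall n \near \oo, \sum_(x : {ffun 'I_n.+1 -> 'I_c} | `[< F (N2 H (Q n) x) >]) pw n.+1 x <=
    expR (- (n.+1%:R * (b - dl))).
Proof.
move=> eps0 hF dl0; pose e := eps / 8.
have e0 : 0 < e by rewrite divr_gt0.
have [M _ /(_ M (leqnn M)) hM] := G_cvg e0.
(* The loss [dl] is split in three: smoothing by theta, rounding of the masses, and the number of
   codes, which is a constant and hence absorbed for large n. *)
pose theta := 1 - expR (- (dl / 3)).
have d3 : 0 < dl / 3 by rewrite divr_gt0.
have t01 : 0 < theta < 1.
  by rewrite subr_gt0 expR_lt1 oppr_lt0 d3/= gtrBl expR_gt0.
have lnt : ln (1 - theta) = - (dl / 3) by rewrite subKr expRK.
have [C C0 up] := coarse_upper (@mkappa M) (@kappaP M) p_gt0 p_sum t01 d3.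
near=> n.
have hn : forall g : 'I_c -> T -> R, profile g -> `|G (U n) g - G W g| <= e.
  by near: n; exact: G_cvg.
have hN : forall x : 'I_n.+1 -> 'I_c,
    `|N2 H (Q n) x - G (U n) (colouring_profile R (kappa n) x)| <= e.
  by near: n; exact: N_cvg.
have nC : C / (dl / 3) <= n.+1%:R.
  by apply: (@le_trans _ _ n%:R); [near: n; exact: nbhs_infty_ger|rewrite ler_nat].
have := up n (kappa n) (@mkappa n) (@kappaP n)
  (fun x : {ffun 'I_n.+1 -> 'I_c} => `[< F (N2 H (Q n) x) >]) b.
rewrite lnt => {}up; apply: (le_trans (up _)) => [x /asboolP Fx|].
  (* Were the entropy of the block average below b, its density would be at distance at least eps
     from F, yet four comparisons of cost eps / 8 join it to the count. *)
  rewrite leNgt; apply/negP => lt_b.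
  have gp := colouring_profileP R (@mkappa n) x.
  have ap := block_avgP (@mkappa M) (@kappaP M) gp.
  have := hF _ ap lt_b _ Fx.
  have h1 := hN x; have h2 := hn _ gp; have h3 := hM _ gp; have h5 := hM _ ap.
  have h8 := graph_density_block_avg H (Q M) (@mkappa M) (@kappaP M) gp.
  rewrite h8 in h5.
  apply/negP; rewrite -ltNge.
  have eE : eps = 8 * e by rewrite /e; field.
  move: h1 h2 h3 h5; rewrite !ler_norml ltr_norml eE => *; lra.
apply: (@le_trans _ _ (expR (n.+1%:R * (dl / 3)) *
    expR (- (n.+1%:R * (b + - (dl / 3) - dl / 3))))).
  rewrite ler_pM2r ?expR_gt0//; rewrite ler_pdivrMr// in nC.
  by rewrite (le_trans nC)// (le_trans _ (expR_ge1Dx _))// lerDr.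
rewrite -expRD ler_expR le_eqVlt; apply/orP; left; apply/eqP; field.
Unshelve. all: by end_near. Qed.

End count_probabilities.

(** * Compactness of profiles *)

Section ultrafilter_limits.
Context (R : realType) (I : Type) (F : set_system I) (FU : UltraFilter F).

Lemma ultra_bounded_cvg (a : I -> R) (M : R) : (forall i, `|a i| <= M) ->
  exists l : R, a i @[i --> F] --> l.
Proof.
move=> aM; have aU : UltraFilter (a @ F).
  split; first exact: fmap_proper_filter.
  move=> G GP aG; apply/seteqP; split => // A GA.
  have [//|h] := in_ultra_setVsetC (a @^-1` A) FU.
  have /aG GA' : (a @ F) (~` A) by [].
  by have := filter_ex (filterI GA GA') => -[x []].
have cM : compact `[- M, M]%classic by exact: segment_compact.
rewrite compact_ultra in cM.
have [|l [_ hl]] := cM _ aU; last by exists l.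
by apply: (@filterE _ F) => i /=; rewrite in_itv/= -ler_norml.
Qed.

End ultrafilter_limits.

Section dominated_set_functions.
Context d (T : measurableType d) (R : realType) (P : probability T R).
Variable nu : set T -> R.
Hypothesis nu_ge0 : forall A, 0 <= nu A.
Hypothesis nuU : forall A B, measurable A -> measurable B -> A `&` B = set0 ->
  nu (A `|` B) = nu A + nu B.
Hypothesis nu_le : forall A, measurable A -> nu A <= fine (P A).

Let nue A := (nu A)%:E.

Let nu0 : nu set0 = 0.
Proof.
by apply/eqP; rewrite eq_le nu_ge0 andbT (le_trans (nu_le _))// measure0.
Qed.

Let nue_ge0 A : (0 <= nue A)%E. Proof. by rewrite lee_fin. Qed.

Let nu_tail (F : (set T)^nat) (n : nat) : (forall k, measurable (F k)) ->
  trivIset setT F -> nu (\bigcup_k F k) =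
  \sum_(0 <= i < n) nu (F i) + nu (\bigcup_(k in [set k | (n <= k)%N]) F k).
Proof.
move=> mF tF; elim: n => [|n ->].
  rewrite big_geq// add0r; congr nu; by apply: eq_bigcupl; split=> k.
rewrite big_nat_recr//= -addrA; congr (_ + _).
rewrite -nuU => //.
- congr nu; apply/seteqP; split => [x [k /= nk Fx]|x [Fx|[k /= nk Fx]]].
  + move: nk; rewrite leq_eqVlt => /orP[/eqP nk|nk]; first by left; rewrite nk.
    by right; exists k.
  + by exists n => //=.
  + by exists k => //=; exact: ltnW.
- by apply: bigcup_measurable => k _; exact: mF.
- apply/seteqP; split => // x [Fx [k /= nk Fkx]].
  have : n = k by apply: (tF n k I I); exists x.
  by move=> e; rewrite e ltnn in nk.
Qed.

(** Domination by P upgrades finite to countable additivity: what the partial sums miss is the value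
    on a tail union, at most its P-measure, which tends to 0. *)
Let nue_sigma : semi_sigma_additive nue.
Proof.
move=> F mF tF mUF; rewrite /nue.
under eq_fun do rewrite sumEFin.
apply: cvg_EFin; first by near=> n.
have i1 : intg P (fun=> 1 : R) by exact: intg_cst.
have h := tail_integral_cvg0 i1 mF tF.
rewrite -[X in _ --> X]subr0.
rewrite (_ : _ \o _ = (fun n => nu (\bigcup_k F k) -
    nu (\bigcup_(k in [set k | (n <= k)%N]) F k))); last first.
  by apply/funext => n /=; rewrite (nu_tail n mF tF) addrK.
have mt n : measurable (\bigcup_(k in [set k | (n <= k)%N]) F k).
  by apply: bigcup_measurable => k _; exact: mF.
have t0 : (fun n => nu (\bigcup_(k in [set k | (n <= k)%N]) F k)) @ \oo --> (0 : R).
  apply: (squeeze_cvgr _ (cvg_cst _) h); apply: nearW => n.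
  rewrite nu_ge0 (le_trans (nu_le (mt n)))//.
  rewrite (@eq_Rintegral _ _ _ _ _ (\1_(\bigcup_(k in [set k | (n <= k)%N]) F k))).
    by rewrite Rintegral_indic.
  by move=> x _; rewrite mul1r.
exact: (cvgB (cvg_cst _) t0).
Unshelve. all: by end_near. Qed.

Lemma dominated_density : exists g : T -> R, [/\ forall x, 0 <= g x, intg P g &
  forall A, measurable A -> nu A = \int[P]_x (g x * \1_A x)].
Proof.
pose M1 := isMeasure.Build _ _ _ nue (congr1 EFin nu0) nue_ge0 nue_sigma.
pose m : {measure set T -> \bar R} := HB.pack_for (Measure.type T R) nue M1.
have mfin : fin_num_fun m by [].
pose M2 := isFinite.Build _ _ _ _ mfin.
have sig : sigma_finite setT m by apply: fin_num_fun_sigma_finite => //; exact: ltry.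
pose M3 := isSFinite.Build _ _ _ _ (sfinite_measure_sigma_finite sig).
pose M4 := isSigmaFinite.Build _ _ _ _ sig.
pose M := HB.pack_for (FiniteMeasure.type T R) (Measure.sort m) M2 M3 M4.
have [|g [g0 gfin ig gE]] := @radon_nikodym_sigma_finite _ _ _ P M.
  apply/null_content_dominatesP => A mA PA0; apply/eqP.
  rewrite eq_le measure_ge0 andbT /= /nue lee_fin (le_trans (nu_le mA))//.
  by rewrite PA0.
exists (fun x => fine (g x)); split.
- by move=> x; exact: fine_ge0.
- by apply: eq_integrable ig => // x _ /=; rewrite fineK.
- move=> A mA; rewrite -Rintegral_setE; apply: EFin_inj.
  have -> : (nu A)%:E = (\int[P]_(x in A) g x)%E := gE A mA.
  rewrite /Rintegral fineK.
    by apply: eq_integral => x _; rewrite fineK.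
  apply: integrable_fin_num => //.
  apply: (integrableS measurableT) => //.
  by apply: eq_integrable ig => // x _ /=; rewrite fineK.
Qed.

End dominated_set_functions.

Lemma cvg_eq_lim (R : realType) (I : Type) (F : set_system I) (FF : ProperFilter F)
    (a b : I -> R) (l l' : R) :
  a @ F --> l -> b @ F --> l' -> a =1 b -> l = l'.
Proof.
move=> al bl /funext ab; rewrite ab in al.
by rewrite -(cvg_lim (@Rhausdorff R) al) -(cvg_lim (@Rhausdorff R) bl).
Qed.

Section profile_compactness.
Context d (T : measurableType d) (R : realType) (P : probability T R).
Variable c : nat.
Context (I : Type) (F : set_system I) (FU : UltraFilter F).
Variable f : I -> 'I_c -> T -> R.
Hypothesis fP : forall i, profile (f i).

Let FF : Filter F. Proof. exact: filter_filter. Qed.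

Let mf i r : measurable_fun setT (f i r). Proof. by have [] := fP i. Qed.

Let f01 i r x : 0 <= f i r x <= 1. Proof. by have [_ /(_ x)[]] := fP i. Qed.

Let iA i r A : measurable A -> intg P (fun x => f i r x * \1_A x).
Proof. by move=> mA; apply: intg_indic => //; exact: intg_profile. Qed.

(** Along the ultrafilter the mass of every measurable set converges. The limits are additive and
    dominated by P, hence have densities, and these add up to 1 almost everywhere. *)
Lemma profile_ultralimit : exists g, profile g /\ forall r A, measurable A ->
  \int[P]_x (f i r x * \1_A x) @[i --> F] --> \int[P]_x (g r x * \1_A x).
Proof.
have /choice[nu nuP] : forall rA : 'I_c * set T, exists l : R, 0 <= l /\
    (measurable rA.2 -> \int[P]_x (f i rA.1 x * \1_(rA.2) x) @[i --> F] --> l).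
  move=> [r A]; have [mA|nA] := pselect (measurable A); last by exists 0; split.
  have [|l hl] := @ultra_bounded_cvg R I F FU
    (fun i => \int[P]_x (f i r x * \1_A x)) 1.
    move=> i; apply: Rintegral_bound => [|x].
      by apply: intg_measurable (iA i r mA).
    by rewrite normrM mulr_ile1// ?indic_norm_le1// profile_bound.
  exists l; split=> // .
  apply: (cvgr_to_ge hl); apply: nearW => i; apply: Rintegral_ge0 => x _.
  by rewrite mulr_ge0// ?indicE//; have /andP[] := f01 i r x.
have nu_cvg r A : measurable A ->
    \int[P]_x (f i r x * \1_A x) @[i --> F] --> nu (r, A).
  by have [_] := nuP (r, A).
have /choice[g0 g0P] r : exists g : T -> R, [/\ forall x, 0 <= g x, intg P g &
    forall A, measurable A -> nu (r, A) = \int[P]_x (g x * \1_A x)].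
  apply: dominated_density => [A|A B mA mB AB|A mA]; first by have [] := nuP (r, A).
    have h := @cvgD _ _ _ _ FF _ _ _ _ (nu_cvg r A mA) (nu_cvg r B mB).
    have hU := nu_cvg r _ (measurableU _ _ mA mB).
    apply: (cvg_eq_lim (b := fun i => \int[P]_x (f i r x * \1_A x) +
      \int[P]_x (f i r x * \1_B x)) _ hU h) => i /=; rewrite -RintegralD//; try exact: iA.
    apply: eq_Rintegral => x _; rewrite -mulrDr; congr (_ * _).
    rewrite !indicE in_setU; have : ~ (x \in A /\ x \in B).
      by rewrite !inE => -[xA xB]; have : (A `&` B) x by []; rewrite AB.
    by case: (x \in A); case: (x \in B) => //= h0; rewrite ?addr0 ?add0r//; case: h0.
  apply: (cvgr_to_le (nu_cvg r A mA)); apply: nearW => i.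
  rewrite -Rintegral_indic//; apply: le_Rintegral => //; first exact: iA.
    exact: integrable_indic.
  by move=> x _; rewrite ler_piMl ?indicE//; have /andP[] := f01 i r x.
have mg0 r : measurable_fun setT (g0 r).
  by have [_ ig _] := g0P r; exact: intg_measurable ig.
have ig0A r A : measurable A -> intg P (fun x => g0 r x * \1_A x).
  by move=> mA; apply: intg_indic => //; have [] := g0P r.
have [i0 _] := filter_ex (@filterT _ F _).
pose s x := \sum_r g0 r x.
have ms : measurable_fun setT s by exact: measurable_sum.
have s1 : {ae P, forall x, s x = 1}.
  have is_ : intg P s by apply: intg_sum => r _; have [] := g0P r.
  have : ae_eq P setT (EFin \o s) (EFin \o (fun=> 1)).
    apply: integral_ae_eq => // [|A _ mA].
      by apply/measurable_EFinP.
    have sA : \int[P]_x (s x * \1_A x) = \int[P]_x \1_A x.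
      transitivity (\sum_r nu (r, A)).
        rewrite (@eq_Rintegral _ _ _ _ _ (fun x => \sum_r g0 r x * \1_A x)).
          rewrite Rintegral_sum; last by move=> r _; exact: ig0A.
          by apply: eq_bigr => r _; have [_ _ ->] := g0P r.
        by move=> x _; rewrite mulr_suml.
      have h : \sum_r (\int[P]_x (f i r x * \1_A x) - nu (r, A)) @[i --> F] --> (0 : R).
        apply: cvg_sum0 => r.
        have hr := @cvgB _ _ _ _ FF _ _ _ _ (nu_cvg r A mA) (cvg_cst (nu (r, A))).
        by rewrite subrr in hr; exact: hr.
      apply/eqP; rewrite eq_sym -subr_eq0; apply/eqP/esym.
      apply: (cvg_eq_lim _ h (cvg_cst _)) => i; rewrite sumrB; congr (_ - _).
      rewrite -Rintegral_sum; last by move=> r _; exact: iA.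
      apply: eq_Rintegral => x _; rewrite -mulr_suml.
      by have [_ /(_ x)[_ ->]] := fP i; rewrite mul1r.
    have := congr1 EFin sA; rewrite -!Rintegral_fin; last 2 first.
    - exact: integrable_indic.
    - exact: intg_indic.
    rewrite [X in _ -> X = _](_ : _ = \int[P]_x (s x * \1_A x)%:E)%E; last first.
      by rewrite integral_mkcond; apply: eq_integral => x _;
        rewrite patchE indicE; case: ifP; rewrite ?mulr1 ?mulr0.
    move=> ->.
    rewrite [RHS]integral_mkcond; apply: eq_integral => x _.
    by rewrite patchE indicE; case: ifP.
  by apply: filterS => x /(_ Logic.I); case.
(* On the null set where the densities do not add up to 1 they are replaced by an arbitrary member
   of the family, so that the limit is a profile everywhere. *)
pose g r x := if s x == 1 then g0 r x else f i0 r x.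
have mg r : measurable_fun setT (g r).
  apply: measurable_fun_if => //; last 2 first.
  - exact: measurable_funTS.
  - exact: measurable_funTS.
  exact: measurable_fun_eqr.
have gp : profile g.
  split=> // x; split=> [r|].
    rewrite /g; case: ifPn => [/eqP sx|_]; last exact: f01.
    have [h0 _ _] := g0P r; rewrite h0 -sx /s (bigD1 r)//= lerDl sumr_ge0// => r' _.
    by have [] := g0P r'.
  transitivity (if s x == 1 then s x else \sum_r f i0 r x).
    by rewrite /g; case: ifP.
  case: ifPn => [/eqP//|_]; by have [_ /(_ x)[]] := fP i0.
exists g; split=> // r A mA.
rewrite (_ : \int[P]_x (g r x * \1_A x) = nu (r, A)); first exact: nu_cvg.
have [_ _ ->//] := g0P r; apply: Rintegral_ae_eq.
- by apply: measurable_funM => //; exact: measurable_indic.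
- by apply: measurable_funM => //; exact: measurable_indic.
- by move: s1; apply: filterS => x sx; rewrite /g sx eqxx.
Qed.

Variable g : 'I_c -> T -> R.
Hypothesis gP : profile g.
Hypothesis fg : forall r A, measurable A ->
  \int[P]_x (f i r x * \1_A x) @[i --> F] --> \int[P]_x (g r x * \1_A x).

Let fg0 r A : measurable A ->
  \int[P]_x ((f i r x - g r x) * \1_A x) @[i --> F] --> (0 : R).
Proof.
move=> mA; have h := @cvgB _ _ _ _ FF _ _ _ _ (@fg r A mA) (cvg_cst (\int[P]_x (g r x * \1_A x))).
rewrite subrr in h.
rewrite (_ : (fun i => _) = (fun i => \int[P]_x (f i r x * \1_A x) -
  \int[P]_x (g r x * \1_A x))); first exact: h.
apply/funext => i; rewrite -RintegralB//; [|exact: iA|by apply: intg_indic => //; exact: intg_profile].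
by apply: eq_Rintegral => x _; rewrite mulrBl.
Qed.

Let ifg i r : intg P (fun x => f i r x - g r x).
Proof. by apply: intgB; exact: intg_profile. Qed.

Lemma profile_weak_bounded (r : 'I_c) (lam : T -> R) (B : R) :
  measurable_fun setT lam -> (forall x, `|lam x| <= B) ->
  \int[P]_x ((f i r x - g r x) * lam x) @[i --> F] --> (0 : R).
Proof.
move=> mlam lamB; suff key (e : R) : 0 < e ->
    \forall i \near F, `|\int[P]_x ((f i r x - g r x) * lam x)| <= e.
  by apply/cvgr0Pnorm_le => e; exact: key.
move=> e0.
(* f - g is at most 2 in absolute value and rounding changes [lam] by at most 1 / k.+1; this k makes
   the product at most e / 2. *)
pose k := Num.truncn (4 / e).
have k1 : 2 * k.+1%:R^-1 <= e / 2.
  have e4 : 0 <= 4 / e by rewrite divr_ge0// ltW.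
  have /andP[_ h] := truncn_itv e4.
  by rewrite ltr_pdivrMr// in h; rewrite ler_pdivrMr// /k; lra.
have [|x|L [kap [h [mk hk1 hk2]]]] := @quantize _ T R (fun x => lam x + B) (2 * B) k.
- exact: measurable_funD.
- by have := lamB x; rewrite ler_norml => /andP[]; lra.
have hw := weak_simple (fun j => h j - B) (fun i => ifg i r) mk (@fg0 r).
have e2 : 0 < e / 2 by rewrite divr_gt0.
move/cvgr0Pnorm_le : (hw FF) => /(_ _ e2); apply: filterS => i hi.
have mk' : measurable_fun setT (fun x => h (kap x) - B).
  exact: (measurable_ord_fun (fun j => h j - B) mk).
have hb x : `|h (kap x) - B| <= `|B| + `|B|.
  have := hk1 x; have := lamB x; have := ler_norm B.
  by rewrite !ler_norml => ? /andP[? ?] /andP[? ?]; lra.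
have dB x : `|f i r x - g r x| <= 2.
  by rewrite (le_trans (ler_normB _ _))// (lerD (profile_bound _ _ _) (profile_bound _ _ _)).
have i1 := intgM (ifg i r) mk' hb.
have i2 := intgM (ifg i r) mlam lamB.
rewrite (_ : \int[P]_x ((f i r x - g r x) * lam x) =
  \int[P]_x ((f i r x - g r x) * (h (kap x) - B)) +
  \int[P]_x ((f i r x - g r x) * lam x - (f i r x - g r x) * (h (kap x) - B))); last first.
  by rewrite RintegralB// addrC subrK.
rewrite (le_trans (ler_normD _ _))// [leRHS]splitr lerD//.
apply: Rintegral_bound => [|x]; first exact: intg_measurable (intgB i2 i1).
rewrite -mulrBr normrM (le_trans _ k1)// ler_pM//.
by have := hk1 x; have := hk2 x; rewrite ler_norml;
  move: (k.+1%:R^-1) (h (kap x)) (lam x) => *; lra.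
Qed.

Variable p : 'I_c -> R.
Hypothesis p_gt0 : forall r, 0 < p r.
Hypothesis p_sum : \sum_r p r = 1.

(** Test every [f i] with the smoothed ratio of the limit [g]: it is bounded, so the pairing passes
    to the limit, and theta then tends to 0. *)
Lemma entropy_ultralimit (b : R) : (\forall i \near F, entropy P p (f i) <= b) ->
  entropy P p g <= b.
Proof.
move=> hb; have h theta : 0 < theta < 1 -> entropy P p g + ln (1 - theta) <= b.
  move=> t01; apply: (le_trans (entropy_le_llr P p_gt0 p_sum gP t01)).
  pose lam r x := llr p theta (g ^~ x) r.
  have mlam r : measurable_fun setT (lam r).
    apply: (measurableT_comp (@measurable_ln R)).
    apply: measurable_funM => //; apply: measurable_funD => //.
    by apply: measurable_funM => //; have [] := gP.
  pose B := `|ln theta| + \sum_r `|ln (p r)|.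
  have lamB r x : `|lam r x| <= B by apply: norm_llr_le => //; case: gP.
  have c0 : (fun i => \sum_r \int[P]_x ((f i r x - g r x) * lam r x)) @ F --> (0 : R).
    by apply: cvg_sum0 => r; exact: profile_weak_bounded (mlam r) (lamB r).
  have ip k (kp : profile k) r : intg P (fun x => k r x * lam r x).
    by apply: intgM (mlam r) (lamB r); exact: intg_profile.
  have hle : (fun i => \int[P]_u \sum_r g r u * lam r u +
      \sum_r \int[P]_x ((f i r x - g r x) * lam r x)) @ F -->
      \int[P]_u \sum_r g r u * lam r u.
    by have hD := @cvgD _ _ _ _ FF _ _ _ _ (cvg_cst (\int[P]_u \sum_r g r u * lam r u)) c0;
      rewrite addr0 in hD; exact: hD.
  apply: (cvgr_to_le hle); near=> i.
  apply: (@le_trans _ _ (entropy P p (f i))); last by near: i.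
  apply: le_trans (entropy_ge P p_gt0 p_sum (fP i) mlam lamB _); last first.
    by move=> x; rewrite sum_expR_llr//; case: gP.
  rewrite !Rintegral_sum; try by move=> r _; exact: ip.
  rewrite -big_split/= ler_sum// => r _.
  rewrite [X in _ + X <= _](_ : _ = \int[P]_x (f i r x * lam r x) -
      \int[P]_x (g r x * lam r x)); first by rewrite addrC subrK.
  rewrite -RintegralB//; [|exact: ip|exact: ip].
  by apply: eq_Rintegral => x _; rewrite mulrBl.
apply/ler_addgt0Pr => e e0.
have t01 : 0 < 1 - expR (- e) < 1.
  by rewrite subr_gt0 expR_lt1 oppr_lt0 e0/= gtrBl expR_gt0.
by have := h _ t01; rewrite subKr expRK lerBlDr.
Unshelve. all: by end_near. Qed.

End profile_compactness.

(** * The rate function *)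

Section rate_function.
Context d (T : measurableType d) (R : realType) (P : probability T R).
Variables (v c : nat) (H : rel 'I_v) (D : nat).
Hypothesis v_gt0 : (0 < v)%N.
Hypothesis D_gt0 : (0 < D)%N.
Hypothesis H_deg : forall a : 'I_v,
  (#|[pred e : 'I_v * 'I_v | edge H e && ((e.1 == a) || (e.2 == a))]| <= D)%N.
Variables (kappa : forall n, T -> 'I_n.+1) (Q : forall n, 'M[R]_n.+1).
Variable W : T * T -> R.
Hypothesis mkappa : forall n, measurable_fun setT (kappa n).
Hypothesis kappaP : forall n j, P (kappa n @^-1` [set j]) = (n.+1%:R^-1)%:E.
Hypothesis iW : intg (P \x P)%E W.
Hypothesis UW : forall eps : R, 0 < eps ->
  \forall n \near \oo, cut_le P (fun z => block_kernel (kappa n) (Q n) z - W z) eps.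
Hypothesis Utail : forall eta : R, 0 < eta -> exists2 K, 1 <= K &
  \forall n \near \oo, norm_lt P D (fun z => block_kernel (kappa n) (Q n) z -
    clip K (block_kernel (kappa n) (Q n) z)) eta.
Variable p : 'I_c -> R.
Hypothesis p_gt0 : forall r, 0 < p r.
Hypothesis p_sum : \sum_r p r = 1.

Local Notation G := (graph_density P H).
Local Notation U n := (block_kernel (kappa n) (Q n)).
Local Notation pw n := (prod_weight (fun _ : 'I_n => p)).

Let G_cvg := graph_density_cvg c D_gt0 H_deg mkappa iW UW Utail.

(** [W] is replaced by one U_M uniformly over all profiles, and the density at U_M is Lipschitz in
    finitely many block masses, which converge by assumption. *)
Lemma graph_density_ultralimit (I : Type) (F : set_system I) (FU : UltraFilter F)
    (f : I -> 'I_c -> T -> R) (g : 'I_c -> T -> R) :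
  (forall i, profile (f i)) -> profile g ->
  (forall r A, measurable A ->
    \int[P]_x (f i r x * \1_A x) @[i --> F] --> \int[P]_x (g r x * \1_A x)) ->
  G W (f i) @[i --> F] --> G W g.
Proof.
move=> fp gp fg; suff key (e : R) : 0 < e ->
    \forall i \near F, `|G W g - G W (f i)| <= e.
  by apply/cvgrPdist_le => e; exact: key.
move=> e0; have e3 : 0 < e / 3 by rewrite divr_gt0.
have [M _ /(_ M (leqnn M)) hM] := G_cvg e3.
have [C C0 lipC] := graph_density_lipschitz P c (@mkappa M) H (Q M).
have C1 : 0 < C + 1 by rewrite ltr_wpDl.
pose dl := e / 3 / (C + 1).
have dl0 : 0 < dl by rewrite divr_gt0.
have Cdl : C * dl <= e / 3.
  by rewrite -[leRHS](divfK (lt0r_neq0 C1)) mulrC ler_pM2l// lerDl.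
pose a (jr : 'I_M.+1 * 'I_c) i := `|block_mass P (kappa M) (f i jr.2) jr.1 -
  block_mass P (kappa M) (g jr.2) jr.1|.
have a_ge0 jr i : 0 <= a jr i by exact: normr_ge0.
have FF : Filter F by exact: filter_filter.
have a0 : (fun i => \sum_jr a jr i) @ F --> (0 : R).
  apply: cvg_sum0 => -[j r]; rewrite -[X in _ --> X](normr0 R^o); apply: cvg_norm.
  have h := @cvgB _ _ _ _ FF _ _ _ _ (@fg r _ (measurable_block (@mkappa M) j))
    (cvg_cst (block_mass P (kappa M) (g r) j)).
  by rewrite subrr in h; exact: h.
move/cvgr0Pnorm_le : a0 => /(_ _ dl0); apply: filterS => i hi.
have close j r : `|block_mass P (kappa M) (f i r) j -
    block_mass P (kappa M) (g r) j| <= dl.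
  apply: le_trans hi; rewrite [leRHS]ger0_norm; last exact: sumr_ge0.
  rewrite (bigD1 (j, r))//= lerDl; exact: sumr_ge0.
have h1 := lipC _ _ _ (fp i) gp (ltW dl0) close.
have h2 := hM _ gp; have h3 := hM _ (fp i).
have eE : e = 3 * (e / 3) by field.
rewrite [leRHS]eE; move: (le_trans h1 Cdl) h2 h3.
by rewrite !ler_norml; move: (e / 3) => x *; lra.
Qed.

Definition rate (t : R) : \bar R := ereal_inf
  [set (entropy P p f)%:E | f in [set f : 'I_c -> T -> R | profile f /\ G W f = t]].

Lemma rate_ge0 t : (0 <= rate t)%E.
Proof.
by apply: le_ereal_inf_tmp => _ [f [fp _] <-]; rewrite lee_fin; exact: entropy_ge0.
Qed.

Lemma rate_le f : profile f -> (rate (G W f) <= (entropy P p f)%:E)%E.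
Proof. by move=> fp; apply: ereal_inf_lbound; exists f. Qed.

Lemma rate_lt t (b : R) : (rate t < b%:E)%E ->
  exists f, [/\ profile f, G W f = t & entropy P p f < b].
Proof.
by move=> /ereal_inf_lt[_ [f [fp fG] <-]]; rewrite lte_fin => fb; exists f.
Qed.

Lemma rate_attained t (a : R) : (rate t <= a%:E)%E ->
  exists f, [/\ profile f, G W f = t & entropy P p f <= a].
Proof.
move=> ta.
have /choice[f fP] (n : nat) : exists f,
    [/\ profile f, G W f = t & entropy P p f < a + n.+1%:R^-1].
  by apply: rate_lt; rewrite (le_lt_trans ta)// lte_fin ltrDl.
have [F [FU Foo]] := ultraFilterLemma (F := \oo) _.
have fp n : profile (f n) by have [] := fP n.
have [g [gp fg]] := profile_ultralimit P FU fp.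
exists g; split=> //.
  apply: (cvg_eq_lim _ (graph_density_ultralimit FU fp gp fg) (cvg_cst t)) => n.
  by have [] := fP n.
apply/ler_addgt0Pr => e e0; apply: (entropy_ultralimit FU fp gp fg p_gt0 p_sum).
apply: Foo; near=> n; have [_ _ h] := fP n; rewrite (le_trans (ltW h))// lerD2l.
apply/ltW; near: n; exact: (near_infty_natSinv_lt (PosNum e0)).
Unshelve. all: by end_near. Qed.

(** An ultrafilter on values t is lifted to profiles by choosing a minimizer for each t; the density
    of their ultralimit is the limit of the values. *)
Lemma rate_compact (a : R) : compact [set t | (rate t <= a%:E)%E].
Proof.
rewrite compact_ultra => F FU FK; have FF : ProperFilter F by exact: ultra_proper.
(* [f0] is the default profile for the values outside the sublevel set, which the ultrafilter
   ignores. *)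
have [t0 /rate_attained[f0 [f0p _ _]]] := filter_ex FK.
have /choice[f fP] (t : R) : exists f : 'I_c -> T -> R, profile f /\
    ((rate t <= a%:E)%E -> G W f = t /\ entropy P p f <= a).
  have [/rate_attained[f [fp fG fa]]|nt] := pselect (rate t <= a%:E)%E.
    by exists f; split.
  by exists f0; split.
have fp t : profile (f t) by have [] := fP t.
have [g [gp fg]] := profile_ultralimit P FU fp.
exists (G W g); split.
  apply: (le_trans (rate_le gp)); rewrite lee_fin.
  apply: (entropy_ultralimit FU fp gp fg p_gt0 p_sum).
  by apply: filterS FK => t ta; have [_ /(_ ta)[]] := fP t.
apply: cvg_trans (graph_density_ultralimit FU fp gp fg); apply: near_eq_cvg.
by apply: filterS FK => t ta; have [_ /(_ ta)[-> ]] := fP t.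
Qed.

Local Notation prob n F :=
  (\sum_(x : {ffun 'I_n.+1 -> 'I_c} | `[< F (N2 H (Q n) x) >]) pw n.+1 x).

Lemma count_ldp_lower (F : set R) t (b : R) : F^° t -> (rate t < b%:E)%E ->
  \forall n \near \oo, expR (- (n.+1%:R * b)) <= prob n F.
Proof.
move=> /nbhs_ballP[e /= e0 he] /rate_lt[f [fp fG fb]].
have b0 : 0 < b - entropy P p f by rewrite subr_gt0.
have hF s : `|s - G W f| < e -> F s.
  by move=> h; apply: he; rewrite /ball/= fG in h *; rewrite distrC.
have := count_lower v_gt0 D_gt0 H_deg mkappa kappaP iW UW Utail p_gt0 p_sum
  fp e0 hF b0.
by apply: filterS => n; rewrite addrC subrK.
Qed.

(** The compact sublevel set at b - dl / 2 is disjoint from the closure of F, hence at positive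
    distance e from F, as [count_upper] requires. *)
Lemma count_ldp_upper (F : set R) (b dl : R) :
  (forall t, closure F t -> (b%:E <= rate t)%E) -> 0 < dl ->
  \forall n \near \oo, prob n F <= expR (- (n.+1%:R * (b - dl))).
Proof.
move=> hF dl0; have d2 : 0 < dl / 2 by rewrite divr_gt0.
(* Compactness as a near-covering property: a distance valid near each point of the set yields one
   valid for all points. *)
have /compact_near_coveringP cK := @rate_compact (b - dl / 2).
have [e [e0 he]] : exists e : R, 0 < e /\
    forall x, (rate x <= (b - dl / 2)%:E)%E -> forall t, F t -> e <= `|t - x|.
  have := cK R (0 : R)^'+ (fun e x => forall t, F t -> e <= `|t - x|) _.
  move=> /(_ _) h; have {}h := h _.
  have hK : \forall e \near (0 : R)^'+, forall x,
      (rate x <= (b - dl / 2)%:E)%E -> forall t, F t -> e <= `|t - x|.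
    apply: h => x xK.
    have nF : ~ closure F x.
      move=> /hF; apply/negP; rewrite -ltNge (le_lt_trans xK)// lte_fin.
      by rewrite ltrBlDr ltrDl.
    have [e e0 eF] : exists2 e : R, 0 < e & forall t, F t -> e <= `|t - x|.
      apply: contrapT => h0; apply: nF => B /nbhs_ballP[e /= e0 eB].
      apply: contrapT => FB; apply: h0; exists e => // t Ft; rewrite leNgt.
      apply/negP => te; apply: FB; exists t; split=> //; apply: eB.
      by rewrite /ball/= distrC.
    near=> x' e' => t Ft.
    have h1 := eF _ Ft; have h2 : `|t - x| <= `|t - x'| + `|x' - x|.
      by rewrite (le_trans _ (ler_normD _ _))// addrA subrK.
    have h3 : `|x' - x| <= e / 2.
      by near: x'; apply: cvgr_distC_le; [exact: cvg_id|rewrite divr_gt0].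
    have h4 : e' <= e / 2.
      by near: e'; apply: nbhs_right_le; rewrite divr_gt0.
    rewrite /= -(lerD2r (e / 2)) (le_trans (lerD h4 (lexx _)))// -splitr.
    by rewrite (le_trans h1)// (le_trans h2)// lerD2l.
  near (0 : R)^'+ => e; exists e; split; first by near: e; exact: nbhs_right_gt.
  by near: e.
have hup := count_upper v_gt0 D_gt0 H_deg mkappa kappaP iW UW Utail p_gt0 p_sum
  (F := F) (b := b - dl / 2) e0 _ d2.
have : \forall n \near \oo, prob n F <= expR (- (n.+1%:R * (b - dl / 2 - dl / 2))).
  apply: hup => f fp fb t Ft; apply: he => //.
  by rewrite (le_trans (rate_le fp))// lee_fin ltW.
by apply: filterS => n; rewrite -addrA -opprD -splitr.
Unshelve. all: by end_near. Qed.

End rate_function.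

(** * Transfer to the unit interval *)

(** Sending an edge at [a] to its other endpoint is injective, because an undirected edge occurs in
    one orientation only. *)
Lemma edge_degree (v : nat) (H : rel 'I_v) (a : 'I_v) : symmetric H ->
  (#|[pred e : 'I_v * 'I_v | edge H e && ((e.1 == a) || (e.2 == a))]|
    <= max_degree H)%N.
Proof.
move=> sH; apply: (@leq_trans #|[pred b | H a b]|); last first.
  exact: (@leq_bigmax _ (fun a => #|[pred b | H a b]|)).
pose other (e : 'I_v * 'I_v) := if e.1 == a then e.2 else e.1.
have oI : {in [pred e | edge H e && ((e.1 == a) || (e.2 == a))] &, injective other}.
  move=> [x y] [x' y']; rewrite !inE /edge/other/=.
  move=> /andP[/andP[xy _] xya] /andP[/andP[xy' _] xya'].
  have [xa|xa] := eqVneq x a; have [xa'|xa'] := eqVneq x' a => e.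
  - by rewrite xa xa' e.
  - rewrite (negbTE xa')/= in xya'; move/eqP in xya'.
    by exfalso; move: xy xy'; rewrite xa xya' e; lia.
  - rewrite (negbTE xa)/= in xya; move/eqP in xya.
    by exfalso; move: xy xy'; rewrite xa' xya e; lia.
  - rewrite (negbTE xa)/= in xya; rewrite (negbTE xa')/= in xya'.
    by rewrite e (eqP xya) (eqP xya').
rewrite -(card_in_image oI); apply: subset_leq_card; apply/fintype.subsetP => b.
move=> /fintype.imageP[[x y]]; rewrite !inE /edge/other/= => /andP[/andP[_ Hxy] xya] ->.
have [xa|xa] := eqVneq x a; first by rewrite -xa.
by rewrite (negbTE xa)/= in xya; rewrite sH -(eqP xya).
Qed.

Section iid_laws.
Context d (Omega : measurableType d) (R : realType) (P : probability Omega R).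
Variables (c : nat) (mu : probability 'I_c.+1 R).
Variables (n : nat) (X : 'I_n -> {mfun Omega >-> 'I_c.+1}).
Hypothesis X_iid : iid P mu X.

Lemma iid_prob (A : pred {ffun 'I_n -> 'I_c.+1}) :
  P [set w | A [ffun i => X i w]] =
  (\sum_(x | A x) prod_weight (fun=> fun r => fine (mu [set r])) x)%:E.
Proof.
have [Xd Xi] := X_iid.
pose B (x : {ffun 'I_n -> 'I_c.+1}) := \bigcap_(i in [set: 'I_n]) (X i @^-1` [set x i]).
have m1 (r : 'I_c.+1) : measurable [set r] by [].
have mB x : measurable (B x).
  apply: fin_bigcap_measurable => [|i _]; first exact: finite_finset.
  by rewrite -[X in measurable X]setTI; exact: measurable_funP.
have BE x w : B x w <-> [ffun i => X i w] = x.
  split=> [h|<- i _ /=]; last by rewrite ffunE.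
  by apply/ffunP => i; rewrite ffunE; exact: (h i).
have -> : [set w | A [ffun i => X i w]] = \bigcup_(x in [set` enum A]) B x.
  apply/seteqP; split => [w /= Aw|w [x /= Ax /BE xw] /=].
    by exists [ffun i => X i w] => /=; [rewrite mem_enum|exact/BE].
  by rewrite mem_enum in Ax; rewrite xw.
have tB : trivIset [set` enum A] B.
  by move=> x y _ _ [w [/BE <- /BE <-]].
rewrite measure_fin_bigcup// -fsbig_seq ?enum_uniq// big_enum/=.
rewrite -sumEFin; apply: eq_bigr => x _; rewrite /B Xi// -prodEFin.
apply: eq_bigr => i _; rewrite -[LHS]/(distribution P (X i) [set x i]) Xd//.
by rewrite fineK// fin_num_measure.
Qed.

End iid_laws.

Section unit_interval_rate.
Context (R : realType).

Local Notation P := (unit_leb R).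
Local Notation TR := (measurableTypeR R).

Lemma ae_unit_itv : {ae P, forall x, unit_itv R x}.
Proof.
exists (~` unit_itv R); split=> //; first by apply: measurableC; exact: measurable_unit_itv.
by rewrite /unit_leb /mrestr setICl measure0.
Qed.

Lemma ae_power_unit_itv v :
  {ae power_prob P v, forall x, forall a, unit_itv R (tnth x a)}.
Proof.
have mB : measurable (box (fun _ : 'I_v => unit_itv R)).
  by apply: measurable_box => a; exact: measurable_unit_itv.
exists (~` box (fun _ : 'I_v => unit_itv R)); split=> //; first exact: measurableC.
have pB : power_prob P v (box (fun _ : 'I_v => unit_itv R)) = 1%E.
  rewrite power_box => [|a]; last exact: measurable_unit_itv.
  rewrite big1// => a _; transitivity (P setT); last exact: probability_setT.
  transitivity (@lebesgue_measure R (unit_itv R `&` unit_itv R)); first by [].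
  by rewrite setIid -[in LHS](setTI (unit_itv R)).
by rewrite probability_setC// pB subee.
Qed.

Variables (v c : nat) (H : rel 'I_v) (D : nat) (p : 'I_c.+1 -> R) (W : R * R -> R).
Hypothesis D_gt0 : (0 < D)%N.
Hypothesis H_deg : forall a : 'I_v,
  (#|[pred e : 'I_v * 'I_v | edge H e && ((e.1 == a) || (e.2 == a))]| <= D)%N.
Variable N : R.
Hypothesis WN : norm_lt P D (W : TR * TR -> R) N.
Hypothesis p_gt0 : forall r, 0 < p r.
Hypothesis p_sum : \sum_r p r = 1.

Implicit Types f : 'I_c.+1 -> TR -> R.

Let mW : measurable_fun setT (W : TR * TR -> R). Proof. by case: WN. Qed.

Let mG f r : (forall r, measurable_fun setT (f r)) -> measurable_fun setT
  (fun x : v.-tuple TR => \prod_(e | edge H e) W (tnth x e.1, tnth x e.2) *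
    \prod_(a < v) f r (tnth x a)).
Proof.
move=> mf; apply: measurable_funM.
  by apply: measurable_bprod => e _; exact: measurable_edge.
by apply: measurable_bprod => a _; exact: measurable_tnth_fun.
Qed.

Let mkl f : (forall r, measurable_fun setT (f r)) ->
  measurable_fun setT (fun x => \sum_r f r x * ln (f r x / p r)).
Proof.
move=> mf; apply: measurable_sum => r; apply: measurable_funM => //.
by apply: (measurableT_comp (@measurable_ln R)); exact: measurable_funM.
Qed.

(** Outside the unit interval, a null set, all mass goes to the colour [ord0], so that the
    constraint of [profile] holds everywhere. *)
Definition extend_profile f r x := if x \in unit_itv R then f r x else (r == ord0)%:R.

Lemma extend_profileP f : colour_profile f -> profile (extend_profile f).
Proof.
move=> [mf fp]; split=> [r|x].
  apply: measurable_fun_ifT => //.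
  by apply: (measurable_fun_bool true); rewrite setTI preimage_mem_true;
    exact: measurable_unit_itv.
have [xI|nxI] := pselect (unit_itv R x).
  rewrite (_ : _ ^~ x = f ^~ x); first exact: fp.
  by apply/funext => r; rewrite /extend_profile mem_set.
rewrite (_ : _ ^~ x = fun r => (r == ord0)%:R); last first.
  by apply/funext => r; rewrite /extend_profile memNset.
split=> [r|]; first by rewrite ler0n lern1 leq_b1.
by rewrite (bigD1 ord0)//= big1 ?addr0// => r /negbTE ->.
Qed.

Lemma extend_profileE f r x : unit_itv R x -> extend_profile f r x = f r x.
Proof. by rewrite /extend_profile => /mem_set ->. Qed.

Lemma G2_extend f : colour_profile f -> G2 H W (extend_profile f) = G2 H W f.
Proof.
move=> fp; have [mg _] := extend_profileP fp; have [mf _] := fp.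
apply: eq_bigr => r _; apply: ae_eq_integral => //.
- by apply/measurable_EFinP; exact: mG.
- by apply/measurable_EFinP; exact: mG.
apply: filterS (ae_power_unit_itv v) => x hx _; congr ((_ * _)%:E).
by apply: eq_bigr => a _; rewrite extend_profileE.
Qed.

Lemma relative_entropy_extend f : colour_profile f ->
  relative_entropy p (extend_profile f) = relative_entropy p f.
Proof.
move=> fp; have [mg _] := extend_profileP fp; have [mf _] := fp.
apply: ae_eq_integral => //.
- by apply/measurable_EFinP; exact: mkl.
- by apply/measurable_EFinP; exact: mkl.
apply: filterS ae_unit_itv => x hx _; congr (_%:E).
by apply: eq_bigr => r _; rewrite extend_profileE.
Qed.

Lemma profile_colour f : profile f -> colour_profile f.
Proof. by move=> [mf fp]; split=> // x _; exact: fp. Qed.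

Lemma G2_graph_density f : profile f ->
  G2 H W f = (graph_density P H (W : TR * TR -> R) f)%:E.
Proof.
move=> fp; rewrite /graph_density -sumEFin; apply: eq_bigr => r _.
rewrite -Rintegral_fin//.
apply: (intg_hom D_gt0 (@edge_lt _ H) H_deg (N := fun=> N)) => //.
exact: profile_test fp.
Qed.

Lemma relative_entropyE f : profile f -> relative_entropy p f = (entropy P p f)%:E.
Proof. by move=> fp; rewrite -Rintegral_fin//; exact: (intg_kl P p_gt0 p_sum fp). Qed.

Lemma I2_rate t : I2 H p W t = rate P H (W : TR * TR -> R) p t.
Proof.
congr ereal_inf; apply/seteqP; split=> _ [f [fp fG] <-].
  have ep := extend_profileP fp; exists (extend_profile f).
    split=> //; apply: EFin_inj.
    by rewrite -G2_graph_density// G2_extend.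
  by rewrite -relative_entropyE// relative_entropy_extend.
exists f; last by rewrite relative_entropyE.
by split; [exact: profile_colour|rewrite G2_graph_density// fG].
Qed.

End unit_interval_rate.

Lemma ae_prod d1 d2 (X : measurableType d1) (Y : measurableType d2) (R : realType)
    (P : probability X R) (Q : probability Y R) (A : set X) (B : set Y) :
  {ae P, forall x, A x} -> {ae Q, forall y, B y} ->
  {ae (P \x Q)%E, forall z, A z.1 /\ B z.2}.
Proof.
move=> [N [mN N0 AN]] [M [mM M0 BM]].
have m1 : measurable (N `*` [set: Y]) by exact: measurableX.
have m2 : measurable ([set: X] `*` M) by exact: measurableX.
exists (N `*` setT `|` setT `*` M); split; first exact: measurableU.
  apply/eqP; rewrite eq_le measure_ge0 andbT.
  have h1 : (P \x Q)%E (N `*` [set: Y]) = 0%E.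
    transitivity (P N * Q setT)%E; first exact: product_measure1E.
    by rewrite [P N]N0 mul0e.
  have h2 : (P \x Q)%E ([set: X] `*` M) = 0%E.
    transitivity (P setT * Q M)%E; first exact: product_measure1E.
    by rewrite [Q M]M0 mule0.
  have e2le (a b : \bar R) : a = b -> (a <= b)%E by move=> ->.
  apply: (le_trans (measureU2 _ m1 m2)); rewrite -[leRHS]adde0.
  by apply: leeD; exact: e2le.
move=> z /= /not_andP[nA|nB]; first by left; split=> //; exact: AN.
by right; split=> //; exact: BM.
Qed.

Section grid_cells.
Context (R : realType).
Local Notation P := (unit_leb R).
Local Notation TR := (measurableTypeR R).

(** The point 0 is left out because its ceiling is 0, which is no matrix index i.+1. *)
Lemma ae_unit_itv0 : {ae P, forall x, 0 < x <= 1}.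
Proof.
exists (~` `]0, 1]); split.
- by apply: measurableC; exact: measurable_itv.
- rewrite /unit_leb /mrestr.
  rewrite (_ : _ `&` _ = [set 0]) ?lebesgue_measure_set1//.
  apply/seteqP; split => [x [/= h0 h1]|x ->]; last first.
    by split; rewrite ?/unit_itv/= in_itv/= ?ltxx ?lexx ?ler01.
  move: h0 h1; rewrite /unit_itv/= !in_itv/= => h0 /andP[x0 x1].
  by apply: contrapT => /eqP xn; apply: h0; rewrite lt_neqAle eq_sym xn x0.
- by move=> x /=; rewrite in_itv.
Qed.

(* The index of the cell ]i / n.+1, i.+1 / n.+1] containing x; the value outside
   ]0, 1] is irrelevant. *)
Definition cell n (x : TR) : 'I_n.+1 :=
  odflt ord0 [pick i : 'I_n.+1 | i%:R < n.+1%:R * x <= i.+1%:R].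

Definition cell_itv n (i : 'I_n.+1) : set TR :=
  `](n.+1%:R^-1 * i%:R), (n.+1%:R^-1 * i.+1%:R)]%classic.

Lemma cell_itvE n (i : 'I_n.+1) x :
  cell_itv i x <-> i%:R < n.+1%:R * x <= i.+1%:R.
Proof. by rewrite /cell_itv/= in_itv/= ltr_pdivrMl// ler_pdivlMl. Qed.

Lemma cellE n (i : 'I_n.+1) x : cell_itv i x -> cell n x = i.
Proof.
move/cell_itvE => /andP[i1 i2]; rewrite /cell; case: pickP => [j /andP[j1 j2]|/(_ i)].
  have ij : (i < j.+1)%N by rewrite -(ltr_nat R) (lt_le_trans i1).
  have ji : (j < i.+1)%N by rewrite -(ltr_nat R) (lt_le_trans j1).
  by apply/val_inj => /=; lia.
by rewrite i1 i2.
Qed.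

Lemma cell_mem n x : 0 < x <= 1 -> cell_itv (cell n x) x.
Proof.
move=> /andP[x0 x1]; rewrite /cell; case: pickP => [i /cell_itvE//|h].
exfalso; pose m := `|Num.ceil (n.+1%:R * x)|.-1%N.
have y0 : 0 < n.+1%:R * x by rewrite mulr_gt0.
have c0 : 0 < Num.ceil (n.+1%:R * x) by rewrite ceil_gt0.
have cm : Num.ceil (n.+1%:R * x) = m.+1%:Z.
  by rewrite /m prednK ?absz_gt0 ?gt_eqF// gez0_abs// ltW.
have := ceil_itv (n.+1%:R * x); rewrite cm => hm.
have hm' : m%:R < n.+1%:R * x <= m.+1%:R.
  by move: hm; rewrite intrB/= -[m.+1]addn1 natrD; rewrite !pmulrn; lra.
have mn : (m < n.+1)%N.
  rewrite -(ltr_nat R); have /andP[h1 _] := hm'; rewrite (lt_le_trans h1)//.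
  by rewrite ler_piMr.
by have := h (Ordinal mn); rewrite /= hm'.
Qed.

Lemma measurable_cell_itv n (i : 'I_n.+1) : measurable (cell_itv i).
Proof. exact: measurable_itv. Qed.

Lemma measurable_cell n : measurable_fun setT (cell n).
Proof.
apply: measurable_ord => j.
(* The second set accounts for the default value [ord0] of [cell] off all the intervals. *)
rewrite (_ : _ @^-1` _ = cell_itv j `|`
    ([set x | j = ord0] `&` ~` \bigcup_(i in [set: 'I_n.+1]) cell_itv i)).
  apply: measurableU; first exact: measurable_cell_itv.
  apply: measurableI.
    have [->|j0] := eqVneq j ord0; first by rewrite (_ : [set _ | _] = setT)//; apply/seteqP.
    rewrite (_ : [set _ | _] = set0)//; apply/seteqP; split=> // x /= /eqP.
    by rewrite (negbTE j0).
  apply: measurableC; apply: fin_bigcup_measurable => [|i _]; first exact: finite_finset.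
  exact: measurable_cell_itv.
apply/seteqP; split => [x /= <-|x [/cellE//|[/= -> h]]].
  rewrite /cell; case: pickP => [i /cell_itvE xi|h]; first by left.
  by right; split=> //= -[i _ /cell_itvE]; rewrite h.
rewrite /cell; case: pickP => [i /cell_itvE xi|//].
by exfalso; apply: h; exists i.
Qed.

Lemma unit_leb_cell n (j : 'I_n.+1) : P (cell n @^-1` [set j]) = (n.+1%:R^-1)%:E.
Proof.
have mc : measurable (cell n @^-1` [set j]).
  by apply: measurable_fiber; exact: measurable_cell.
transitivity (P (cell_itv j)).
  have [N [mN N0 hN]] := ae_unit_itv0.
  have mI := measurable_cell_itv j.
  apply/eqP; rewrite eq_le; apply/andP; split.
    apply: (@le_trans _ _ (P (cell_itv j `|` N))).
      apply: le_measure; rewrite ?inE//; first exact: measurableU.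
      move=> x /= xj; have [x01|nx] := pselect (0 < x <= 1); last by right; exact: hN.
      by left; rewrite -xj; exact: cell_mem.
    by rewrite (le_trans (measureU2 _ mI mN))// [X in (_ + X)%E]N0 adde0.
  by apply: le_measure; rewrite ?inE// => x /cellE.
have n0 : 0 < n.+1%:R :> R by rewrite ltr0n.
transitivity (@lebesgue_measure R (cell_itv j)).
  rewrite /unit_leb /mrestr; congr lebesgue_measure; apply/setIidl.
  move=> x /cell_itvE /andP[x1 x2]; rewrite /unit_itv/= in_itv/=.
  apply/andP; split.
    rewrite -(pmulr_rge0 _ n0); apply: ltW; apply: le_lt_trans x1; exact: ler0n.
  rewrite -(ler_pM2l n0) mulr1; apply: (le_trans x2); by rewrite ler_nat.
rewrite /cell_itv lebesgue_measure_itv/= lte_fin ltr_pM2l ?invr_gt0// ltr_nat ltnSn.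
by rewrite -EFinB -mulrBr -natrB// subSnn mulr1.
Qed.

Lemma step_kernel_cell n (Q : 'M[R]_n.+1) (x y : R) : 0 < x <= 1 -> 0 < y <= 1 ->
  step_kernel Q (x, y) = Q (cell n x) (cell n y).
Proof.
have key (t : R) (i : 'I_n.+1) : 0 < t <= 1 ->
    (Num.ceil (n.+1%:R * t) == i.+1%:Z) = (cell n t == i).
  move=> t01; rewrite ceil_eq.
  have -> : (i.+1%:Z - 1)%:~R = i%:R :> R.
    by rewrite -[i.+1]addn1 PoszD addrK.
  apply/idP/eqP => [h|<-]; first by apply: cellE; apply/cell_itvE.
  by apply/cell_itvE; exact: cell_mem.
move=> x01 y01; rewrite /step_kernel/=.
rewrite (bigD1 (cell n x))//= [X in _ + X]big1 ?addr0; last first.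
  move=> i xi; rewrite big1// => j _.
  by rewrite key// eq_sym (negbTE xi) mulr0.
rewrite (bigD1 (cell n y))//= big1 ?addr0; last first.
  by move=> j yj; rewrite [X in _ && X]key// [X in _ && X]eq_sym (negbTE yj) andbF mulr0.
by rewrite !key// !eqxx mulr1.
Qed.

End grid_cells.

Section step_kernels.
Context (R : realType).
Local Notation P := (unit_leb R).
Local Notation TR := (measurableTypeR R).

Let half : set TR := [set x | 0 < x <= 1].

Let mhalf : measurable half.
Proof. by have := @measurable_itv R `]0, 1]; rewrite set_itvE. Qed.

Lemma step_kernel_out n (Q : 'M[R]_n.+1) (x y : R) : ~ (half x /\ half y) ->
  step_kernel Q (x, y) = 0.
Proof.
have key (t : R) (i : 'I_n.+1) : Num.ceil (n.+1%:R * t) == i.+1%:Z -> half t.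
  rewrite ceil_eq; have -> : (i.+1%:Z - 1)%:~R = i%:R :> R.
    by rewrite -[i.+1]addn1 PoszD addrK.
  have n0 : 0 < n.+1%:R :> R by rewrite ltr0n.
  move=> /andP[h1 h2]; rewrite /half/=; apply/andP; split.
    by rewrite -(pmulr_rgt0 _ n0); apply: le_lt_trans h1; exact: ler0n.
  by rewrite -(ler_pM2l n0) mulr1; apply: (le_trans h2); rewrite ler_nat.
move=> nxy; rewrite /step_kernel big1// => i _; rewrite big1// => j _.
case: (boolP (_ && _)) => [/andP[/key hx /key hy]|_]; last by rewrite mulr0.
by exfalso; apply: nxy.
Qed.

Lemma measurable_step_kernel n (Q : 'M[R]_n.+1) :
  measurable_fun setT (step_kernel Q : TR * TR -> R).
Proof.
rewrite (_ : step_kernel Q = (fun z : TR * TR =>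
    block_kernel (@cell R n) Q z * \1_(half `*` half) z)).
  apply: measurable_funM; last by apply: measurable_indic; exact: measurableX.
  apply: (measurable_block2 _ (fun i j => Q i j)); exact: measurable_cell.
apply/funext => -[x y]; have [[hx hy]|nh] := pselect (half x /\ half y).
  rewrite step_kernel_cell// indicE mem_set ?mulr1//; by split.
rewrite step_kernel_out// indicE memNset ?mulr0// => -[/= h1 h2]; exact: nh.
Qed.

Section relabelled.
Variable s : TR -> TR.
Hypothesis sP : mp_bijection s.

(** Relabelling a step kernel by [s] amounts to composing [cell] with [s]; the result is again a
    block kernel with blocks of equal measure. *)
Definition relabelled_cell n (u : TR) : 'I_n.+1 := cell n (s u).

Let ms : measurable_fun setT s. Proof. by case: sP. Qed.

Lemma measurable_relabelled_cell n : measurable_fun setT (@relabelled_cell n).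
Proof. exact: (measurableT_comp (@measurable_cell R n) ms). Qed.

Lemma unit_leb_relabelled_cell n (j : 'I_n.+1) :
  P (@relabelled_cell n @^-1` [set j]) = (n.+1%:R^-1)%:E.
Proof.
have [_ _ sE] := sP; rewrite -(@unit_leb_cell R n j).
apply: (sE (cell n @^-1` [set j])).
by apply: measurable_fiber; exact: measurable_cell.
Qed.

Lemma ae_relabel_half : {ae P, forall u, half (s u)}.
Proof.
have [_ _ sE] := sP; have [N [mN N0 hN]] := ae_unit_itv0 R.
exists (s @^-1` N); split.
- by rewrite -[X in measurable X]setTI; exact: ms.
- by rewrite -N0; exact: sE.
- by move=> u /= h; apply: hN.
Qed.

Lemma ae_relabel n (Q : 'M[R]_n.+1) : {ae @unit_leb2 R, forall z : TR * TR,
  [/\ unit_itv R z.1, unit_itv R z.2 &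
      block_kernel (@relabelled_cell n) Q z = relabel s (step_kernel Q) z]}.
Proof.
have h : {ae P, forall u, unit_itv R u /\ half (s u)}.
  by apply: filterS2 (ae_unit_itv R) ae_relabel_half => u; split.
apply: filterS (ae_prod h h) => -[x y] /= [[x1 x2] [y1 y2]]; split=> //.
by rewrite /relabel/= step_kernel_cell.
Qed.

Lemma measurable_relabel n (Q : 'M[R]_n.+1) :
  measurable_fun setT (relabel s (step_kernel Q) : TR * TR -> R).
Proof.
apply: (measurableT_comp (@measurable_step_kernel n Q)).
apply/measurable_fun_pairP; split => /=.
  exact: (measurableT_comp ms).
exact: (measurableT_comp ms).
Qed.

Lemma cut_le_relabel n (Q : 'M[R]_n.+1) (W : R * R -> R) (eps : R) :
  kernel_L1 W -> (cut_dist (relabel s (step_kernel Q)) W <= eps%:E)%E ->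
  cut_le P (fun z => block_kernel (@relabelled_cell n) Q z - W z) eps.
Proof.
move=> [iW _] cut A B mA mB.
(* [cut_dist] only tests subsets of [0,1], whereas [cut_le] tests all measurable sets of the line;
   the measure does not see the difference. *)
pose A' := A `&` unit_itv R; pose B' := B `&` unit_itv R.
have mI := @measurable_unit_itv R.
have mA' : measurable A' by exact: measurableI.
have mB' : measurable B' by exact: measurableI.
have iU : intg (P \x P)%E (block_kernel (@relabelled_cell n) Q).
  by apply: (intg_block2 _ _ (fun i j => Q i j)); exact: measurable_relabelled_cell.
have ih := @intgB _ _ _ (prod_prob P P) _ _ iU iW.
have hi := @intg_indic _ _ _ (prod_prob P P) _ (A `*` B) ih (measurableX mA mB).
have mr := @measurable_relabel n Q.
have mW : measurable_fun setT (W : TR * TR -> R) := @intg_measurable _ _ _ (prod_prob P P) _ iW.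
have E1 : (\int[@unit_leb2 R]_(z in A' `*` B') (relabel s (step_kernel Q) z - W z)%:E =
    (\int[prod_prob P P]_(z in A `*` B)
      (block_kernel (@relabelled_cell n) Q z - W z))%:E)%E.
  rewrite Rintegral_setE -Rintegral_fin//.
  transitivity (\int[@unit_leb2 R]_z
      ((relabel s (step_kernel Q) z - W z) * \1_(A' `*` B') z)%:E)%E.
    rewrite integral_mkcond; apply: eq_integral => z _.
    by rewrite patchE indicE; case: ifP; rewrite ?mulr1 ?mulr0.
  apply: ae_eq_integral => //.
  - apply/measurable_EFinP; apply: measurable_funM; first exact: measurable_funB.
    by apply: measurable_indic; exact: measurableX.
  - by case/integrableP: hi.
  apply: filterS (ae_relabel Q) => -[x y] /= [x1 y1 ->] _; congr ((_ * _)%:E).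
  rewrite !indicE; congr (nat_of_bool _)%:R; apply/idP/idP; rewrite !inE.
    by move=> [[Ax _] [By _]]; split.
  by move=> [/= Ax By]; do 2 split.
have : (`|\int[@unit_leb2 R]_(z in A' `*` B') (relabel s (step_kernel Q) z - W z)%:E|
    <= eps%:E)%E.
  apply: (le_trans _ cut); apply: ereal_sup_ubound; exists A', B'; split=> //.
    by split=> // x [].
  by split=> // x [].
by rewrite E1 abse_EFin lee_fin.
Qed.

End relabelled.

(** * Uniform tails from the moment of order q times the degree *)

Section tails.
Variables (q C : R) (D : nat).
Hypothesis q_gt1 : 1 < q.
Hypothesis D_gt0 : (0 < D)%N.

Let r := q * D%:R.
Let D0 : 0 < D%:R :> R. Proof. by rewrite ltr0n. Qed.
Let q0 : 0 < q. Proof. exact: lt_trans q_gt1. Qed.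
Let r0 : 0 < r. Proof. exact: mulr_gt0. Qed.
Let rD : 0 < r - D%:R.
Proof. by rewrite /r -[X in _ - X]mul1r -mulrBl mulr_gt0// subr_gt0. Qed.

(** Where |u| > K, |u|^D is |u|^r times a negative power of |u|, which is at most the same power of
    K; here r > D because q > 1. *)
Lemma clip_tail_le (K u : R) : 1 <= K ->
  `|u - clip K u| ^+ D <= `|u| `^ r * K `^ (- (r - D%:R)).
Proof.
move=> K1; have K0 : 0 < K by exact: lt_le_trans K1.
rewrite sub_clipE; last exact: ltW.
have [uK|Ku] := leP (`|u|) K.
  rewrite max_r ?subr_le0// expr0n eqn0Ngt D_gt0/=.
  by rewrite mulr_ge0// powR_ge0.
have u0 : 0 < `|u| by exact: lt_trans Ku.
rewrite max_l; last by rewrite subr_ge0 ltW.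
apply: (@le_trans _ _ (`|u| ^+ D)).
  rewrite lerXn2r ?nnegrE//; first by rewrite subr_ge0 ltW.
  by rewrite gerBl ltW.
rewrite -powR_mulrn//.
have -> : `|u| `^ D%:R = `|u| `^ r * `|u| `^ (- (r - D%:R)).
  rewrite -powRD; first by rewrite opprB addrC subrK.
  by apply/implyP => _; rewrite gt_eqF.
rewrite ler_wpM2l ?powR_ge0// !powRN lef_pV2 ?posrE ?powR_gt0//.
by apply: ge0_ler_powR => //; rewrite ?nnegrE ltW.
Qed.

(** [Rintegral_block2] exchanges [kappa] for the unrelabelled grid, on which the block kernel is the
    step kernel almost everywhere. *)
Lemma block_moment n (Q : 'M[R]_n.+1) (kappa : TR -> 'I_n.+1) :
  measurable_fun setT kappa ->
  (forall j, P (kappa @^-1` [set j]) = (n.+1%:R^-1)%:E) ->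
  (Lr_norm r (step_kernel Q) <= C%:E)%E ->
  \int[prod_prob P P]_z (`|block_kernel kappa Q z| `^ r) <= C `^ r.
Proof.
move=> mk kP nC; pose F i j := `|Q i j| `^ r.
have mc := @measurable_cell R n.
have cP := @unit_leb_cell R n.
have F0 i j : 0 <= F i j by exact: powR_ge0.
pose a := \int[prod_prob P P]_z F (cell n z.1) (cell n z.2).
have -> : \int[prod_prob P P]_z (`|block_kernel kappa Q z| `^ r) = a.
  by rewrite /a (Rintegral_block2 mc cP F) (Rintegral_block2 mk kP F).
have a0 : 0 <= a by apply: Rintegral_ge0.
have iF := intg_block2 P mc F.
have E : (\int[@unit_leb2 R]_z (`|(step_kernel Q z)%:E| `^ r) = a%:E)%E.
  rewrite /a -(Rintegral_fin iF); apply: ae_eq_integral => //.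
  - under eq_fun do rewrite abse_EFin poweR_EFin.
    apply/measurable_EFinP.
    apply: (measurableT_comp (measurable_powR r)).
    by apply: (measurableT_comp (@normr_measurable R setT)); exact: measurable_step_kernel.
  - by case/integrableP: iF.
  have h := ae_prod (ae_unit_itv0 R) (ae_unit_itv0 R).
  apply: filterS h => -[x y] /= [hx hy] _.
  by rewrite step_kernel_cell.
move: nC; rewrite /Lr_norm Lnorm.unlock/= E poweR_EFin lee_fin => aC.
have -> : a = (a `^ r^-1) `^ r by rewrite -powRrM mulVf ?gt_eqF// powRr1.
apply: ge0_ler_powR => //; rewrite ?nnegrE ?powR_ge0//; first exact: ltW.
exact: le_trans (powR_ge0 _ _) aC.
Qed.

Lemma block_tail (eta : R) : 0 < eta -> exists2 K, 1 <= K &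
  forall n (Q : 'M[R]_n.+1) (kappa : TR -> 'I_n.+1), measurable_fun setT kappa ->
    (forall j, P (kappa @^-1` [set j]) = (n.+1%:R^-1)%:E) ->
    (Lr_norm r (step_kernel Q) <= C%:E)%E ->
  norm_lt P D (fun z => block_kernel kappa Q z - clip K (block_kernel kappa Q z)) eta.
Proof.
move=> eta0; pose t := r - D%:R; have eD : 0 < eta ^+ D by rewrite exprn_gt0.
pose b := C `^ r / eta ^+ D.
have b0 : 0 <= b by rewrite divr_ge0 ?powR_ge0// ltW.
(* Chosen so that K^(r - D) exceeds C^r / eta^D, which makes the bound of [clip_tail_le] integrate
   to less than eta^D. *)
pose K := 1 + b `^ t^-1; have K1 : 1 <= K by rewrite lerDl powR_ge0.
have Kb : b < K `^ t.
  have -> : b = (b `^ t^-1) `^ t by rewrite -powRrM mulVf ?gt_eqF// powRr1.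
  apply: gt0_ltr_powR => //; rewrite ?nnegrE ?powR_ge0//.
    by rewrite (le_trans ler01).
  by rewrite /K ltrDr.
exists K => // n Q kappa mk kP nC; split=> //.
  apply: (measurable_block2 mk (fun i j => Q i j - clip K (Q i j))).
pose F i j := `|Q i j - clip K (Q i j)| ^+ D.
pose F' i j := `|Q i j| `^ r.
have iF := intg_block2 P mk F.
have iF' := intg_block2 P mk F'.
rewrite (Rintegral_fin iF) lte_fin.
apply: (@le_lt_trans _ _ (K `^ (- t) * \int[prod_prob P P]_z F' (kappa z.1) (kappa z.2))).
  rewrite -RintegralZl//; apply: le_Rintegral => //; first exact: intgZl.
  by move=> z _; rewrite mulrC; exact: clip_tail_le.
apply: (@le_lt_trans _ _ (K `^ (- t) * C `^ r)).
  by rewrite ler_wpM2l ?powR_ge0//; exact: block_moment.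
have Kt : 0 < K `^ t by rewrite powR_gt0// (lt_le_trans ltr01).
rewrite powRN mulrC ltr_pdivrMr// mulrC -ltr_pdivrMr//.
Qed.

End tails.

End step_kernels.

(** * The large deviation principle *)

Section exponential_rates.
Context (R : realType).

Lemma lne_rate_ge k (x b : R) : expR (- (k.+1%:R * b)) <= x ->
  ((- b)%:E <= k.+1%:R^-1%:E * lne x%:E)%E.
Proof.
move=> hx; have x0 : 0 < x by apply: lt_le_trans hx; exact: expR_gt0.
rewrite lne_EFin// -EFinM lee_fin ler_pdivlMl// mulrN -[leLHS]expRK.
by rewrite ler_ln ?posrE ?expR_gt0.
Qed.

Lemma lne_rate_le k (x b : R) : 0 <= x -> x <= expR (- (k.+1%:R * b)) ->
  (k.+1%:R^-1%:E * lne x%:E <= (- b)%:E)%E.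
Proof.
rewrite le_eqVlt => /orP[/eqP <- _|x0 hx].
  rewrite le0_lneNy// gt0_muleNy ?leNye// lte_fin invr_gt0//.
rewrite lne_EFin// -EFinM lee_fin ler_pdivrMl// mulrN -[leRHS]expRK.
by rewrite ler_ln ?posrE ?expR_gt0.
Qed.

Lemma near_succ (A : nat -> Prop) :
  (\forall k \near \oo, A k.+1) -> \forall n \near \oo, A n.
Proof.
move=> [N _ hN]; exists N.+1 => // -[//|n] /= Nn; exact: hN.
Qed.

Lemma LDP_of_counts (d : nat -> measure_display)
    (Omega : forall n, measurableType (d n))
    (P : forall n, probability (Omega n) R)
    (T : forall n, Omega n -> R) (J : R -> \bar R) (prob : nat -> set R -> R) :
  (forall n F, P n.+1 (@T n.+1 @^-1` F) = (prob n F)%:E) ->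
  (forall t, (0 <= J t)%E) -> (forall a : R, compact [set t | (J t <= a%:E)%E]) ->
  (forall F t (b : R), F^° t -> (J t < b%:E)%E ->
    \forall n \near \oo, expR (- (n.+1%:R * b)) <= prob n F) ->
  (forall F (b dl : R), (forall t, closure F t -> (b%:E <= J t)%E) -> 0 < dl ->
    \forall n \near \oo, prob n F <= expR (- (n.+1%:R * (b - dl)))) ->
  LDP P T J.
Proof.
move=> probE J0 Jc low up; split=> // F mF.
have prob0 n : 0 <= prob n F by rewrite -lee_fin -probE.
pose r n := (n%:R^-1%:E * lne (P n (@T n @^-1` F)))%E.
have up' (b : R) : (forall t, closure F t -> (b%:E <= J t)%E) ->
    (limn_esup r <= (- b)%:E)%E.
  move=> hb; apply/lee_addgt0Pr => e e0; apply: limn_esup_le; apply: near_succ.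
  apply: filterS (up F b e hb e0) => n hn.
  by rewrite /r probE -EFinD -[- b + e]opprK opprD opprK; exact: lne_rate_le.
split; last 2 first.
- exact: limn_einf_sup.
- have : (ereal_inf [set J t | t in closure F] <= - limn_esup r)%E.
    have m0 : (0 <= ereal_inf [set J t | t in closure F])%E.
      by apply: le_ereal_inf_tmp => _ [t _ <-].
    case E : (ereal_inf _) m0 => [b| |] // m0.
      rewrite leeNr; apply: up' => t Ft; rewrite -E.
      by apply: ereal_inf_lbound; exists t.
    (* The rate is infinite on the closure of F, so the upper bound holds with every real b. *)
    have -> // : (- limn_esup r)%E = +oo%E.
    apply/eqyP => A _; rewrite leeNr; apply: up' => t Ft.
    rewrite (le_trans (leey _))// -E.
    by apply: ereal_inf_lbound; exists t.
  by rewrite leeNr.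
rewrite leeNl; apply: le_ereal_inf_tmp => _ [t Ft <-].
case E : (J t) (J0 t) => [b| |] // _; last by rewrite leey.
apply/lee_addgt0Pr => e e0; rewrite leeNl -EFinD -EFinN.
apply: limn_einf_ge; apply: near_succ.
have tb : (J t < (b + e)%:E)%E by rewrite E lte_fin ltrDl.
apply: filterS (low F t _ Ft tb) => n hn.
by rewrite /r probE; exact: lne_rate_ge.
Qed.

End exponential_rates.

Lemma sum_prob_ord (R : realType) (c : nat) (mu : probability 'I_c.+1 R) :
  \sum_r fine (mu [set r]) = 1.
Proof.
apply: EFin_inj; rewrite -sumEFin -(@probability_setT _ _ _ mu).
have -> : [set: 'I_c.+1] = \bigcup_(r in [set` enum 'I_c.+1]) [set r].
  by apply/seteqP; split=> // r _; exists r => //=; rewrite mem_enum.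
rewrite measure_fin_bigcup//; last by move=> r s _ _ [x [-> ->]].
rewrite -fsbig_seq ?enum_uniq// big_enum/=; apply: eq_bigr => r _.
by rewrite fineK// fin_num_measure.
Qed.

Section count_LDP.
Context (R : realType) (v : nat) (H : rel 'I_v) (c : nat).
Hypothesis v_gt0 : (0 < v)%N.
Variable mu : probability 'I_c.+1 R.
Hypothesis mu_pos : forall r, (0 < mu [set r])%E.
Variables (d : nat -> measure_display) (Omega : forall n, measurableType (d n)).
Variables (P : forall n, probability (Omega n) R).
Variable X : forall n, 'I_n -> {mfun Omega n >-> 'I_c.+1}.
Hypothesis X_iid : forall n, iid (P n) mu (@X n).

Local Notation TR := (measurableTypeR R).
Local Notation p := (fun r => fine (mu [set r])).

Lemma count_LDP (Q : forall n, 'M[R]_n) (W : R * R -> R) (D : nat)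
    (kappa : forall n, TR -> 'I_n.+1) :
  (0 < D)%N ->
  (forall a : 'I_v,
    (#|[pred e : 'I_v * 'I_v | edge H e && ((e.1 == a) || (e.2 == a))]| <= D)%N) ->
  (forall n, measurable_fun setT (kappa n)) ->
  (forall n j, unit_leb R (kappa n @^-1` [set j]) = (n.+1%:R^-1)%:E) ->
  (@unit_leb2 R).-integrable setT (EFin \o W) ->
  (forall eps : R, 0 < eps -> \forall n \near \oo,
    cut_le (unit_leb R) (fun z => block_kernel (kappa n) (Q n.+1) z - W z) eps) ->
  (forall eta : R, 0 < eta -> exists2 K, 1 <= K &
    \forall n \near \oo, norm_lt (unit_leb R) D
      (fun z => block_kernel (kappa n) (Q n.+1) z -
        clip K (block_kernel (kappa n) (Q n.+1) z)) eta) ->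
  LDP P (fun n w => N2 H (Q n) (fun i => X i w)) (I2 H p W).
Proof.
move=> D0 Hd mk kP iW UW Ut.
have p0 r : 0 < p r by rewrite fine_gt0// mu_pos ltey_eq fin_num_measure.
have p1 := sum_prob_ord mu.
have [N [_ WN _]] := kernel_norms D0 mk iW UW Ut.
have -> : I2 H p W = rate (unit_leb R) H (W : TR * TR -> R) p.
  by apply/funext => t; exact: (I2_rate D0 Hd WN p0 p1).
apply: (LDP_of_counts (prob := fun n F =>
    \sum_(x : {ffun 'I_n.+1 -> 'I_c.+1} | `[< F (N2 H (Q n.+1) x) >])
      prod_weight (fun=> p) x)).
- move=> n F; rewrite -(iid_prob (X_iid n.+1)
    (fun x : {ffun 'I_n.+1 -> 'I_c.+1} => `[< F (N2 H (Q n.+1) x) >])).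
  congr (P n.+1 _); apply/funext => w /=.
  have -> : N2 H (Q n.+1) (fun i => X i w) =
      N2 H (Q n.+1) [ffun i : 'I_n.+1 => X i w].
    by congr N2; apply/funext => i; rewrite ffunE.
  by apply/propext; split => /asboolP.
- exact: (rate_ge0 _ H _ p0 p1).
- move=> a; exact: (@rate_compact _ _ _ _ _ _ _ _ D0 Hd _ _ _ mk iW UW Ut _ p0 p1 a).
- move=> F t b; exact: (count_ldp_lower v_gt0 D0 Hd mk kP iW UW Ut p0 p1).
- move=> F b dl; exact: (count_ldp_upper v_gt0 D0 Hd mk kP iW UW Ut p0 p1).
Qed.

End count_LDP.

Lemma eq_N2 (R : realType) (v c : nat) (H : rel 'I_v) n (Q Q' : 'M[R]_n) (x : 'I_n -> 'I_c) :
  (forall e, ~~ edge H e) -> N2 H Q x = N2 H Q' x.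
Proof.
move=> noE; congr (_ * _); apply: eq_bigr => i _; congr (_ * _).
by rewrite !big1// => e he; have := noE e; rewrite he.
Qed.

Lemma eq_I2 (R : realType) (v c : nat) (H : rel 'I_v) (p : 'I_c -> R)
    (W W' : R * R -> R) : (forall e, ~~ edge H e) -> I2 H p W = I2 H p W'.
Proof.
move=> noE; have G2E f : G2 H W f = G2 H W' f.
  apply: eq_bigr => r _; apply: eq_integral => x _; congr ((_ * _)%:E).
  by rewrite !big1// => e he; have := noE e; rewrite he.
apply/funext => t; congr ereal_inf; apply/seteqP; split=> _ [f [fp fG] <-].
  by exists f => //; split=> //; rewrite -G2E.
by exists f => //; split=> //; rewrite G2E.
Qed.

Lemma mp_bijection_id (R : realType) : mp_bijection (@idfun (measurableTypeR R)).
Proof.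
by split=> //; exact: measurable_id.
Qed.

Lemma near_shift (A : nat -> Prop) :
  (\forall n \near \oo, A n) -> \forall n \near \oo, A n.+1.
Proof. by move=> [N _ hN]; exists N => // n Nn; apply: hN; exact: leqW. Qed.

Theorem corollary1p7 (R : realType)
  (v : nat) (v_ge2 : (2 <= v)%N)
  (H : rel 'I_v) (H_sym : symmetric H) (H_irr : irreflexive H)
  (c : nat) (mu : probability 'I_c.+1 R)
  (mu_nondeg : nondegenerate_prob mu)
  (mu_pos : forall r, (0 < mu [set r])%E)
  (d : nat -> measure_display) (Omega : forall n, measurableType (d n))
  (P : forall n, probability (Omega n) R)
  (X : forall n, 'I_n -> {mfun Omega n >-> 'I_c.+1})
  (X_iid : forall n, iid (P n) mu (@X n))
  (Q : forall n, 'M[R]_n)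
  (Q_sym : forall n i j, Q n i j = Q n j i)
  (Q_diag : forall n i, Q n i i = 0)
  (W : R * R -> R) (W_L1 : kernel_L1 W)
  (Q_cvg : (fun n => delta_cut (step_kernel (Q n)) W) @ \oo --> 0%E)
  (q : R) (q_gt1 : 1 < q)
  (Q_bound :
    (limn_esup (fun n => Lr_norm (q * (max_degree H)%:R) (step_kernel (Q n)))
     < +oo)%E) :
  LDP P (fun n w => N2 H (Q n) (fun i => X n i w))
    (I2 H (fun r => fine (mu [set r])) W).
Proof.
have v_gt0 : (0 < v)%N by exact: ltnW.
have Hd a := edge_degree a H_sym.
have [D0|D0] := posnP (max_degree H).
  (* Q_bound is void here, but N2 and G2 depend neither on Q nor on W. *)
  have noE e : ~~ edge H e.
    apply/negP => he; have := Hd e.1; rewrite D0 leqn0 => /eqP/card0_eq/(_ e).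
    by rewrite !inE he eqxx.
  rewrite (eq_I2 _ W (fun=> 0) noE).
  rewrite (_ : (fun n w => _) = (fun n w => N2 H (0 : 'M[R]_n) (fun i => X n i w))).
    (* For the zero kernels all norm conditions are trivial and the positive degree bound 1 is
       available. *)
    apply: (count_LDP v_gt0 mu_pos X_iid (Q := fun n => 0) (D := 1%N)
      (kappa := fun n => @cell R n)) => //.
    - by move=> a; rewrite (leq_trans (Hd a))// D0.
    - by move=> n; exact: measurable_cell.
    - by move=> n j; exact: unit_leb_cell.
    - exact: (intg_cst (prod_prob (unit_leb R) (unit_leb R)) 0).
    - move=> eps e0; apply: nearW => n S S' _ _.
      rewrite Rintegral_setE (@eq_Rintegral _ _ _ _ _ (fun=> 0)).
        by rewrite [X in `|X|](@prob_cst _ _ _ (prod_prob _ _)) normr0 ltW.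
      by move=> z _; rewrite /block_kernel mxE subr0 mul0r.
    move=> eta e0; exists 1 => //; apply: nearW => n.
    rewrite (_ : (fun z => _) = fun=> 0); first exact: norm_lt0.
    apply/funext => z; rewrite /block_kernel mxE clip_id ?subr0// normr0//.
  by apply: functional_extensionality_dep => n; apply/funext => w; exact: eq_N2.
have [C hC] : exists C : R, \forall n \near \oo,
    (Lr_norm (q * (max_degree H)%:R) (step_kernel (Q n)) <= C%:E)%E.
  move: Q_bound; case E : (limn_esup _) => [l| |] // _.
    exists (l + 1); have lt : (limn_esup (fun n =>
        Lr_norm (q * (max_degree H)%:R) (step_kernel (Q n))) < (l + 1)%:E)%E.
      by rewrite E lte_fin ltrDl.
    by apply: filterS (limn_esup_lt_near lt) => n /ltW.
  exists 0; have lt : (limn_esup (fun n =>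
      Lr_norm (q * (max_degree H)%:R) (step_kernel (Q n))) < 0%:E)%E.
    by rewrite E ltNye.
  by apply: filterS (limn_esup_lt_near lt) => n /ltW.
pose dc n := delta_cut (step_kernel (Q n.+1)) W.
(* The infimum in [delta_cut] need not be attained, so a bijection within 1 / n.+1 of it is taken.
   The identity fills in where the distance is not finite, which happens for finitely many n
   only. *)
have /choice[s sP] n : exists s, mp_bijection s /\ (dc n \is a fin_num ->
    (cut_dist (relabel s (step_kernel (Q n.+1))) W <= dc n + n.+1%:R^-1%:E)%E).
  have [fn|nf] := boolP (dc n \is a fin_num); last first.
    by exists idfun; split=> //; exact: mp_bijection_id.
  have : (dc n < dc n + n.+1%:R^-1%:E)%E by rewrite lteDl// lte_fin.
  by move=> /ereal_inf_lt[_ [s sP <-] /ltW h]; exists s.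
apply: (count_LDP v_gt0 mu_pos X_iid (kappa := fun n => @relabelled_cell R (s n) n)
  D0 Hd).
- by move=> n; apply: measurable_relabelled_cell; have [] := sP n.
- by move=> n j; apply: unit_leb_relabelled_cell; have [] := sP n.
- by case: W_L1.
- move=> eps e0; have e2 : 0 < eps / 2 by rewrite divr_gt0.
  have /fine_cvgP[h1 h2] := Q_cvg.
  have {}h2 : \forall n \near \oo,
      `|fine (delta_cut (step_kernel (Q n)) W)| <= eps / 2.
    by move/cvgr0Pnorm_le : h2; apply.
  near=> n.
  have dfin : dc n \is a fin_num by near: n; exact: near_shift h1.
  have hd : `|fine (dc n)| <= eps / 2 by near: n; exact: near_shift h2.
  have hn : n.+1%:R^-1 <= eps / 2.
    by apply/ltW; near: n; exact: (near_infty_natSinv_lt (PosNum e2)).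
  have [sb /(_ dfin) hs] := sP n; apply: cut_le_relabel => //.
  apply: (le_trans hs); rewrite -(fineK dfin) -EFinD lee_fin [leRHS]splitr.
  by rewrite lerD// (le_trans (ler_norm _)).
move=> eta eta0; have [K K1 hK] := block_tail C q_gt1 D0 eta0; exists K => //.
apply: filterS (near_shift hC) => n hn; apply: hK => //.
- by apply: measurable_relabelled_cell; have [] := sP n.
- by move=> j; apply: unit_leb_relabelled_cell; have [] := sP n.
Unshelve. all: by end_near. Qed.
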